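(* Let $\mathcal L$ be the vector space of integrable functions $f$ on $\mathbb R^n$ satisfying $$\int_{\mathbb R^n}|f|\left(\ln_+|f|+\ln_+|x|\right)dx<\infty.$$ Then $\mathcal L$ is the largest vector space $S$ of integrable functions on $\mathbb R^n$ with the following property: if $g\in S$ and $f$ is an integrable function such that $|f|\le|g|$ and $\int_{\mathbb R^n}f\,dx=0$, then $f\in\mathcal H^1(\mathbb R^n)$. That is, $\mathcal L$ has this property, and every vector space $S$ of integrable functions having this property is contained in $\mathcal L$.
   Context: $\ln_+=\max(\ln,0)$, with $\ln_+(0)=0$. Let $\varphi$ be a smooth function on $\mathbb R^n$ supported in the unit ball with nonzero integral, $\varphi_t(x)=t^{-n}\varphi(t^{-1}x)$ for $t>0$, and $\mathcal M_\varphi f(x)=\sup_{t>0}|\varphi_t*f(x)|$. The Hardy space $\mathcal H^1(\mathbb R^n)$ is the space of $f\in L^1(\mathbb R^n)$ such that $\|\mathcal M_\varphi f\|_1<\infty$ (it is standard that the space does not depend on the choice of $\varphi$). *)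

(* Defs.v *)
From HB Require Import structures.
From mathcomp Require Import all_boot all_order all_algebra.
From mathcomp Require Import all_classical all_reals all_analysis.
Set Implicit Arguments.
Unset Strict Implicit.
Unset Printing Implicit Defensive.
Import Order.TTheory GRing.Theory Num.Theory.
Import numFieldNormedType.Exports.
Local Open Scope classical_set_scope.
Local Open Scope ring_scope.

Section measurable_rV.
Context {R : realType} (n : nat).

Definition rV_coord (i : 'I_n) (x : 'rV[R]_n) : R := x ord0 i.

Let rV_set0 : g_sigma_preimage rV_coord set0.
Proof. exact: sigma_algebra0. Qed.

Let rV_setC A : g_sigma_preimage rV_coord A -> g_sigma_preimage rV_coord (~` A).
Proof. exact: sigma_algebraC. Qed.

Let rV_bigcup (F : (set 'rV[R]_n)^nat) :
  (forall i, g_sigma_preimage rV_coord (F i)) ->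
  g_sigma_preimage rV_coord (\bigcup_i F i).
Proof. exact: sigma_algebra_bigcup. Qed.

(* Smallest sigma-algebra making the coordinates measurable, i.e. the Borel
   sigma-algebra of R^n. *)
HB.instance Definition _ := @isMeasurable.Build default_measure_display
  'rV[R]_n (g_sigma_preimage rV_coord) rV_set0 rV_setC rV_bigcup.

End measurable_rV.

Section lebesgue_rV.
Context {R : realType}.

Definition rV_cons n (p : R * 'rV[R]_n) : 'rV[R]_n.+1 :=
  row_mx (const_mx p.1 : 'rV[R]_1) p.2.

Lemma measurable_rV_coord n (i : 'I_n) :
  measurable_fun [set: 'rV[R]_n] (rV_coord i).
Proof.
move=> _ Y mY; rewrite setTI; apply: sub_sigma_algebra => /=.
rewrite -bigcup_seq/=; exists i => /=; first by rewrite mem_index_enum.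
by exists Y => //; rewrite setTI.
Qed.

Lemma measurable_fun_rVP d (T : measurableType d) n (f : T -> 'rV[R]_n) :
  (forall i, measurable_fun setT (rV_coord i \o f)) -> measurable_fun setT f.
Proof.
move=> mf; have prefS : g_sigma_preimage (fun i => rV_coord i \o f) `<=`
    @measurable d T.
  apply: smallest_sub; first exact: sigma_algebra_measurable.
  rewrite -bigcup_seq; apply: bigcup_sub => i _.
  by move=> A [B mB <-]; exact: mf.
rewrite g_sigma_preimage_comp in prefS.
by move=> _ A mA; apply: prefS; exists A.
Qed.

Lemma measurable_rV_cons n : measurable_fun setT (@rV_cons n).
Proof.
apply: measurable_fun_rVP => i.
case: (split_ordP (i : 'I_(1 + n))) => j ->.
  apply: (eq_measurable_fun fst); last exact: measurable_fst.
  move=> p _; apply/esym; rewrite /= /rV_coord /rV_cons.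
  by etransitivity; [exact: row_mxEl|rewrite mxE].
apply: (eq_measurable_fun (rV_coord j \o snd)).
  by move=> p _; apply/esym; exact: row_mxEr.
by apply: measurableT_comp => //; exact: measurable_rV_coord.
Qed.

Definition rV_uncons n (x : 'rV[R]_n.+1) : R * 'rV[R]_n :=
  (x ord0 ord0, rsubmx (x : 'rV_(1 + n))).

Lemma rV_consK n : cancel (@rV_cons n) (@rV_uncons n).
Proof.
move=> [a x]; rewrite /rV_uncons /rV_cons row_mxKr; congr pair.
transitivity (row_mx (const_mx a : 'rV[R]_1) x ord0 (lshift n ord0)).
  by congr (_ _ _); exact/val_inj.
by rewrite row_mxEl mxE.
Qed.

Lemma measurable_rV_uncons n : measurable_fun setT (@rV_uncons n).
Proof.
apply: measurable_fun_pair => /=; first exact: (measurable_rV_coord ord0).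
apply: measurable_fun_rVP => i.
apply: (eq_measurable_fun (rV_coord (rshift 1 i : 'I_n.+1))).
  by move=> x _; rewrite /= /rV_coord mxE.
exact: measurable_rV_coord.
Qed.

End lebesgue_rV.

Section lebesgue_rVS.
Context {R : realType} n (mu : {sigma_finite_measure set 'rV[R]_n -> \bar R}).
Local Open Scope ereal_scope.

Definition lebesgue_rVS : set 'rV[R]_n.+1 -> \bar R :=
  pushforward (@lebesgue_measure R \x mu) (@rV_cons R n).

Let mpre A : measurable A -> measurable (@rV_cons R n @^-1` A).
Proof.
by move=> mA; rewrite -[X in measurable X]setTI; exact: measurable_rV_cons.
Qed.

Let lebesgue_rVS0 : lebesgue_rVS set0 = 0.
Proof. by rewrite /lebesgue_rVS /pushforward preimage_set0 measure0. Qed.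

Let lebesgue_rVS_ge0 A : 0 <= lebesgue_rVS A.
Proof. rewrite /lebesgue_rVS /pushforward; exact: measure_ge0. Qed.

Let lebesgue_rVS_sigma_additive : semi_sigma_additive lebesgue_rVS.
Proof.
move=> F mF tF mUF; rewrite /lebesgue_rVS /pushforward preimage_bigcup.
apply: measure_semi_sigma_additive.
- by move=> i; exact: mpre.
- apply/trivIsetP => /= i j _ _ ij; rewrite -preimage_setI.
  by move/trivIsetP : tF => /(_ _ _ _ _ ij) ->//; rewrite preimage_set0.
- by rewrite -preimage_bigcup; exact: mpre.
Qed.

HB.instance Definition _ := isMeasure.Build _ _ _ lebesgue_rVS
  lebesgue_rVS0 lebesgue_rVS_ge0 lebesgue_rVS_sigma_additive.

Let lebesgue_rVS_sigma_finite : sigma_finite setT lebesgue_rVS.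
Proof.
have /sigma_finiteP[F [TF ndF Foo]] := sigma_finiteT (@lebesgue_measure R).
have /sigma_finiteP[G [TG ndG Goo]] := sigma_finiteT mu.
exists (fun k => @rV_uncons R n @^-1` (F k `*` G k)).
  rewrite -preimage_bigcup -[LHS](preimage_setT (@rV_uncons R n)).
  congr (_ @^-1` _); rewrite -setXTT TF TG predeqE => -[x y]; split.
    move=> [/= [i _ Fix] [j _ Gjy]]; exists (maxn i j) => //; split.
    - by move: x Fix; exact/subsetPset/ndF/leq_maxl.
    - by move: y Gjy; exact/subsetPset/ndG/leq_maxr.
  by move=> [i _ []/= ? ?]; split; exists i.
move=> k; have [mF Fk] := Foo k; have [mG Gk] := Goo k.
have mFG : measurable (F k `*` G k) by exact: measurableX.
split.
  by rewrite -[X in measurable X]setTI; exact: measurable_rV_uncons.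
rewrite /lebesgue_rVS /pushforward -comp_preimage.
rewrite (_ : _ \o _ = id); last by apply/funext => p /=; exact: rV_consK.
by rewrite preimage_id product_measure1E// lte_mul_pinfty// ge0_fin_numE.
Qed.

HB.instance Definition _ := Measure_isSigmaFinite.Build _ _ _ lebesgue_rVS
  lebesgue_rVS_sigma_finite.

End lebesgue_rVS.

(* Lebesgue measure on R^n: the Dirac mass if n = 0, otherwise the product of
   lebesgue_measure with the measure in dimension n - 1 (see lebesgue_rV_box). *)
Fixpoint lebesgue_rV (R : realType) (n : nat) :
    {sigma_finite_measure set 'rV[R]_n -> \bar R} :=
  if n is m.+1 then lebesgue_rVS (lebesgue_rV R m) else \d_ (0 : 'rV[R]_0).

Lemma lebesgue_rV_box (R : realType) (n : nat) (A : 'I_n -> set R) :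
  (forall i, measurable (A i)) ->
  lebesgue_rV R n [set x | forall i, A i (x ord0 i)] =
  (\prod_(i < n) lebesgue_measure (A i))%E.
Proof.
have rV_consE m (a : R) (y : 'rV[R]_m) (i : 'I_m) :
    rV_cons (a, y) ord0 (lift ord0 i) = y ord0 i.
  transitivity (rV_cons (a, y) ord0 (rshift 1 i)); last exact: row_mxEr.
  by congr (_ _ _); exact/val_inj.
have rV_consE0 m (a : R) (y : 'rV[R]_m) : rV_cons (a, y) ord0 ord0 = a.
  exact: (congr1 fst (rV_consK (a, y))).
elim: n A => [|n IHn] A mA.
  by rewrite big_ord0 /= diracE mem_set// => -[].
rewrite big_ord_recl -IHn//= /lebesgue_rVS /pushforward.
pose B := [set x : 'rV[R]_n | forall i, A (lift ord0 i) (x ord0 i)].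
have mB : measurable B.
  rewrite (_ : B = \bigcap_(i in [set: 'I_n])
      (rV_coord i @^-1` A (lift ord0 i))).
    apply: fin_bigcap_measurable; first exact: finite_finset.
    move=> i _; rewrite -[X in measurable X]setTI.
    exact: measurable_rV_coord.
  by apply/seteqP; split => [x Bx i _|x Bx i]; [exact: Bx|exact: (Bx i I)].
rewrite -(product_measure1E lebesgue_measure (lebesgue_rV R n) (mA ord0) mB).
congr (_ _); apply/seteqP; split => -[a x] /=.
  move=> Ax; split; first by have := Ax ord0; rewrite rV_consE0.
  by move=> i; have := Ax (lift ord0 i); rewrite rV_consE.
move=> [Aa Bx] i; case: (unliftP ord0 i) => [j|] ->.
  by rewrite rV_consE; exact: Bx.
by rewrite rV_consE0.
Qed.

Section hardy.
Context {R : realType} {n : nat}.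
Implicit Types (f g phi : 'rV[R]_n -> R) (x y : 'rV[R]_n) (t : R).
Local Notation mu := (lebesgue_rV R n).

(* The library's norm on 'rV[R]_n is the sup norm. *)
Definition euclid_norm x : R := Num.sqrt (\sum_(i < n) x ord0 i ^+ 2).

(* ln is 0 on nonpositive reals, so ln_plus 0 = 0. *)
Definition ln_plus (r : R) : R := Num.max (ln r) 0.

Definition pderiv (i : 'I_n) f x : R := 'D_('e_i) f x.

Definition smooth_fun f := forall s : seq 'I_n,
  continuous (foldr pderiv f s) /\
  forall (i : 'I_n) x, derivable (foldr pderiv f s) x 'e_i.

Definition dilate phi t x : R := t ^- n * phi (t^-1 *: x).

Definition convolution f g x : R := \int[mu]_y (f (x - y) * g y).

Definition hardy_maximal phi f x : \bar R :=
  ereal_sup [set `|convolution (dilate phi t) f x|%:E | t in [set t : R | 0 < t]].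

(* Functions are represented by Borel functions; each L^1 class contains one. *)
Definition L1 f := mu.-integrable setT (EFin \o f).

Definition hardy phi f := L1 f /\ ('N[mu]_1[hardy_maximal phi f] < +oo)%E.

(* The integrand is nonnegative, so the integral is defined in [0, +oo]. *)
Definition LlogL f := L1 f /\
  (\int[mu]_x (`|f x| * (ln_plus `|f x| + ln_plus (euclid_norm x)))%:E < +oo)%E.

Definition L1_subspace (S : set ('rV[R]_n -> R)) :=
  GRing.submod_closed (mem S) /\ S `<=` L1.

Definition dominated_in_hardy phi (S : set ('rV[R]_n -> R)) :=
  forall g f, S g -> L1 f -> {ae mu, forall x, `|f x| <= `|g x|} ->
    \int[mu]_x f x = 0 -> hardy phi f.

End hardy.

(* Main.v *)
From HB Require Import structures.
Require Import Defs.
From mathcomp Require Import all_boot all_order all_algebra.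
From mathcomp Require Import all_classical all_reals all_analysis.
From mathcomp Require Import measurable_realfun.
From mathcomp Require Import ring lra zify.
Set Implicit Arguments.
Unset Strict Implicit.
Unset Printing Implicit Defensive.
Import Order.TTheory GRing.Theory Num.Theory.
Import numFieldNormedType.Exports.
Local Open Scope classical_set_scope.
Local Open Scope ring_scope.

(** Write M for the uncentred maximal function over cubes and |x| for the sup norm.
    That LlogL has the property is the classical argument: for f in LlogL of integral 0, small
    dilations are controlled by M applied to the pieces of f on dyadic shells, and large dilations
    (compared with |x|) use the cancellation, both with summable bounds.

    Conversely let g be in S and h = |g|.  Choosing f = h on a set carrying at most half of the mass
    of h, and f = - s h elsewhere with 0 <= s <= 1 making the integral 0, we may use that M_phi f is
    integrable.
    - Far away, phi does not vanish near some z0 <> 0, so on the disjoint cubes around 2^j z0 of size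
      ~ 2^j the function M_phi f is at least c 2^(-jn) int_{|y| >= 2^j} h up to a summable error;
      summing over j gives int h ln_+ |y| < oo.
    - Locally, take f = h on {M h > l_0} and, for l >= l_0, let Omega = {M h > l} and
      Omega' = {M h > A l}.  Testing M_phi f with the dilation t(x) = delta d(x, complement of
      Omega) on Omega \ Omega' and using Fubini, the integral of M_phi f there is at least
      |int_Omega h(y) b(y) dy|, where b(y) is the integral of phi_t(x)(x - y) over x.  Since t is
      almost constant at the scale of the support, and Omega' has small density in the Whitney cube
      at y, b is close to the integral of phi.  Summing over l = A^i l_0 gives
      sum_i int_{M h > A^i l_0} h < oo, that is int h ln_+ h < oo. *)

(** * Cubes and covering in R^n *)

(** Balls are those of the sup norm, that is cubes: their measure is explicit, rational ones form a
    countable base, and passing to the Euclidean norm changes [ln_plus] by at most ln n. The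
    logarithm of the converse arises because each test is made on a small set and yet sees a large
    mass. On Omega \ Omega' the maximal function controls the integral of h over all of Omega, while
    these differences are disjoint for successive levels: a point where h is large is counted once
    per level, but the maximal function is integrated only once. The cubes around 2^j z0 play the
    same role at infinity. The obstacle at a level is that a fixed scale t would mix the values of h
    in Omega with values of f outside, which may be negative. Taking t to be a small fraction of the
    distance to the complement confines the convolution to Omega. The price is that for fixed y the
    kernel is no longer a dilation of phi as a function of x. Two parameters pay for this: delta is
    fixed first, against the variation of t, and then A, against a power of 1 / delta, so that
    removing Omega' costs little. *)

Section geometry.
Context {R : realType} {n : nat}.
Local Notation V := ('rV[R]_n).
Local Notation mu := (lebesgue_rV R n).
Implicit Types (x y c : V) (r : R).

Lemma rV_ballP x y r : ball x r y <-> `|x - y| < r.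
Proof. by rewrite -ball_normE. Qed.

Lemma rV_ball_le0 x r : r <= 0 -> ball x r = set0.
Proof.
move=> r0; rewrite -subset0 => y /rV_ballP h.
by have := le_lt_trans (normr_ge0 _) h; rewrite ltNge r0.
Qed.

Lemma rV_ball_self x r : 0 < r -> ball x r x.
Proof. by move=> r0; apply/rV_ballP; rewrite subrr normr0. Qed.

Lemma rV_norm_ltP x r : 0 < r -> (`|x| < r) <-> forall i, `|x ord0 i| < r.
Proof.
move=> r0; have /(congr1 (fun f => f (0 : V) r x)) := @mx_norm_ball R 1 n.
rewrite /ball_ /= sub0r normrN => <-.
split=> [[_ h] i|h].
  by have := h ord0 i; rewrite -ball_normE /= mxE sub0r normrN.
by split=> // i j; rewrite -ball_normE /= mxE sub0r normrN (ord1 i).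
Qed.

Lemma rV_norm_leP x r : 0 <= r -> (`|x| <= r) <-> forall i, `|x ord0 i| <= r.
Proof.
move=> r0; split=> [h i|h]; apply/ler_addgt0Pr => e e0.
  apply/ltW; have /rV_norm_ltP : `|x| < r + e by rewrite (le_lt_trans h)// ltrDl.
  by apply; rewrite ltr_wpDl.
apply/ltW/rV_norm_ltP; first by rewrite ltr_wpDl.
by move=> i; rewrite (le_lt_trans (h i))// ltrDl.
Qed.

Lemma rV_coord_le x i : `|x ord0 i| <= `|x|.
Proof. exact: (rV_norm_leP x (normr_ge0 _)).1. Qed.

Lemma rV_ballE c r : 0 < r ->
  ball c r = [set x | forall i, `]c ord0 i - r, c ord0 i + r[%classic (x ord0 i)].
Proof.
move=> r0; apply/seteqP; split=> x /=.
  move=> /rV_ballP /(rV_norm_ltP _ r0) h i; have := h i.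
  by rewrite !mxE ltr_distlC in_itv.
move=> h; apply/rV_ballP/(rV_norm_ltP _ r0) => i; have := h i.
by rewrite /= !mxE ltr_distlC in_itv.
Qed.

Lemma lebesgue_rV_ball c r : 0 < r -> mu (ball c r) = ((2 * r) ^+ n)%:E.
Proof.
move=> r0; rewrite rV_ballE//.
rewrite (lebesgue_rV_box (A := fun i => `]c ord0 i - r, c ord0 i + r[%classic))//.
rewrite (eq_bigr (fun=> (2 * r)%:E)).
  by rewrite big_const card_ord; elim: {1 2}n => [|m IH] //=; rewrite IH exprS EFinM.
move=> i _; rewrite lebesgue_measure_itv /= lte_fin.
rewrite ifT; last by lra.
by rewrite -EFinB; congr EFin; lra.
Qed.

Lemma measurable_rV_ball c r : measurable (ball c r).
Proof.
have [r0|r0] := ltP 0 r; last by rewrite rV_ball_le0.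
have -> : ball c r = \bigcap_(i in [set: 'I_n])
    (@rV_coord R n i @^-1` `]c ord0 i - r, c ord0 i + r[%classic).
  rewrite rV_ballE//.
  by apply/seteqP; split => [x Bx i _|x Bx i]; [exact: Bx|exact: (Bx i I)].
apply: fin_bigcap_measurable; first exact: finite_finset.
move=> i _; rewrite -[X in measurable X]setTI.
by apply: measurable_rV_coord.
Qed.

(* Cubes with rational centre and radius, enumerated by nat; indices coding no pair, or a pair with
   nonpositive radius, give the empty ball. *)
Definition qcenter (i : nat) : V :=
  if unpickle i is Some p then map_mx ratr (p : 'rV[rat]_n * rat).1 else 0.
Definition qradius (i : nat) : R :=
  if unpickle i is Some p then ratr (p : 'rV[rat]_n * rat).2 else 0.
Definition qball i := ball (qcenter i) (qradius i).

Lemma qball_approx y e : 0 < e ->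
  exists i, [/\ 0 < qradius i, qball i y & qball i `<=` ball y e].
Proof.
move=> e0.
have [q] := rat_in_itvoo (divr_gt0 e0 (ltr0n R 4)).
rewrite in_itv /= => /andP[q0 qe].
have H (i : 'I_n) : {p : rat | ratr p \in `](y ord0 i - ratr q), (y ord0 i + ratr q)[}.
  have := @rat_in_itvoo R (y ord0 i - ratr q) (y ord0 i + ratr q).
  move=> h; apply: cid; apply: h; lra.
have q0' : 0 < ratr q :> R by lra.
(* A centre within [ratr q] of [y] and twice that as radius: [y] is inside, and the cube stays
   within [3 * ratr q < e] of [y]. *)
pose p := (\row_i sval (H i), 2 * q) : 'rV[rat]_n * rat.
exists (pickle p); rewrite /qball /qcenter /qradius pickleK /=.
have E : ratr (2 * q) = 2 * ratr q :> R by rewrite rmorphM /= ratr_nat.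
have C : `|map_mx ratr (\row_i sval (H i)) - y| <= ratr q.
  apply/rV_norm_leP; first by lra.
  move=> i; rewrite !mxE; case: (H i) => /= u.
  by rewrite in_itv /= -ltr_distl => /ltW.
rewrite E; split; first by lra.
  by apply/rV_ballP; lra.
move=> z /rV_ballP h; apply/rV_ballP.
rewrite distrC in C.
have := ler_distD (map_mx ratr (\row_i sval (H i))) y z; lra.
Qed.

(** Countability of the rational cubes is what makes open sets measurable for the sigma-algebra
    generated by the coordinates. *)
Lemma qball_cover (U : set V) : open U ->
  U = \bigcup_(i in [set i | 0 < qradius i /\ qball i `<=` U]) qball i.
Proof.
move=> oU; apply/seteqP; split=> [y Uy|y [i [_ iU] iy]]; last exact: iU.
have /nbhs_ballP[e /= e0 eU] : nbhs y U by exact: open_nbhs_nbhs.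
have [i [i0 iy ie]] := qball_approx y e0.
by exists i => //; split=> //; exact: subset_trans eU.
Qed.

Lemma open_measurable_rV (U : set V) : open U -> measurable U.
Proof.
move=> oU; rewrite (qball_cover oU); apply: bigcup_measurable => i _.
exact: measurable_rV_ball.
Qed.

Lemma continuous_measurable_rV (f : V -> R) : continuous f -> measurable_fun setT f.
Proof.
move=> /continuousP cf; apply: (measurability _ (RGenOpens.measurableE R)).
move=> _ [_ [a [b ->] <-]]; rewrite setTI.
by apply: open_measurable_rV; apply: cf; exact: interval_open.
Qed.

(** Greedy selection: keep a ball of largest radius, discard the balls that meet it, which lie in
    its triple, and recurse on the others. *)
Lemma vitali_finite (c : nat -> V) (r : nat -> R) (s : seq nat) :
  exists D : seq nat, [/\ {subset D <= s}, uniq D,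
    trivIset [set` D] (fun i => ball (c i) (r i)) &
    forall i, i \in s -> exists2 j, j \in D &
       ball (c i) (r i) `<=` ball (c j) (3 * r j)].
Proof.
have [m] := ubnP (size s); elim: m s => // m IH s sm.
case: s sm => [|i0 s0] sm; first by exists [::]; split => // i j /=.
set s := i0 :: s0 in sm *.
have [j js jmax] : exists2 j, j \in s & forall i, i \in s -> r i <= r j.
  have : s != [::] by [].
  elim: (s) => // a [|b t] IHt _.
    by exists a; rewrite ?mem_seq1 // => i; rewrite mem_seq1 => /eqP ->.
  have [//|j jt jm] := IHt.
  have [aj|ja] := leP (r a) (r j).
    exists j; first by rewrite in_cons jt orbT.
    by move=> i; rewrite in_cons => /orP[/eqP ->//|/jm].
  exists a; first by rewrite mem_head.
  move=> i; rewrite in_cons => /orP[/eqP ->//|/jm h].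
  exact: le_trans h (ltW ja).
pose dis i := `[< ball (c i) (r i) `&` ball (c j) (r j) = set0 >].
(* If the largest radius is nonpositive, every ball is empty and one index covers them all. *)
have [r0|r0] := leP (r j) 0.
  exists [:: j]; split => //.
  - by move=> i; rewrite mem_seq1 => /eqP ->.
  - by move=> i k /=; rewrite !mem_seq1 => /eqP -> /eqP ->.
  - move=> i is_; exists j; first exact: mem_head.
    by rewrite rV_ball_le0 // (le_trans (jmax _ is_)).
have [|D [Ds uD tD cD]] := IH [seq i <- s | dis i].
  apply: (@leq_trans (size s)); last by rewrite -ltnS.
  rewrite size_filter -(count_predC dis s) -addn1 leq_add2l.
  rewrite -has_count; apply/hasP; exists j => //=; apply/asboolP.
  rewrite setIid => jj0.
  by have := rV_ball_self (c j) r0; rewrite jj0.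
have Dd i : i \in D -> ball (c i) (r i) `&` ball (c j) (r j) = set0.
  by move=> /Ds; rewrite mem_filter => /andP[/asboolP].
exists (j :: D); split.
- move=> i; rewrite in_cons => /orP[/eqP ->//|/Ds].
  by rewrite mem_filter => /andP[].
- rewrite /= uD andbT; apply/negP => /Dd; rewrite setIid => jj0.
  by have := rV_ball_self (c j) r0; rewrite jj0.
- apply/trivIsetP => i k /=; rewrite !in_cons.
  move=> /orP[/eqP ->|iD] /orP[/eqP ->|kD] // ik.
  + by rewrite eqxx in ik.
  + by rewrite setIC Dd.
  + by rewrite Dd.
  + by move/trivIsetP : tD; apply.
- move=> i is_; have [di|] := boolP (dis i).
    have [|k kD h] := cD i; first by rewrite mem_filter di.
    by exists k => //; rewrite in_cons kD orbT.
  move=> /asboolP /eqP /set0P [z [/rV_ballP iz /rV_ballP jz]].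
  exists j; first exact: mem_head.
  move=> w /rV_ballP iw; apply/rV_ballP.
  have := jmax _ is_; rewrite distrC in iz.
  have := ler_distD z (c j) w; have := ler_distD (c i) z w; lra.
Qed.

Local Open Scope ereal_scope.

(** Used with the two measures in both orders: Lebesgue measure against the mass of a function for
    the weak type inequality, the reverse for the differentiation argument. The countable family is
    exhausted by finite ones, to which the finite selection applies. *)
Lemma vitali_measure (nu1 nu2 : {measure set V -> \bar R}) (C : R)
    (P : set nat) (c : nat -> V) (r : nat -> R) (U : set V) :
  measurable U -> (0 <= C)%R ->
  (forall i, P i -> nu1 (ball (c i) (3 * r i)%R) <= C%:E * nu2 (ball (c i) (r i))) ->
  (forall i, P i -> ball (c i) (r i) `<=` U) ->
  nu1 (\bigcup_(i in P) ball (c i) (r i)) <= C%:E * nu2 U.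
Proof.
move=> mU C0 H PU.
pose s N := [seq i <- iota 0 N | `[< P i >]].
pose F N := \bigcup_(i in [set` s N]) ball (c i) (r i).
have mF N : measurable (F N).
  by apply: bigcup_measurable => i _; exact: measurable_rV_ball.
have -> : \bigcup_(i in P) ball (c i) (r i) = \bigcup_N F N.
  apply/seteqP; split=> [x [i Pi ix]|x [N _ [i + ix]]].
    exists i.+1 => //; exists i => //=.
    by rewrite mem_filter mem_iota /= add0n ltnSn andbT; apply/asboolP.
  by rewrite /= mem_filter => /andP[/asboolP Pi _]; exists i.
have /(@nondecreasing_cvg_mu _ _ _ nu1)cv : nondecreasing_seq F.
  apply/nondecreasing_seqP => N; apply/subsetPset => x [i + ix].
  rewrite /= mem_filter mem_iota => /andP[Pi iN]; exists i => //=.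
  by rewrite mem_filter mem_iota Pi /=; lia.
have {}cv := cv mF (bigcup_measurable (fun N _ => mF N)).
rewrite -(cvg_lim _ cv)//; apply: lime_le; first by apply/cvg_ex; eexists; exact: cv.
apply: nearW => N /=.
have [D [Ds uD tD cD]] := vitali_finite c r (s N).
have DP i : i \in D -> P i by move=> /Ds; rewrite mem_filter => /andP[/asboolP].
apply: (@le_trans _ _ (nu1 (\big[setU/set0]_(i <- D) ball (c i) (3 * r i)))).
  apply: le_measure; rewrite ?inE//.
    by apply: bigsetU_measurable => i _; exact: measurable_rV_ball.
  move=> x [i /= /cD[j jD h] /h jx].
  by rewrite -bigcup_seq; exists j.
apply: (@le_trans _ _ (\sum_(i <- D) nu1 (ball (c i) (3 * r i)))).
  elim: (D) => [|a t IHt]; first by rewrite !big_nil measure0.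
  rewrite !big_cons; apply: le_trans (measureU2 _ _ _) _; rewrite ?lee_add2l//.
  - exact: measurable_rV_ball.
  - by apply: bigsetU_measurable => i _; exact: measurable_rV_ball.
  - by rewrite leeD2l.
apply: (@le_trans _ _ (\sum_(i <- D) C%:E * nu2 (ball (c i) (r i)))).
  by rewrite !big_seq; apply: lee_sum => i iD; apply: H; exact: DP.
rewrite -ge0_sume_distrr//.
apply: lee_wpmul2l; first by rewrite lee_fin.
rewrite fsbig_seq// -measure_fin_bigcup//; last first.
  by move=> i _; exact: measurable_rV_ball.
apply: le_measure; rewrite ?inE//.
  by apply: bigcup_measurable => i _; exact: measurable_rV_ball.
by move=> x [i /= /DP /PU]; exact.
Qed.

End geometry.
Arguments qradius {R} n i.
Arguments qball {R n} i.

(** * Measures with a density *)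

Section density.
Context d {T : measurableType d} {R : realType} (mu : {measure set T -> \bar R}).
Variable h : T -> R.
Hypotheses (h0 : forall x, 0 <= h x) (mh : measurable_fun setT h).
Local Open Scope ereal_scope.

Definition density_set E := \int[mu]_(x in E) (h x)%:E.

Let d0 : density_set set0 = 0. Proof. exact: integral_set0. Qed.
Let dge0 E : 0 <= density_set E.
Proof. by apply: integral_ge0 => x _; rewrite lee_fin. Qed.
Let dadd : semi_sigma_additive density_set.
Proof.
move=> F mF tF mUF; rewrite /density_set ge0_integral_bigcup//.
- by apply: is_cvg_ereal_nneg_natsum_cond => k _ _; apply: dge0.
- by apply/measurable_EFinP; exact: measurable_funS mh.
- by move=> x _; rewrite lee_fin.
Qed.

(** Packed as a measure so that the covering lemma and continuity along decreasing sequences apply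
    to the mass of [h]. *)
Definition density : {measure set T -> \bar R} := HB.pack density_set
  (isMeasure.Build _ _ _ density_set d0 dge0 dadd).

Lemma densityE E : density E = \int[mu]_(x in E) (h x)%:E. Proof. by []. Qed.

End density.

(** * Outer regularity of finite Borel measures *)

Section regularity.
Context {R : realType} {n : nat}.
Local Notation V := ('rV[R]_n).

(** Measurability on ['rV[R]_n] is defined through the coordinates; since these are continuous, one
    may argue from open sets instead. *)
Lemma measurable_rV_open (A : set V) : measurable A -> <<s @open V >> A.
Proof.
apply: smallest_sub; first exact: smallest_sigma_algebra.
rewrite -bigcup_seq; apply: bigcup_sub => i _ _ [B mB <-].
have : measurable_fun [set: g_sigma_algebraType (@open V)]
    (rV_coord i : g_sigma_algebraType (@open V) -> R).
  apply: (measurability _ (RGenOpens.measurableE R)).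
  move=> _ [_ [a [b ->] <-]]; rewrite setTI.
  apply: sub_sigma_algebra.
  have /continuousP : continuous (@rV_coord R n i) by exact: coord_continuous.
  by apply; exact: interval_open.
by move=> /(_ measurableT B mB).
Qed.

Variable nu : {measure set V -> \bar R}.
Hypothesis nufin : (nu setT < +oo)%E.
Local Open Scope ereal_scope.

(** Approximation is asked from both sides, by closed sets inside and open sets outside: the
    two-sided property passes to complements, so that the regular sets form a sigma-algebra. *)
Definition regular_set A := forall e : R, (0 < e)%R -> exists U C,
  [/\ open U, closed C, C `<=` A, A `<=` U & nu (U `\` C) <= e%:E].

Let regular_open U : open U -> regular_set U.
Proof.
move=> oU e e0.
(* Closed sets increasing to [U]; as [nu] is finite, the measure of what they leave out of [U] tends
   to 0. *)
pose C k := [set x : V | ball x k.+1%:R^-1 `<=` U].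
have cC k : closed (C k).
  rewrite -(setCK (C k)) closedC.
  have -> : ~` C k = \bigcup_(y in ~` U) ball y k.+1%:R^-1.
    apply/seteqP; split => [x /existsNP[y /not_implyP[xy yU]]|x [y yU yx] /(_ y)].
      by exists y => //; exact: ball_sym.
    by move=> /(_ (ball_sym yx)).
  apply: bigcup_open => y _.
  exact: (@ball_open R V).
have CU k : C k `<=` U by move=> x; apply; exact: ballxx.
have mU := open_measurable_rV oU.
have mC k : measurable (C k).
  by rewrite -(setCK (C k)); apply: measurableC; apply: open_measurable_rV; rewrite openC.
have /(_ _ _ _ _)cv := @nonincreasing_cvg_mu _ _ _ nu (fun k => U `\` C k).
have H0 : \bigcap_k (U `\` C k) = set0.
  rewrite -subset0 => x xC; have [Ux _] := xC 0%N I.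
  have /nbhs_ballP[r /= r0 rU] : nbhs x U by exact: open_nbhs_nbhs.
  have [k _ kr] := near_infty_natSinv_lt (PosNum r0).
  have [_] := xC k I; apply; apply: subset_trans rU; apply: le_ball.
  by apply/ltW; apply: (kr k) => /=.
have {}cv : nu (U `\` C k) @[k --> \oo] --> 0.
  rewrite -(measure0 nu) -H0; apply: cv => //.
  - apply: le_lt_trans nufin; apply: le_measure; rewrite ?inE//.
    exact: measurableD.
  - by move=> k; exact: measurableD.
  - by rewrite H0.
  - apply/nonincreasing_seqP => k; apply/subsetPset => x [Ux Ck]; split => //.
    apply: contra_not Ck => h; apply: subset_trans h; apply: le_ball.
    by rewrite lef_pV2 ?posrE// ler_nat.
have [N _ HN] : \forall k \near \oo, nu (U `\` C k) < e%:E.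
  apply: (cv [set x | x < e%:E]); apply: open_nbhs_nbhs; split.
    exact: open_ereal_lt_ereal.
  by rewrite /= lte_fin.
by exists U, (C N); split => //; apply/ltW; apply: HN => /=.
Qed.

Let regularC A : regular_set A -> regular_set (~` A).
Proof.
move=> rA e e0; have [U [C [oU cC CA AU UC]]] := rA e e0.
exists (~` C), (~` U); split; [by rewrite openC|by rewrite closedC| | |].
- exact: subsetC.
- exact: subsetC.
- by rewrite setDE setCK setIC -setDE.
Qed.

Let regularU (A : (set V)^nat) :
  (forall i, regular_set (A i)) -> regular_set (\bigcup_i A i).
Proof.
move=> rA e e0.
(* Half of [e] is split geometrically among the approximations. The other half pays for keeping only
   finitely many [C i], since an infinite union of closed sets need not be closed. *)
have e2 i : (0 < e / 2 / (2 ^ i.+1)%:R)%R by rewrite divr_gt0// ?divr_gt0// ltr0n expn_gt0.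
have /choice[U /choice[C HUC]] := fun i => rA i _ (e2 i).
pose D N := \bigcup_(i < N) C i.
have mU i : measurable (U i) by apply: open_measurable_rV; have [] := HUC i.
have mC i : measurable (C i).
  rewrite -(setCK (C i)); apply: measurableC; apply: open_measurable_rV.
  by rewrite openC; have [] := HUC i.
have mUU : measurable (\bigcup_i U i) by exact: bigcup_measurable.
have mD N : measurable (D N) by apply: bigcup_measurable.
have mDD N : measurable (\bigcup_i U i `\` D N) by exact: measurableD.
have mcap : measurable (\bigcap_N (\bigcup_i U i `\` D N)) by exact: bigcapT_measurable.
have cv : nu (\bigcup_i U i `\` D N) @[N --> \oo] -->
          nu (\bigcap_N (\bigcup_i U i `\` D N)).
  apply: (@nonincreasing_cvg_mu _ _ _ nu (fun N => \bigcup_i U i `\` D N)) => //.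
    apply: le_lt_trans nufin; apply: le_measure; rewrite ?inE//.
  apply/nonincreasing_seqP => k; apply/subsetPset => x [Ux Ck]; split => //.
  by apply: contra_not Ck => -[i /= ik Cix]; exists i => //=; lia.
have le2 : nu (\bigcap_N (\bigcup_i U i `\` D N)) <= (e / 2)%:E.
  apply: (@le_trans _ _ (nu (\bigcup_i (U i `\` C i)))).
    apply: le_measure; rewrite ?inE//.
      by apply: bigcup_measurable => i _; exact: measurableD.
    move=> x xc; have [[i _ Ui] _] := xc 0%N I; exists i => //; split => // Ci.
    by have [_] := xc i.+1 I; apply; exists i => /=.
  apply: (@le_trans _ _ (\sum_(i <oo) nu (U i `\` C i))).
    apply: measure_sigma_subadditive => //.
    - by move=> i; exact: measurableD.
    - by apply: bigcup_measurable => i _; exact: measurableD.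
  apply: le_trans (epsilon_trick0 xpredT (ltW (_ : 0 < e / 2)%R)); last by lra.
  by apply: lee_nneseries => // i _; have [] := HUC i.
have [N _ HN] : \forall k \near \oo, nu (\bigcup_i U i `\` D k) < e%:E.
  apply: (cv [set x | x < e%:E]); apply: open_nbhs_nbhs; split.
    exact: open_ereal_lt_ereal.
  by rewrite /= (le_lt_trans le2)// lte_fin; lra.
exists (\bigcup_i U i), (D N); split.
- by apply: bigcup_open => i _; have [] := HUC i.
- by apply: closed_bigcup => // i _; have [] := HUC i.
- move=> x [i _ Cix]; exists i => //; have [_ _ CA _ _] := HUC i; exact: CA.
- by apply: subset_bigcup => i _; have [] := HUC i.
- by apply/ltW; apply: HN => /=.
Qed.

Lemma outer_regular (A : set V) (e : R) : measurable A -> (0 < e)%R ->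
  exists U : set V, [/\ open U, A `<=` U & nu (U `\` A) <= e%:E].
Proof.
move=> mA e0; suff /(_ e e0)[U [C [oU cC CA AU UC]]] : regular_set A.
  exists U; split => //; apply: le_trans UC; apply: le_measure; rewrite ?inE.
  - by apply: measurableD => //; exact: open_measurable_rV.
  - apply: measurableD; first exact: open_measurable_rV.
    rewrite -(setCK C); apply: measurableC; apply: open_measurable_rV.
    by rewrite openC.
  - by move=> x [Ux Ax]; split => //; apply: contra_not Ax; exact: CA.
move: A mA => A /measurable_rV_open; apply: smallest_sub.
  split; first exact/regular_open/open0.
    by move=> B rB; rewrite setTD; exact: regularC.
  exact: regularU.
exact: regular_open.
Qed.
End regularity.

(** * Restriction of a function to a set *)

Section cutoff.
Context d {T : measurableType d} {R : realType} (mu : {measure set T -> \bar R}).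
Implicit Types (h : T -> R) (E : set T).
Local Open Scope ereal_scope.

Definition cutoff h E : T -> R := fun x => (h x * \1_E x)%R.

Lemma cutoff_ge0 h E : (forall x, 0 <= h x)%R -> forall x, (0 <= cutoff h E x)%R.
Proof. by move=> h0 x; rewrite mulr_ge0. Qed.

Lemma measurable_cutoff h E : measurable E -> measurable_fun setT h ->
  measurable_fun setT (cutoff h E).
Proof. by move=> mE mh; apply: measurable_funM. Qed.

Lemma cutoff_in h E x : E x -> cutoff h E x = h x.
Proof. by move=> Ex; rewrite /cutoff indicE mem_set// mulr1. Qed.

Lemma cutoff_out h E x : ~ E x -> cutoff h E x = 0%R.
Proof. by move=> Ex; rewrite /cutoff indicE memNset// mulr0. Qed.

Lemma integral_cutoff h E Q :
  \int[mu]_(x in Q) (cutoff h E x)%:E = \int[mu]_(x in Q `&` E) (h x)%:E.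
Proof.
rewrite integral_mkcondr; apply: eq_integral => x _.
have [xE|xE] := pselect (E x); first by rewrite /patch mem_set// cutoff_in.
by rewrite cutoff_out// /patch memNset.
Qed.

Lemma integral_ge0_subset h (A B : set T) : (forall x, 0 <= h x)%R ->
  measurable_fun setT h -> measurable A -> measurable B -> A `<=` B ->
  \int[mu]_(x in A) (h x)%:E <= \int[mu]_(x in B) (h x)%:E.
Proof.
move=> h0 mh mA mB AB; apply: ge0_subset_integral => //.
  by apply/measurable_EFinP; exact: measurable_funS mh.
by move=> x _; rewrite lee_fin.
Qed.

Lemma measurable_gt_level h (a : R) : measurable_fun setT h ->
  measurable [set x | (a < h x)%R].
Proof.
move=> mh; rewrite (_ : mkset _ = setT `&` h @^-1` `]a, +oo[%classic%R).
  exact: mh.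
by rewrite setTI; apply/seteqP; split => y /=; rewrite in_itv /= andbT.
Qed.

End cutoff.

(** * Level sets of the maximal function *)

Section maximal_sets.
Context {R : realType} {n : nat}.
Local Notation V := ('rV[R]_n).
Local Notation mu := (lebesgue_rV R n).
Implicit Types (x y c z : V) (r l : R) (h : V -> R).
Local Open Scope ereal_scope.

Lemma lebesgue_rV_ballM c r : (0 < r)%R ->
  (mu : {measure set V -> \bar R}) (ball c r) = ((2 * r) ^+ n)%:E.
Proof. exact: lebesgue_rV_ball. Qed.

(* [heavy_set h l] is {M h > l}, where M is the uncentred maximal function over rational cubes. *)
Definition heavy_balls h l : set nat := [set i | (0 < qradius n i :> R)%R /\
  (l * (2 * qradius n i) ^+ n)%:E < \int[mu]_(y in @qball R n i) (h y)%:E].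

Definition heavy_set h l : set V := \bigcup_(i in heavy_balls h l) qball i.

Lemma open_heavy_set h l : open (heavy_set h l).
Proof. by apply: bigcup_open => i _; exact: (@ball_open R V). Qed.

Lemma measurable_heavy_set h l : measurable (heavy_set h l).
Proof. by apply: open_measurable_rV; exact: open_heavy_set. Qed.

(** Allows cubes of arbitrary centre and radius to be tested against [heavy_set], which only knows
    rational ones. *)
Lemma qball_super c r (e : R) : (0 < r)%R -> (r < e)%R ->
  exists i, ball c r `<=` @qball R n i /\ (r <= qradius n i < e)%R.
Proof.
move=> r0 re.
have d0 : (0 < (e - r) / 4)%R by lra.
have [i [i0 ci ie]] := qball_approx c d0.
have [q] : exists q : rat, (ratr q : R) \in `](r + (e - r) / 4)%R, e[.
  by apply: rat_in_itvoo; lra.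
rewrite in_itv /= => /andP[q1 q2].
(* An index with the centre of [i] and the new radius [q]; if [i] codes no pair, its centre is 0. *)
pose p := (if unpickle i is Some p then (p : 'rV[rat]_n * rat).1 else 0%R, q).
have E : qcenter (pickle p) = qcenter i :> V.
  rewrite /qcenter pickleK /=; case: (unpickle i) => // ; by rewrite map_mx0.
have E2 : qradius n (pickle p) = ratr q :> R by rewrite /qradius pickleK.
exists (pickle p); rewrite /qball E E2; split; last by apply/andP; split; lra.
have := ie _ (rV_ball_self _ i0) => /rV_ballP h1.
move=> w /rV_ballP h2; apply/rV_ballP; rewrite distrC in h1.
by have := ler_distD c (qcenter i) w; lra.
Qed.

(** The strict inequality leaves room: it survives a slight increase of the radius, and a rational
    cube of such a radius contains [ball c r]. *)
Lemma ball_heavy_set h l c r : (forall x, 0 <= h x)%R -> measurable_fun setT h ->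
  (0 < r)%R ->
  (l * (2 * r) ^+ n)%:E < \int[mu]_(y in ball c r) (h y)%:E ->
  ball c r `<=` heavy_set h l.
Proof.
move=> h0 mh r0 lr.
have [e re he] : exists2 e, (r < e)%R & forall s, (r <= s < e)%R ->
    (l * (2 * s) ^+ n)%:E < \int[mu]_(y in ball c r) (h y)%:E.
  (* A real number is inserted between the two sides because the integral may be [+oo]. *)
  have [a ra aI] : exists2 a, (l * (2 * r) ^+ n < a)%R &
      a%:E <= \int[mu]_(y in ball c r) (h y)%:E.
    case: (integral _ _ _) lr => [a|_|//].
      by rewrite lte_fin => la; exists a.
    by exists (l * (2 * r) ^+ n + 1)%R; [rewrite ltrDl|rewrite leey].
  have cf : continuous (fun s : R => l * (2 * s) ^+ n)%R.
    move=> s; apply: cvgM; first exact: cvg_cst.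
    apply: (@continuous_comp _ _ _ (fun s : R => 2 * s)%R (fun s : R => s ^+ n)%R).
      by apply: cvgM; [exact: cvg_cst|exact: cvg_id].
    exact: exprn_continuous.
  have /nbhs_ballP[e /= e0 He] : \forall s \near r, (l * (2 * s) ^+ n < a)%R.
    by apply: (cf r [set x | (x < a)%R]); apply: lt_nbhsl.
  exists (r + e)%R; first by rewrite ltrDl.
  move=> s /andP[rs se]; apply: lt_le_trans aI; rewrite lte_fin.
  by apply: He; rewrite /ball /= ltr_distlC; apply/andP; split; lra.
have [i [ci /andP[ri ie]]] := qball_super c r0 re.
apply: (subset_trans ci) => x ix; exists i; last exact: ix.
split; first exact: lt_le_trans ri.
apply: (@lt_le_trans _ _ (\int[mu]_(y in ball c r) (h y)%:E)).
  by apply: he; rewrite ri.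
by apply: integral_ge0_subset => //; exact: measurable_rV_ball.
Qed.

Lemma notin_heavy_set h l c r z : (forall x, 0 <= h x)%R -> measurable_fun setT h ->
  (0 < r)%R -> ball c r z -> ~ heavy_set h l z ->
  \int[mu]_(y in ball c r) (h y)%:E <= (l * (2 * r) ^+ n)%:E.
Proof.
move=> h0 mh r0 cz hz; rewrite leNgt; apply/negP => /(ball_heavy_set h0 mh r0).
by move=> /(_ _ cz).
Qed.

(** The Hardy-Littlewood weak type inequality; [3 ^+ n] is the price of tripling the selected
    cubes. *)
Lemma heavy_set_weak h l : (forall x, 0 <= h x)%R -> measurable_fun setT h ->
  (0 < l)%R ->
  mu (heavy_set h l) <= (3 ^+ n / l)%:E * \int[mu]_y (h y)%:E.
Proof.
move=> h0 mh l0.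
apply: (@vitali_measure _ _ mu (density mu h0 mh) (3 ^+ n / l)%R (heavy_balls h l)
   qcenter (qradius n) setT) => //.
  by rewrite divr_ge0 ?exprn_ge0// ltW.
move=> i [i0 hi].
rewrite densityE; apply: (@le_trans _ _ ((2 * (3 * qradius n i)) ^+ n)%:E).
  by rewrite -(lebesgue_rV_ball (qcenter i)) ?mulr_gt0//; exact: lexx.
rewrite [X in X%:E](_ : _ = 3 ^+ n / l * (l * (2 * qradius n i) ^+ n))%R; last first.
  by rewrite !exprMn; field; rewrite gt_eqF.
rewrite EFinM lee_wpmul2l//; last exact: ltW.
by rewrite lee_fin divr_ge0 ?exprn_ge0// ltW.
Qed.

Lemma heavy_set_sub h1 h2 l1 l2 : (forall i, (0 < qradius n i :> R)%R ->
    (l1 * (2 * qradius n i) ^+ n)%:E < \int[mu]_(y in @qball R n i) (h1 y)%:E ->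
    (l2 * (2 * qradius n i) ^+ n)%:E < \int[mu]_(y in @qball R n i) (h2 y)%:E) ->
  heavy_set h1 l1 `<=` heavy_set h2 l2.
Proof.
move=> H x [i [i0 hi] ix]; exists i; last exact: ix.
by split => //; exact: H.
Qed.

(* Only the part of [h] above [l / 2] can make a cube heavy at level [l]. *)
Lemma heavy_set_weak_above h l : (forall x, 0 <= h x)%R -> measurable_fun setT h ->
  (0 < l)%R ->
  mu (heavy_set h l) <=
    (2 * 3 ^+ n / l)%:E * \int[mu]_(y in [set y | (l / 2 < h y)%R]) (h y)%:E.
Proof.
move=> h0 mh l0; set E := [set y | _].
have mE : measurable E by exact: measurable_gt_level.
have := @heavy_set_weak (cutoff h E) (l / 2)%R (cutoff_ge0 _ h0) (measurable_cutoff mE mh).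
rewrite integral_cutoff setTI (_ : 3 ^+ n / (l / 2) = 2 * 3 ^+ n / l)%R; last first.
  by field; rewrite gt_eqF.
move=> /(_ (divr_gt0 l0 (ltr0Sn _ 1))); apply: le_trans.
apply: le_measure; rewrite ?inE; [exact: measurable_heavy_set|exact: measurable_heavy_set|].
apply: heavy_set_sub => i i0 hi.
have mq : measurable (@qball R n i) by exact: measurable_rV_ball.
have mcut := measurable_cutoff mE mh.
have : \int[mu]_(y in @qball R n i) (h y)%:E <=
    \int[mu]_(y in @qball R n i) (cutoff h E y)%:E + (l / 2 * (2 * qradius n i) ^+ n)%:E.
  have -> : (l / 2 * (2 * qradius n i) ^+ n)%:E =
     \int[mu]_(y in @qball R n i) (cst (l / 2)%:E y).
    rewrite integral_cst// EFinM; congr (_ * _).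
    by apply/esym; exact: (lebesgue_rV_ball (qcenter i)).
  rewrite -ge0_integralD//.
  - apply: ge0_le_integral => //.
    + by move=> x _; rewrite lee_fin.
    + by apply/measurable_EFinP; exact: measurable_funS mh.
    + apply: emeasurable_funD => //.
      by apply/measurable_EFinP; exact: measurable_funS mcut.
    + move=> x _; rewrite /= -EFinD lee_fin.
      have [Ex|Ex] := pselect (E x); first by rewrite cutoff_in// lerDl; lra.
      by rewrite cutoff_out// add0r; move/negP : Ex; rewrite -leNgt.
  - by move=> x _; rewrite lee_fin; exact: cutoff_ge0.
  - by apply/measurable_EFinP; exact: measurable_funS mcut.
  - by move=> x _; rewrite lee_fin; lra.
move=> /(lt_le_trans hi).
rewrite -lteBlDr//= -EFinB.
by congr (_%:E < _); lra.
Qed.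

(* If [z] is not heavy at level [l], cubes heavy at level [A * l] that come within [d] of [y] have
   radius less than [d], so the weak type inequality applies to [h] restricted to [ball z (5 * d)]. *)
Lemma heavy_set_local h l A d y z : (forall x, 0 <= h x)%R -> measurable_fun setT h ->
  (0 < l)%R -> (0 < d)%R -> (5 ^+ n <= A)%R -> ~ heavy_set h l z ->
  (`|z - y| <= 2 * d)%R ->
  mu (heavy_set h (A * l) `&` ball y d) <= (30 ^+ n / A * d ^+ n)%:E.
Proof.
move=> h0 mh l0 d0 A5 hz zy.
have A0 : (0 < A)%R by apply: lt_le_trans A5; rewrite exprn_gt0.
have Al0 : (0 < A * l)%R by rewrite mulr_gt0.
have mB : measurable (ball z (5 * d)) by exact: measurable_rV_ball.
have mq i : measurable (@qball R n i) by exact: measurable_rV_ball.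
have I5 : \int[mu]_(x in ball z (5 * d)%R) (h x)%:E <= (l * (2 * (5 * d)) ^+ n)%:E.
  apply: notin_heavy_set hz => //; [lra|apply: rV_ball_self; lra].
have := @heavy_set_weak (cutoff h (ball z (5 * d)%R)) (A * l)%R (cutoff_ge0 _ h0) (measurable_cutoff mB mh) Al0.
rewrite integral_cutoff setTI => W.
apply: (@le_trans _ _ (mu (heavy_set (cutoff h (ball z (5 * d)%R)) (A * l)))).
  apply: le_measure; rewrite ?inE.
  - by apply: measurableI; [exact: measurable_heavy_set|exact: measurable_rV_ball].
  - exact: measurable_heavy_set.
  move=> x [[i [i0 hi] ix] /rV_ballP yx].
  have cx : (`|qcenter i - x| < qradius n i)%R by apply/rV_ballP.
  have zc : (`|z - qcenter i| < 3 * d + qradius n i)%R.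
    have := ler_distD y z x; have := ler_distD x z (qcenter i).
    rewrite (distrC x (qcenter i)); lra.
  (* If the radius is at least [d], the cube lies in the cube around [z] of five times that radius.
     As [z] is not heavy, the mean of [h] over the small cube is at most [5 ^+ n * l], so it cannot
     be heavy at level [A * l]. *)
  have [dr|rd] := leP d (qradius n i).
    exfalso; move: hi; apply/negP; rewrite -leNgt.
    apply: (@le_trans _ _ (\int[mu]_(x in ball z (5 * qradius n i)%R) (h x)%:E)).
      apply: integral_ge0_subset => //; first exact: measurable_rV_ball.
      move=> w /rV_ballP cw; apply/rV_ballP.
      by have := ler_distD (qcenter i) z w; lra.
    apply: (@le_trans _ _ (l * (2 * (5 * qradius n i)) ^+ n)%:E).
      by apply: notin_heavy_set hz => //; [lra|apply: rV_ball_self; lra].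
    rewrite lee_fin (_ : 2 * (5 * qradius n i) = 5 * (2 * qradius n i))%R; last by lra.
    rewrite exprMn mulrA ler_wpM2r ?exprn_ge0//; first lra.
    by rewrite mulrC ler_wpM2r// ltW.
  exists i; last exact: ix.
  split => //; rewrite integral_cutoff.
  suff -> : @qball R n i `&` ball z (5 * d)%R = qball i by [].
  apply/setIidl => w /rV_ballP cw; apply/rV_ballP.
  by have := ler_distD (qcenter i) z w; lra.
apply: le_trans W _; apply: le_trans (lee_wpmul2l _ I5) _.
  by rewrite lee_fin divr_ge0 ?exprn_ge0// ltW.
rewrite -EFinM lee_fin.
rewrite (_ : 2 * (5 * d) = 10 * d)%R; last lra.
(* Here [3 ^+ n] is the weak type constant and [10 ^+ n] comes from the volume of
   [ball z (5 * d)]. *)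
rewrite (_ : 30 = 3 * 10)%R; last lra.
rewrite !exprMn le_eqVlt; apply/orP; left; apply/eqP; field.
by rewrite !gt_eqF.
Qed.

(* Weak form of Lebesgue's differentiation theorem, from Vitali covering and outer regularity. *)
Lemma heavy_set_ae_above h l : (forall x, 0 <= h x)%R ->
  mu.-integrable setT (EFin \o h) -> (0 < l)%R ->
  mu ([set x | (2 * 3 ^+ n * l < h x)%R] `\` heavy_set h l) = 0.
Proof.
move=> h0 hi l0.
have mh : measurable_fun setT h by apply/measurable_EFinP; exact: measurable_int hi.
set E := [set x | _]; set F := E `\` _.
have mE : measurable E by exact: measurable_gt_level.
have mF : measurable F by apply: measurableD => //; exact: measurable_heavy_set.
have three0 : (0 < 3 ^+ n :> R)%R by rewrite exprn_gt0.
pose B m := ball (0%R : V) m.+1%:R.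
have mB m : measurable (B m) by exact: measurable_rV_ball.
have FB m : mu (F `&` B m) = 0.
  (* Restricting Lebesgue measure to [B m] gives the finite measure that outer regularity
     requires. *)
  pose nu := mrestr mu (mB m).
  have nuT : nu setT < +oo.
    by rewrite /nu /mrestr setTI lebesgue_rV_ball// ltry.
  have fin : mu (F `&` B m) < +oo.
    by apply: le_lt_trans nuT; apply: le_measure; rewrite ?inE;
      [exact: measurableI|exact: measurableI|exact: setSI].
  have mFB : measurable (F `&` B m) by exact: measurableI.
  (* A cube meeting [F] contains a point that is not heavy, so its mass is at most [l] times its
     volume; the covering costs [3 ^+ n]. On [F] the function [h] exceeds twice the resulting
     constant, so letting [e] tend to 0 forces measure 0. *)
  have up (e : R) : (0 < e)%R ->
      \int[mu]_(x in F `&` B m) (h x)%:E <= (3 ^+ n * l)%:E * (mu (F `&` B m) + e%:E).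
    move=> e0; have [U [oU FU Ue]] := outer_regular nuT mFB e0.
    have mU := open_measurable_rV oU.
    have oUB : open (U `&` B m) by apply: openI => //; exact: (@ball_open R V).
    have mUB := open_measurable_rV oUB.
    pose P := [set i | [/\ (0 < qradius n i :> R)%R, @qball R n i `<=` U `&` B m &
       exists2 z, (F `&` B m) z & @qball R n i z]].
    apply: (@le_trans _ _ (density mu h0 mh (\bigcup_(i in P) qball i))).
      rewrite densityE; apply: integral_ge0_subset => //.
        by apply: bigcup_measurable => i _; exact: measurable_rV_ball.
      move=> x Fx; have : (U `&` B m) x by split; [exact: FU|case: Fx].
      rewrite {1}(qball_cover oUB) => -[i [i0 iU] ix].
      by exists i; [split => //; exists x|exact: ix].
    apply: (@le_trans _ _ ((3 ^+ n * l)%:E * mu (U `&` B m))).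
      apply: vitali_measure => //.
      - by rewrite mulr_ge0// ltW.
      - move=> i [i0 iU [z [[_ Fz] _] iz]].
        rewrite densityE lebesgue_rV_ballM// -EFinM.
        rewrite (_ : 3 ^+ n * l * _ = l * (2 * (3 * qradius n i)) ^+ n)%R; last first.
          by rewrite !exprMn; ring.
        apply: notin_heavy_set Fz => //; first by lra.
        by apply: le_ball iz; lra.
      - by move=> i [].
    apply: lee_wpmul2l; first by rewrite lee_fin mulr_ge0// ltW.
    rewrite -(setDUK (_ : F `&` B m `<=` U `&` B m)); last first.
      by move=> x [Fx Bx]; split => //; exact: FU.
    apply: le_trans (measureU2 _ _ _) _ => //; first exact: measurableD.
    apply: leeD => //; apply: le_trans Ue; rewrite /nu /mrestr.
    apply: le_measure; rewrite ?inE.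
    - exact: measurableD.
    - by apply: measurableI => //; exact: measurableD.
    - by move=> x [[Ux Bx] nF]; split => //; split.
  have dn : (2 * 3 ^+ n * l)%:E * mu (F `&` B m) <= \int[mu]_(x in F `&` B m) (h x)%:E.
    rewrite -integral_cst//; apply: ge0_le_integral => //.
    - by move=> x _; rewrite lee_fin !mulr_ge0// ltW.
    - by apply/measurable_EFinP; exact: measurable_funS mh.
    - by move=> x [[/ltW Ex _] _]; rewrite /= lee_fin.
  have ge0 : 0 <= mu (F `&` B m) by [].
  move: (mu (F `&` B m)) ge0 fin dn up => [a| |] //.
  rewrite lee_fin => a0 _ dn up; congr EFin; apply/eqP.
  rewrite eq_le a0 andbT; apply/ler_addgt0Pr => e e0; rewrite add0r.
  have := le_trans dn (up _ e0).
  rewrite -EFinD -!EFinM lee_fin.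
  rewrite -mulrA (mulrC 2)%R -!mulrA; have : (0 < 3 ^+ n * l)%R by rewrite mulr_gt0.
  move=> c0; rewrite (_ : 3 ^+ n * _ = 3 ^+ n * l * (2 * a))%R; last by ring.
  rewrite mulrA ler_pM2l//; lra.
have FE : F = \bigcup_m (F `&` B m).
  apply/seteqP; split => [x Fx|x [m _ []]//].
  exists (Num.truncn `|x|) => //; split => //; apply/rV_ballP.
  by rewrite sub0r normrN truncnS_gt.
apply: measure_negligible => //; rewrite FE; apply: negligible_bigcup => m.
by apply/negligibleP; [exact: measurableI|exact: FB].
Qed.

End maximal_sets.

(** * Changes of variables and bump functions *)

Section affine_change.
Context {R : realType} {n : nat}.
Local Notation V := ('rV[R]_n).
Local Notation mu := (lebesgue_rV R n).
Local Open Scope ereal_scope.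

Definition open_boxes : set (set V) :=
  [set A | exists a b : V, A = [set x : V | forall i, `]a ord0 i, b ord0 i[%classic (x ord0 i)]].

Lemma ball_open_box (c : V) (r : R) : (0 < r)%R -> open_boxes (ball c r).
Proof.
move=> r0; exists (c - const_mx r)%R, (c + const_mx r)%R; rewrite rV_ballE//.
by apply/seteqP; split => x /= h i; have := h i; rewrite !mxE.
Qed.

Lemma open_boxes_generate : @measurable _ V = <<s open_boxes >>.
Proof.
apply/seteqP; split.
  move=> A /measurable_rV_open; apply: smallest_sub.
    exact: smallest_sigma_algebra.
  move=> U oU; rewrite (qball_cover oU).
  rewrite bigcup_mkcond.
  have [s0 _ sU] := smallest_sigma_algebra setT open_boxes.
  apply: sU => i.
  case: ifPn => [|_].
    rewrite inE => -[i0 _]; apply: sub_sigma_algebra; exact: ball_open_box.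
  exact: s0.
apply: smallest_sub.
  exact: sigma_algebra_measurable.
move=> A [a [b ->]].
rewrite (_ : mkset _ = \bigcap_(i in [set: 'I_n])
    (@rV_coord R n i @^-1` `]a ord0 i, b ord0 i[%classic)).
  apply: fin_bigcap_measurable; first exact: finite_finset.
  move=> i _; rewrite -[X in measurable X]setTI.
  by apply: measurable_rV_coord.
by apply/seteqP; split => [x Bx i _|x Bx i]; [exact: Bx|exact: (Bx i I)].
Qed.

Lemma open_boxes_setI : setI_closed open_boxes.
Proof.
move=> _ _ [a [b ->]] [c [d ->]].
exists (\row_i Num.max (a ord0 i) (c ord0 i)), (\row_i Num.min (b ord0 i) (d ord0 i)).
apply/seteqP; split => x /=.
  move=> [h1 h2] i; have := h1 i; have := h2 i; rewrite !in_itv /= !mxE gt_max lt_min.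
  by move=> /andP[-> ->] /andP[-> ->].
move=> h; split => i; have := h i; rewrite !in_itv /= !mxE gt_max lt_min;
  by move=> /andP[/andP[? ?] /andP[? ?]]; apply/andP.
Qed.

Variables (c : V) (t : R).
Hypothesis t0 : (0 < t)%R.

Definition affine (x : V) : V := (t^-1 *: (x - c))%R.

Lemma measurable_affine : measurable_fun setT affine.
Proof.
apply: measurable_fun_rVP => i.
rewrite (_ : _ \o _ = fun x => t^-1 * (rV_coord i x - c ord0 i))%R; last first.
  by apply/funext => x; rewrite /rV_coord /affine /= !mxE.
apply: measurable_funM => //; apply: measurable_funB => //.
exact: measurable_rV_coord.
Qed.

Lemma tn_ge0 : (0 <= t ^+ n)%R. Proof. by rewrite exprn_ge0// ltW. Qed.

(** Both sides are measures in [A]. They agree on open boxes, whose preimages are again boxes, and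
    the boxes generate the Borel sets and are stable under intersection; the balls of integer radius
    supply sigma-finiteness. *)
Lemma lebesgue_rV_affine (A : set V) : measurable A ->
  pushforward mu affine A = (t ^+ n)%:E * mu A.
Proof.
move=> mA.
pose p1 : {measure set V -> \bar R} := pushforward mu affine.
pose m1 := p1 measurable_affine.
pose m2 : {measure set V -> \bar R} := mscale (NngNum tn_ge0) mu.
suff : m1 A = m2 A by [].
apply: (measure_unique open_boxes (fun k => ball (0%R : V) k.+1%:R)) => //.
- exact: open_boxes_generate.
- exact: open_boxes_setI.
- by move=> k; exact: ball_open_box.
- rewrite -subTset => x _; exists (Num.truncn `|x|) => //; apply/rV_ballP.
  by rewrite sub0r normrN truncnS_gt.
- move=> _ [a [b ->]]; rewrite /m1 /p1 /m2 /= /mscale /pushforward /=.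
  rewrite (lebesgue_rV_box (A := fun i => `]a ord0 i, b ord0 i[%classic))//.
  rewrite [in LHS](_ : _ @^-1` _ = [set x : V | forall i,
     `]t * a ord0 i + c ord0 i, t * b ord0 i + c ord0 i[%classic (x ord0 i)]%R); last first.
    apply/seteqP; split=> x /= h i; have := h i; rewrite !in_itv /= !mxE.
      by rewrite ltr_pdivlMl// ltr_pdivrMl// ltrBrDr ltrBlDr.
    by rewrite ltr_pdivlMl// ltr_pdivrMl// ltrBrDr ltrBlDr.
  rewrite (lebesgue_rV_box (A := fun i =>
     `]t * a ord0 i + c ord0 i, t * b ord0 i + c ord0 i[%classic)%R)//.
  rewrite (eq_bigr (fun i => t%:E * lebesgue_measure `]a ord0 i, b ord0 i[%classic)); last first.
    move=> i _; rewrite !lebesgue_measure_itv /= !lte_fin ltrD2r ltr_pM2l//.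
    by case: ifPn => _; rewrite ?mule0// -!EFinB -EFinM; congr EFin; ring.
  rewrite big_split /=; congr (_ * _).
  by rewrite big_const card_ord; elim: {1 2}n => [|k IH] //=; rewrite IH exprS EFinM.
- move=> k; rewrite /m1 /p1 /= /pushforward.
  rewrite (_ : _ @^-1` _ = ball c (t * k.+1%:R)).
    by rewrite lebesgue_rV_ball ?mulr_gt0// ltry.
  apply/seteqP; split=> x /rV_ballP h; apply/rV_ballP; move: h; rewrite sub0r normrN normrZ;
   by rewrite gtr0_norm ?invr_gt0// ltr_pdivrMl// distrC.
Qed.

Lemma ge0_integral_affine (f : V -> \bar R) : measurable_fun setT f ->
  (forall x, 0 <= f x) ->
  \int[mu]_x f (affine x) = (t ^+ n)%:E * \int[mu]_x f x.
Proof.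
move=> mf f0.
rewrite -[LHS](@ge0_integral_pushforward _ _ _ _ _ affine measurable_affine mu setT f)//.
  rewrite -(@ge0_integral_mscale _ _ _ mu setT measurableT (NngNum tn_ge0))//.
  apply: eq_measure_integral => [|mA A ? _]; first exact: measurable_affine.
  exact: lebesgue_rV_affine.
Qed.

Lemma integral_affine (f : V -> R) : mu.-integrable setT (EFin \o f) ->
  \int[mu]_x (f (affine x))%:E = (t ^+ n)%:E * \int[mu]_x (f x)%:E.
Proof.
move=> fi; have mf := measurable_int _ fi.
rewrite integralE.
have -> : \int[mu]_x ((fun x => (f (affine x))%:E)^\+ x) =
   (t ^+ n)%:E * \int[mu]_x ((EFin \o f)^\+ x).
  by rewrite -(ge0_integral_affine (measurable_funepos mf))//; apply: eq_integral => x _; rewrite !funeposE.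
have -> : \int[mu]_x ((fun x => (f (affine x))%:E)^\- x) =
   (t ^+ n)%:E * \int[mu]_x ((EFin \o f)^\- x).
  by rewrite -(ge0_integral_affine (measurable_funeneg mf))//; apply: eq_integral => x _; rewrite !funenegE.
rewrite [in RHS]integralE [RHS]muleBr//.
by rewrite fin_num_adde_defl// fin_numN; exact: integrable_neg_fin_num.
Qed.

End affine_change.

(** * Bounds for the bump function *)

Section bump.
Context {R : realType} {n : nat}.
Local Notation V := ('rV[R]_n).
Local Notation mu := (lebesgue_rV R n).
Implicit Types (x y : V).

Lemma norm_le_euclid x : `|x| <= euclid_norm x.
Proof.
apply/rV_norm_leP; first exact: sqrtr_ge0.
move=> i; rewrite /euclid_norm -sqrtr_sqr ler_sqrt.
  rewrite (bigD1 i)//= lerDl; apply: sumr_ge0 => j _; exact: sqr_ge0.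
by apply: sumr_ge0 => j _; exact: sqr_ge0.
Qed.

Lemma euclid_le_norm x : euclid_norm x <= n%:R * `|x|.
Proof.
rewrite /euclid_norm -[leRHS]ger0_norm ?mulr_ge0// -sqrtr_sqr ler_sqrt ?sqr_ge0//.
apply: (@le_trans _ _ (\sum_(i < n) `|x| ^+ 2)).
  apply: ler_sum => i _; rewrite -[leLHS]ger0_norm ?sqr_ge0// normrX.
  by rewrite lerXn2r ?nnegrE// rV_coord_le.
rewrite sumr_const card_ord -[leLHS]mulr_natl exprMn ler_wpM2r ?sqr_ge0//.
by rewrite -natrX ler_nat; case: (n) => // k; rewrite expnS expn1 leq_pmulr.
Qed.

Lemma bounded_of_support (f : V -> R) : continuous f ->
  (forall x, 1 < `|x| -> f x = 0) -> exists2 M, 0 < M & forall x, `|f x| <= M.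
Proof.
move=> cf f0.
pose K := [set x : V | `|x| <= 1].
have cK : compact K.
  apply: bounded_closed_compact.
    by exists 1; split => // r r1 x /= /le_trans; apply; exact: ltW.
  rewrite (_ : K = (fun x : V => `|x|) @^-1` [set r : R | r <= 1])//.
  apply: closed_comp => [x _|]; [exact: norm_continuous|exact: closed_le].
have : compact (f @` K) by apply: continuous_compact => //; exact: continuous_subspaceT.
move=> /compact_bounded[M [_ HM]].
exists (`|M| + 1); first by rewrite ltr_wpDl.
move=> x; have [x1|x1] := leP `|x| 1.
  by apply: (HM (`|M| + 1)); [rewrite (le_lt_trans (ler_norm M))// ltrDl|exists x].
by rewrite f0// normr0 addr_ge0.
Qed.

Variable phi : V -> R.
Hypothesis phi_smooth : smooth_fun phi.
Hypothesis phi_supp : forall x, 1 < `|x| -> phi x = 0.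

Lemma bump_continuous : continuous phi.
Proof. by have [] := phi_smooth [::]. Qed.

Lemma bump_pderiv_bounded : exists2 M, 0 < M &
  forall i x, `|pderiv i phi x| <= M.
Proof.
have H i : exists2 M, 0 < M & forall x, `|pderiv i phi x| <= M.
  apply: bounded_of_support; first by have [] := phi_smooth [:: i].
  move=> x x1; rewrite /pderiv (@near_eq_derive _ _ _ phi (cst 0)) ?derive_cst//.
  have : open_nbhs x [set y : V | 1 < `|y|].
    split => //; rewrite (_ : [set y : V | 1 < `|y|] = (fun x : V => `|x|) @^-1` [set r : R | 1 < r])//.
    apply: open_comp => [y _|]; [exact: norm_continuous|exact: open_gt].
  move=> /open_nbhs_nbhs; apply: filterS => y; exact: phi_supp.
have /choice[M HM] : forall i, exists M, 0 < M /\ forall x, `|pderiv i phi x| <= M.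
  by move=> i; have [M M0 HM] := H i; exists M.
exists (1 + \sum_i M i).
  by rewrite ltr_wpDr//; apply: sumr_ge0 => i _; apply/ltW; have [] := HM i.
move=> i x; have [_ h] := HM i; apply: (le_trans (h x)).
rewrite (bigD1 i)//= addrCA lerDl addr_ge0//.
by apply: sumr_ge0 => j _; apply/ltW; have [] := HM j.
Qed.

(** [smooth_fun] speaks of partial derivatives only, so coordinates are changed one at a time:
    [z x y k] takes its first [k] coordinates from [y] and the others from [x], and the mean value
    theorem bounds each step. *)
Lemma bump_lipschitz : exists2 L, 0 < L & forall x y, `|phi x - phi y| <= L * `|x - y|.
Proof.
have [M M0 HM] := bump_pderiv_bounded.
have step i x s : `|phi (s *: 'e_i + x) - phi x| <= M * `|s|.
  pose g (r : R) := phi (r *: 'e_i + x).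
  have dg (r : R) : is_derive r (1 : R) g (pderiv i phi (r *: 'e_i + x)).
    have [_ /(_ i (r *: 'e_i + x)) D] := phi_smooth [::].
    have E : (fun h : R => h^-1 *: ((g \o shift r) (h *: 1) - g r)) =
       (fun h => h^-1 *: ((phi \o shift (r *: 'e_i + x)) (h *: 'e_i) - phi (r *: 'e_i + x))).
      apply/funext => h; rewrite /g /=; congr (_ *: (phi _ - _)).
      by rewrite [h *: 1]mulr1 scalerDl addrA.
    by apply: DeriveDef; rewrite /derivable /derive E.
  have cg : continuous g.
    by move=> r; apply/differentiable_continuous/derivable1_diffP; have [] := dg r.
  have [s0|s0] := leP 0 s.
    have [c _] := @MVT_segment R g _ 0 s s0 (fun r _ => dg r) (continuous_subspaceT cg).
    rewrite /g scale0r add0r subr0 => ->.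
    by rewrite normrM ler_wpM2r.
  have [c _] := @MVT_segment R g _ s 0 (ltW s0) (fun r _ => dg r) (continuous_subspaceT cg).
  rewrite /g scale0r add0r sub0r distrC => ->.
  by rewrite normrM normrN ler_wpM2r.
pose z (x y : V) k : V := \row_i (if (i < k)%N then y ord0 i else x ord0 i).
have zS x y k (kn : (k < n)%N) : z x y k.+1 =
    (y ord0 (Ordinal kn) - x ord0 (Ordinal kn)) *: 'e_(Ordinal kn) + z x y k.
  apply/rowP => i; rewrite !mxE eqxx /=.
  have [->|ik] := eqVneq i (Ordinal kn); first by rewrite /= ltnS leqnn ltnn mulr1 subrK.
  rewrite mulr0 add0r ltnS leq_eqVlt.
  by have /negbTE -> : nat_of_ord i != k by apply: contra ik => /eqP ik; apply/eqP/val_inj.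
have B x y k : (k <= n)%N -> `|phi (z x y k) - phi x| <= k%:R * M * `|x - y|.
  elim: k => [|k IH] kn.
    by rewrite (_ : z x y 0 = x) ?subrr ?normr0 ?mul0r//; apply/rowP => i; rewrite !mxE.
  have := IH (ltnW kn); have := step (Ordinal kn) (z x y k) (y ord0 (Ordinal kn) - x ord0 (Ordinal kn)).
  rewrite -zS => h1 h2.
  have h3 := ler_distD (phi (z x y k)) (phi (z x y k.+1)) (phi x).
  have : `|y ord0 (Ordinal kn) - x ord0 (Ordinal kn)| <= `|x - y|.
    by have := rV_coord_le (x - y) (Ordinal kn); rewrite !mxE distrC.
  move=> /(ler_wpM2l (ltW M0)) h4.
  apply: (le_trans h3); rewrite -natr1 !mulrDl mul1r addrC; apply: lerD => //.
  exact: le_trans h4.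
exists (n%:R * M + 1); first by rewrite ltr_wpDl// mulr_ge0// ltW.
move=> x y; have := B x y n (leqnn n).
rewrite (_ : z x y n = y); last by apply/rowP => i; rewrite !mxE ltn_ord.
rewrite distrC => /le_trans; apply.
by rewrite ler_wpM2r// lerDl.
Qed.

End bump.

(** * Logarithms and counting of powers *)

Section logarithms.
Context {R : realType}.
Implicit Types (a b s : R) (k m : nat).

Lemma ln_plus_ge0 a : 0 <= ln_plus a.
Proof. by rewrite /ln_plus le_max lexx orbT. Qed.

Lemma ln_le_plus a : ln a <= ln_plus a.
Proof. by rewrite /ln_plus le_max lexx. Qed.

Lemma ln_plus_le a b : a <= b -> ln_plus a <= ln_plus b.
Proof.
move=> ab; rewrite /ln_plus ge_max !le_max lexx orbT andbT.
have [a0|a0] := leP a 0; first by rewrite ln0// lexx orbT.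
by rewrite ler_ln ?posrE ?(lt_le_trans a0)// ab.
Qed.

Lemma ln_plusM a b : 0 <= a -> 1 <= b -> ln_plus (a * b) <= ln_plus a + ln b.
Proof.
move=> a0 b1; have lb : 0 <= ln b by exact: ln_ge0.
rewrite {1}/ln_plus ge_max addr_ge0 ?ln_plus_ge0// andbT.
have [->|an0] := eqVneq a 0; first by rewrite mul0r ln0// addr_ge0 ?ln_plus_ge0.
rewrite lnM ?posrE//; first by rewrite lerD2r ln_le_plus.
- by rewrite lt_def an0.
- exact: lt_le_trans b1.
Qed.

Lemma ln2_ge : 1 / 2 <= ln 2 :> R.
Proof.
have := @le_ln1Dx R (- (1 / 2)); rewrite (_ : 1 + - (1 / 2) = 2^-1); last by field.
by rewrite lnV ?posrE//; lra.
Qed.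

Lemma ln2_le1 : ln 2 <= 1 :> R.
Proof. by have := @le_ln1Dx R 1; rewrite -natr1; lra. Qed.

Lemma ln_pow b k : 0 < b -> ln (b ^+ k) = k%:R * ln b.
Proof. by move=> b0; rewrite lnXn// mulr_natl. Qed.

(** The factor 2 bounds [1 / ln 2]. *)
Lemma pow2_le_ln a k : 2 ^+ k <= a -> k%:R <= 2 * ln_plus a.
Proof.
move=> h; have p0 : 0 < 2 ^+ k :> R by rewrite exprn_gt0.
have : k%:R * ln 2 <= ln a by rewrite -ln_pow// ler_ln ?posrE// (lt_le_trans p0).
have := ln_le_plus a; have := ln2_ge; have : 0 <= k%:R :> R by [].
nra.
Qed.

Lemma measurable_ln_plus : measurable_fun setT (@ln_plus R).
Proof. by apply: measurable_maxr => //; exact: measurable_ln. Qed.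

(** Its sum over [k] is the number of levels below [a], comparable to [ln_plus a] up to constants;
    this is how sums over levels become logarithms and conversely. *)
Definition count_pow b a k : R := ((b ^+ k < a)%R)%:R.

Lemma sum_count_pow2_le a m : \sum_(0 <= k < m) count_pow 2 a k <= 1 + 2 * ln_plus a.
Proof.
elim: m => [|m IH].
  by rewrite big_nil addr_ge0// mulr_ge0// ln_plus_ge0.
rewrite big_nat_recr//= {2}/count_pow.
case: ltP => [h|_]; last by rewrite addr0.
have := pow2_le_ln (ltW h).
suff : \sum_(0 <= k < m) count_pow 2 a k <= m%:R by rewrite /=; lra.
rewrite (_ : m%:R = \sum_(0 <= k < m) 1); last by rewrite sumr_const_nat subn0.
by apply: ler_sum => k _; rewrite /count_pow; case: ltP.
Qed.

Lemma eseries_count_pow2_le a :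
  (\sum_(k <oo) (count_pow 2 a k)%:E <= (1 + 2 * ln_plus a)%:E)%E.
Proof.
apply: lime_le; first by apply: is_cvg_ereal_nneg_natsum => k _; rewrite lee_fin.
by apply: nearW => m; rewrite sumEFin lee_fin sum_count_pow2_le.
Qed.

(** If [N] is least with [a <= b ^+ N], the first [N] levels all count, and [ln a <= N * ln b]. *)
Lemma ln_plus_le_eseries b a : 1 < b ->
  ((ln_plus a)%:E <= (ln b)%:E * \sum_(k <oo) (count_pow b a k)%:E)%E.
Proof.
move=> b1; have lb : 0 < ln b by exact: ln_gt0.
have S0 : (0 <= \sum_(k <oo) (count_pow b a k)%:E)%E.
  by apply: nneseries_ge0 => k _ _; rewrite lee_fin.
have [a1|a1] := leP a 1.
  rewrite /ln_plus max_r; first by rewrite mule_ge0// lee_fin ltW.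
  by exact: ln_le0.
have [N [aN Nmin]] : exists N, a <= b ^+ N /\ forall j, (j < N)%N -> b ^+ j < a.
  have ex : exists N, a <= b ^+ N.
    exists (Num.truncn (ln a / ln b)).+1.
    rewrite -ler_ln ?posrE ?exprn_gt0 ?(lt_trans _ a1) ?(lt_trans _ b1)//.
    rewrite ln_pow ?(lt_trans _ b1)// -ler_pdivrMr//.
    by apply/ltW; rewrite truncnS_gt.
  exists (ex_minn ex); case: ex_minnP => N aN Nmin; split => // j jN.
  by rewrite ltNge; apply/negP => /Nmin; lia.
apply: (@le_trans _ _ ((ln b)%:E * (N%:R)%:E)%E).
  rewrite -EFinM lee_fin /ln_plus ge_max.
  rewrite mulrC -ln_pow ?(lt_trans _ b1)// ler_ln ?posrE ?exprn_gt0 ?(lt_trans _ a1) ?(lt_trans _ b1)//.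
  by rewrite aN ln_ge0// exprn_ege1// ltW.
rewrite lee_wpmul2l//; first by rewrite lee_fin ltW.
apply: le_trans (@nneseries_lim_ge R (fun k => (count_pow b a k)%:E) xpredT 0 N _); last first.
  by move=> k _; rewrite lee_fin.
rewrite sumEFin lee_fin.
rewrite (_ : N%:R = \sum_(0 <= k < N) 1); last by rewrite sumr_const_nat subn0.
rewrite [leLHS]big_nat [leRHS]big_nat; apply: ler_sum => k /andP[_ kN].
by rewrite /count_pow Nmin.
Qed.

Lemma sum_min_pow2_le (s : R) (m : nat) : 0 <= s ->
  \sum_(0 <= k < m) Num.min (s / 2 ^+ k) 1 <= 4 + 2 * ln_plus s.
Proof.
move=> s0.
(* The extra term stands for the rest of the series, a geometric tail once [s <= 2 ^+ m]; with it
   the bound becomes inductive. *)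
suff : \sum_(0 <= k < m) Num.min (s / 2 ^+ k) 1 + Num.min (2 * (s / 2 ^+ m)) 2 <=
    4 + 2 * ln_plus s.
  apply: le_trans; rewrite lerDl le_min mulr_ge0//=; rewrite divr_ge0// exprn_ge0//.
elim: m => [|m IH].
  rewrite big_nil add0r; apply: (@le_trans _ _ 2); first by rewrite ge_min lexx orbT.
  by have := ln_plus_ge0 s; lra.
have p0 : 0 < 2 ^+ m :> R by rewrite exprn_gt0.
have E : 2 * (s / 2 ^+ m.+1) = s / 2 ^+ m by rewrite exprS; field; rewrite gt_eqF.
have [sm|sm] := leP (s / 2 ^+ m) 1.
  rewrite big_nat_recr//= E (min_l sm) (@min_l _ _ (s / 2 ^+ m) 2); last by lra.
  by move: IH; rewrite (@min_l _ _ (2 * _) 2)//; lra.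
have : 2 ^+ m <= s by move: sm; rewrite ltr_pdivlMr// mul1r => /ltW.
move=> /pow2_le_ln h.
have : \sum_(0 <= k < m.+1) Num.min (s / 2 ^+ k) 1 <= m.+1%:R.
  rewrite (_ : m.+1%:R = \sum_(0 <= k < m.+1) 1); last by rewrite sumr_const_nat subn0.
  by apply: ler_sum => k _; rewrite ge_min lexx orbT.
have : Num.min (2 * (s / 2 ^+ m.+1)) 2 <= 2 by rewrite ge_min lexx orbT.
by rewrite -natr1; lra.
Qed.

Lemma eseries_min_pow2_le (s : R) : 0 <= s ->
  (\sum_(k <oo) (Num.min (s / 2 ^+ k) 1)%:E <= (4 + 2 * ln_plus s)%:E)%E.
Proof.
move=> s0; apply: lime_le.
  apply: is_cvg_ereal_nneg_natsum => k _; rewrite lee_fin le_min ler01 andbT.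
  by rewrite divr_ge0// exprn_ge0.
by apply: nearW => m; rewrite sumEFin lee_fin sum_min_pow2_le.
Qed.

(** For [s = |y| / J] this bounds, up to constants, the share of [y] in the error made when the
    convolution at scale t = J 2^k is replaced by phi_t(x) times the integral of f over the ball of
    radius t. The cutoff reflects that phi_t(x - y) vanishes for distant [y]; thanks to it the sum
    over [k] stays bounded, with no logarithm. *)
Definition ramp (s : R) (k : nat) : R := if s < 4 * 2 ^+ k then s / 2 ^+ k else 0.

Lemma ramp_ge0 (s : R) k : 0 <= s -> 0 <= ramp s k.
Proof. by move=> s0; rewrite /ramp; case: ifP => // _; rewrite divr_ge0// exprn_ge0. Qed.

Lemma sum_ramp_le (s : R) m : 0 <= s -> \sum_(0 <= k < m) ramp s k <= 8.
Proof.
move=> s0.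
suff : \sum_(0 <= k < m) ramp s k + Num.min (2 * (s / 2 ^+ m)) 8 <= 8.
  apply: le_trans; rewrite lerDl le_min mulr_ge0//=; rewrite divr_ge0// exprn_ge0//.
elim: m => [|m IH].
  by rewrite big_nil add0r ge_min lexx orbT.
have p0 : 0 < 2 ^+ m :> R by rewrite exprn_gt0.
have E : 2 * (s / 2 ^+ m.+1) = s / 2 ^+ m by rewrite exprS; field; rewrite gt_eqF.
rewrite E big_nat_recr//= {2}/ramp; case: ltP => sm.
  have s4 : s / 2 ^+ m < 4 by rewrite ltr_pdivrMr.
  move: IH; rewrite !min_l; [lra|lra|lra].
rewrite addr0 big_nat big1 ?add0r ?ge_min ?lexx ?orbT// => k /andP[_ km].
rewrite /ramp ifF//; apply/negbTE; rewrite -leNgt; apply: le_trans sm.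
by rewrite ler_pM2l//; apply: ler_weXn2l; [rewrite ler1n|exact: ltnW].
Qed.

End logarithms.

Section monotone.
Context d {T : measurableType d} {R : realType} (mu : {measure set T -> \bar R}).
Local Open Scope ereal_scope.

(* The integral of a nonnegative function is a supremum over simple functions below it, so no
   measurability is needed; this spares us the measurability of [hardy_maximal phi f]. *)
Lemma ge0_le_integral_nonmeasurable (f1 f2 : T -> \bar R) :
  (forall x, 0 <= f1 x) -> (forall x, f1 x <= f2 x) ->
  \int[mu]_x f1 x <= \int[mu]_x f2 x.
Proof.
move=> f10 f12; rewrite !ge0_integralTE//; last first.
  by move=> x; exact: le_trans (f12 x).
apply: ge_ereal_sup => _ [h /= hf] <-; apply: ereal_sup_ubound; exists h => // x.
exact: le_trans (f12 x).
Qed.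

End monotone.

(** * Functions in LlogL belong to the Hardy space *)

Section dyadic_majorant.
Context {R : realType} {n : nat}.
Local Notation V := ('rV[R]_n).
Local Notation mu := (lebesgue_rV R n).
Implicit Types (x y c : V) (r l : R).
Variable h : V -> R.
Hypotheses (h0 : forall x, 0 <= h x) (hi : mu.-integrable setT (EFin \o h)).
Local Open Scope ereal_scope.

Let mh : measurable_fun setT h.
Proof. by apply/measurable_EFinP; exact: measurable_int hi. Qed.

(** [dyadic_max] replaces the maximal function of [h] raised to at least [l]: it dominates the means
    of [h] over cubes containing [x], and as a series of indicators of open sets it is measurable
    and can be integrated term by term. *)
Definition dyadic_term l j x : R := (2 ^+ j.+1 * l * \1_(heavy_set h (2 ^+ j * l)) x)%R.
Definition dyadic_max l x : \bar R := l%:E + \sum_(j <oo) (dyadic_term l j x)%:E.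

Lemma dyadic_term_ge0 l j x : (0 < l)%R -> (0 <= dyadic_term l j x)%R.
Proof. by move=> l0; rewrite !mulr_ge0// ?exprn_ge0// ltW. Qed.

Lemma measurable_dyadic_term l j : measurable_fun setT (dyadic_term l j).
Proof. by apply: measurable_funM => //; apply: measurable_indic; exact: measurable_heavy_set. Qed.

Lemma dyadic_max_ge0 l x : (0 < l)%R -> 0 <= dyadic_max l x.
Proof.
move=> l0; apply: adde_ge0; first by rewrite lee_fin ltW.
by apply: nneseries_ge0 => j _ _; rewrite lee_fin dyadic_term_ge0.
Qed.

Lemma measurable_dyadic_max l : (0 < l)%R -> measurable_fun setT (dyadic_max l).
Proof.
move=> l0; apply: emeasurable_funD => //.
apply: ge0_emeasurable_sum => j; first by move=> x _ _; rewrite lee_fin dyadic_term_ge0.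
by move=> _; apply/measurable_EFinP; exact: measurable_dyadic_term.
Qed.

(** A mean of [h] larger than [l] lies between [2 ^+ j * l] and [2 ^+ j.+1 * l] for some [j]; then
    [x] is heavy at the lower level and the term of index [j] alone bounds the mean. *)
Lemma ball_le_dyadic_max c r l x : (0 < r)%R -> (0 < l)%R -> ball c r x ->
  \int[mu]_(y in ball c r) (h y)%:E <= ((2 * r) ^+ n)%:E * dyadic_max l x.
Proof.
move=> r0 l0 cx.
have v0 : (0 < (2 * r) ^+ n)%R by rewrite exprn_gt0// mulr_gt0.
have : \int[mu]_(y in ball c r) (h y)%:E < +oo.
  have /integrableP[_] := hi; apply: le_lt_trans.
  under [leRHS]eq_integral do rewrite /= ger0_norm//.
  by apply: integral_ge0_subset => //; exact: measurable_rV_ball.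
have : 0 <= \int[mu]_(y in ball c r) (h y)%:E.
  by apply: integral_ge0 => y _; rewrite lee_fin.
case E : (integral _ _ _) => [a| |]// a0 _.
have S0 : 0 <= \sum_(j <oo) (dyadic_term l j x)%:E.
  by apply: nneseries_ge0 => j _ _; rewrite lee_fin dyadic_term_ge0.
set q := (a / (2 * r) ^+ n)%R.
have Eq : a%:E = ((2 * r) ^+ n)%:E * q%:E by rewrite -EFinM /q mulrC divfK// gt_eqF.
rewrite Eq lee_wpmul2l ?lee_fin ?(ltW v0)//.
have [al|la] := leP q l; first by apply: (@le_trans _ _ l%:E); rewrite ?lee_fin// leeDl.
have [j jq qj] : exists2 j, (2 ^+ j * l < q)%R & (q <= 2 ^+ j.+1 * l)%R.
  have ex : exists j, (q <= 2 ^+ j.+1 * l)%R.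
    exists (Num.truncn (q / l)).
    rewrite -ler_pdivrMr//; apply/ltW; apply: lt_le_trans (truncnS_gt _) _.
    by rewrite -natrX ler_nat ltnW// ltn_expl.
  exists (ex_minn ex); case: ex_minnP => // -[|m] qm mmin; first by rewrite expr0 mul1r.
  by rewrite ltNge; apply/negP => /mmin; rewrite ltnn.
have xj : heavy_set h (2 ^+ j * l) x.
  apply: (ball_heavy_set h0 mh r0 _ cx).
  by rewrite E Eq -EFinM lte_fin mulrC ltr_pM2l.
apply: (@le_trans _ _ (dyadic_term l j x)%:E).
  by rewrite lee_fin /dyadic_term indicE mem_set// mulr1.
have H : (dyadic_term l j x)%:E <= \sum_(j <oo) (dyadic_term l j x)%:E.
  apply: le_trans (@nneseries_lim_ge R (fun j => (dyadic_term l j x)%:E) xpredT 0 j.+1 _).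
    rewrite big_nat_recr//= leeDr//.
    by apply: sume_ge0 => k _; rewrite lee_fin dyadic_term_ge0.
  by move=> k _; rewrite lee_fin dyadic_term_ge0.
by apply: le_trans H _; rewrite leeDr// lee_fin ltW.
Qed.

(** The classical L log L bound for the maximal function: the weak type inequality for the part of
    [h] above half the level is summed over the levels, then sum and integral are exchanged, and [y]
    counts once for each level below [2 * h y]. *)
Lemma integral_dyadic_max l E : measurable E -> (0 < l)%R ->
  \int[mu]_(x in E) dyadic_max l x <= l%:E * mu E +
    (4 * 3 ^+ n)%:E * \int[mu]_y (h y * (1 + 2 * ln_plus (2 * h y / l)))%:E.
Proof.
move=> mE l0.
rewrite ge0_integralD//; last 3 first.
- by move=> x _; rewrite lee_fin ltW.
- by move=> x _; apply: nneseries_ge0 => j _ _; rewrite lee_fin dyadic_term_ge0.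
- apply: ge0_emeasurable_sum => j; first by move=> x _ _; rewrite lee_fin dyadic_term_ge0.
  by move=> _; apply/measurable_EFinP; apply: measurable_funS (measurable_dyadic_term l j).
rewrite integral_cst// leeD2l//.
pose L j := [set y | (2 ^+ j * l / 2 < h y)%R].
have mL j : measurable (L j) by exact: measurable_gt_level.
rewrite integral_nneseries//; last 2 first.
- by move=> j; apply/measurable_EFinP; apply: measurable_funS (measurable_dyadic_term l j).
- by move=> j x _; rewrite lee_fin dyadic_term_ge0.
apply: (@le_trans _ _ (\sum_(j <oo) (4 * 3 ^+ n)%:E * \int[mu]_(y in L j) (h y)%:E)).
  apply: lee_nneseries => [j _ _|j _]; first by apply: integral_ge0 => x _; rewrite lee_fin dyadic_term_ge0.
  have lj0 : (0 < 2 ^+ j * l)%R by rewrite mulr_gt0// exprn_gt0.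
  have mH := measurable_heavy_set h (2 ^+ j * l).
  apply: (@le_trans _ _ ((2 ^+ j.+1 * l)%:E * mu (heavy_set h (2 ^+ j * l)))).
    under eq_integral do rewrite /dyadic_term EFinM.
    rewrite ge0_integralZl//; last 2 first.
    - by apply/measurable_EFinP; exact: measurable_indic.
    - by rewrite lee_fin mulr_ge0// ?exprn_ge0// ltW.
    rewrite lee_wpmul2l//; first by rewrite lee_fin mulr_ge0// ?exprn_ge0// ltW.
    rewrite integral_indic//; apply: le_measure; rewrite ?inE//.
    exact: measurableI.
  have := heavy_set_weak_above h0 mh lj0.
  move=> /(lee_wpmul2l (_ : 0 <= (2 ^+ j.+1 * l)%:E)) => /(_ _)/le_trans; apply.
    by rewrite lee_fin mulr_ge0// ?exprn_ge0// ltW.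
  rewrite muleA -EFinM (_ : _ * _ = 4 * 3 ^+ n)%R//.
  by rewrite exprS; field; rewrite !gt_eqF// exprn_gt0.
rewrite nneseriesZl//; last by move=> j _; apply: integral_ge0 => x _; rewrite lee_fin.
apply: lee_wpmul2l; first by rewrite lee_fin mulr_ge0// exprn_ge0.
under eq_eseriesr do rewrite -[L _]setTI -integral_cutoff.
rewrite -integral_nneseries//; last 2 first.
- by move=> j; apply/measurable_EFinP; exact: measurable_cutoff.
- by move=> j x _; rewrite lee_fin; exact: cutoff_ge0.
apply: ge0_le_integral => //.
- by move=> x _; apply: nneseries_ge0 => j _ _; rewrite lee_fin; exact: cutoff_ge0.
- apply: ge0_emeasurable_sum => j; first by move=> x _ _; rewrite lee_fin; exact: cutoff_ge0.
  by move=> _; apply/measurable_EFinP; exact: measurable_cutoff.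
- apply/measurable_EFinP; apply: measurable_funM => //; apply: measurable_funD => //.
  apply: measurable_funM => //; apply: measurableT_comp; first exact: measurable_ln_plus.
  by apply: measurable_funM => //; apply: measurable_funM.
move=> x _.
apply: (@le_trans _ _ ((h x)%:E * \sum_(j <oo) (count_pow 2 (2 * h x / l) j)%:E)).
  rewrite -nneseriesZl; last by move=> j _; rewrite lee_fin.
  apply: lee_nneseries => [j _ _|j _]; first by rewrite lee_fin; exact: cutoff_ge0.
  rewrite -EFinM lee_fin /cutoff ler_wpM2l// /count_pow indicE.
  have [xL|//] := boolP (x \in L j).
  move: xL; rewrite inE /L /= => xL; rewrite (_ : _ < _)%R//.
  by rewrite ltr_pdivlMr// mulrC; lra.
rewrite EFinM lee_wpmul2l ?lee_fin//.
exact: eseries_count_pow2_le.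
Qed.

End dyadic_majorant.

(** Applied on the shell [k] with [a] the logarithm of [2 * h y / lambda k], [b] and [c] those of
    [h y] and [|y|] (all through [ln_plus]), [m = n + 1], [l = ln 2] and [Kl = k * ln 2]. *)
Lemma entropy_arith {R : realType} (a b c m Kl l : R) : 0 <= b -> 0 <= c -> 1 <= m ->
  l <= 1 -> Kl <= 1 + 2 * c -> a <= b + (l + m * Kl) ->
  1 + 2 * a <= 4 * (m + 1) * (1 + b + c).
Proof.
move=> b0 c0 m1 l1 Kc H.
have mb : 0 <= m * b by rewrite mulr_ge0//; lra.
have mc : 0 <= m * c by rewrite mulr_ge0//; lra.
have : m * Kl <= m * (1 + 2 * c) by rewrite ler_wpM2l//; lra.
rewrite (_ : 4 * (m + 1) * _ = 4 * m + 4 + 4 * (m * b) + 4 * (m * c) + 4 * b + 4 * c); last by ring.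
rewrite (_ : m * (1 + 2 * c) = m + 2 * (m * c)); last by ring.
lra.
Qed.

(** * Dyadic shells *)

Section shells.
Context {R : realType} {n : nat}.
Local Notation V := ('rV[R]_n).
Local Notation mu := (lebesgue_rV R n).
Implicit Types (x y : V).

Lemma measurable_norm_rV : measurable_fun setT (fun x : V => `|x|).
Proof. by apply: continuous_measurable_rV; exact: norm_continuous. Qed.

Definition shell k : set V :=
  if k is j.+1 then [set x : V | 2 ^+ j <= `|x| < 2 ^+ j.+1] else [set x : V | `|x| < 1].

Lemma shell_lt k x : shell k x -> `|x| < 2 ^+ k.
Proof. by case: k => [|k] //= /andP[]. Qed.

Lemma shell_ge k x : shell k.+1 x -> 2 ^+ k <= `|x|.
Proof. by move=> /= /andP[]. Qed.

Lemma measurable_shell k : measurable (shell k).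
Proof.
rewrite -[shell k]setTI; case: k => [|k].
  rewrite (_ : shell 0 = (fun x : V => `|x|) @^-1` `]-oo, 1[%classic).
    by apply: measurable_norm_rV.
  by apply/seteqP; split => x /=; rewrite in_itv.
rewrite (_ : shell k.+1 = (fun x : V => `|x|) @^-1` `[2 ^+ k, 2 ^+ k.+1[%classic).
  by apply: measurable_norm_rV.
by apply/seteqP; split => x /=; rewrite in_itv.
Qed.

Lemma shell_cover : \bigcup_k shell k = setT.
Proof.
rewrite -subTset => x _.
have ex : exists k, `|x| < 2 ^+ k.
  exists (Num.truncn `|x|).+1; apply: lt_trans (truncnS_gt _) _.
  by rewrite -natrX ltr_nat ltn_expl.
exists (ex_minn ex) => //; case: ex_minnP => -[|k] xk kmin; first by rewrite /= -[1](expr0 2).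
by rewrite /= xk andbT leNgt; apply/negP => /kmin; rewrite ltnn.
Qed.

Lemma trivIset_shell : trivIset setT shell.
Proof.
have H i j x : (i < j)%N -> shell i x -> shell j x -> False.
  case: j => // j ij /shell_lt h1 /shell_ge h2.
  have : 2 ^+ i <= 2 ^+ j :> R by rewrite ler_weXn2l// ler1n.
  lra.
apply/trivIsetP => i j _ _ ij; rewrite -subset0 => x [xi xj].
by move: ij; rewrite neq_ltn => /orP[] h; [exact: (H _ _ _ h xi xj)|exact: (H _ _ _ h xj xi)].
Qed.

Lemma lebesgue_shell_le k : (mu (shell k) <= (2 ^+ n * (2 ^+ k) ^+ n)%:E)%E.
Proof.
have p0 : 0 < 2 ^+ k :> R by rewrite exprn_gt0.
rewrite -exprMn -(lebesgue_rV_ball (0 : V) p0); apply: le_measure; rewrite ?inE.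
- exact: measurable_shell.
- exact: measurable_rV_ball.
- by move=> x /shell_lt xk; apply/rV_ballP; rewrite sub0r normrN.
Qed.

End shells.

(** * Majorants of the maximal function *)

Section convolution_bounds.
Context {R : realType} {n : nat}.
Local Notation V := ('rV[R]_n).
Local Notation mu := (lebesgue_rV R n).
Implicit Types (x y : V) (t : R) (f : V -> R).
Variables (phi : V -> R) (C0 L : R).
Hypotheses (phi_cont : continuous phi) (phi_supp : forall x, 1 < `|x| -> phi x = 0).
Hypotheses (C00 : 0 < C0) (phi_le : forall x, `|phi x| <= C0).
Hypotheses (L0 : 0 < L) (phi_lip : forall x y, `|phi x - phi y| <= L * `|x - y|).

Lemma measurable_phi : measurable_fun setT phi.
Proof. exact: continuous_measurable_rV. Qed.

Lemma measurable_dilate t x : measurable_fun setT (fun y => dilate phi t (x - y)).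
Proof.
apply: measurable_funM => //.
apply: (measurableT_comp measurable_phi).
apply: measurable_fun_rVP => i.
rewrite (_ : _ \o _ = fun y => t^-1 * (x ord0 i - rV_coord i y)); last first.
  by apply/funext => y; rewrite /rV_coord /= !mxE.
apply: measurable_funM => //; apply: measurable_funB => //.
exact: measurable_rV_coord.
Qed.

Lemma dilate_le t x : 0 < t -> `|dilate phi t x| <= C0 * t ^- n.
Proof.
move=> t0; rewrite normrM ger0_norm ?invr_ge0 ?exprn_ge0 ?(ltW t0)// mulrC.
by rewrite ler_wpM2r// invr_ge0 exprn_ge0// ltW.
Qed.

Lemma dilate_supp t x : 0 < t -> t < `|x| -> dilate phi t x = 0.
Proof.
move=> t0 tx; rewrite /dilate phi_supp ?mulr0// normrZ gtr0_norm ?invr_gt0//.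
by rewrite ltr_pdivlMl// mulr1.
Qed.

Lemma dilate_integrable t x f : 0 < t -> L1 f ->
  mu.-integrable setT (EFin \o (fun y => dilate phi t (x - y) * f y)).
Proof.
move=> t0 fL.
apply: (@integrableMr _ _ _ mu setT measurableT (fun y => dilate phi t (x - y)) (EFin \o f)) => //.
  exact: measurable_dilate.
exists (C0 * t ^- n); split; first exact: num_real.
by move=> M CM y _; apply: le_trans (ltW CM); exact: dilate_le.
Qed.

Local Open Scope ereal_scope.

Lemma integral_norm_lty f : L1 f -> \int[mu]_y `|f y|%:E < +oo.
Proof. by move=> /integrableP[]. Qed.

Lemma measurable_L1 f : L1 f -> measurable_fun setT f.
Proof. by move=> fL; apply/measurable_EFinP; exact: measurable_int fL. Qed.

(** The radius [2 * t] leaves room for the boundary of the support, balls being open. *)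
Lemma convolution_near t x f : (0 < t)%R -> L1 f ->
  `|convolution (dilate phi t) f x|%:E <=
  (C0 * t ^- n)%:E * \int[mu]_(y in ball x (2 * t)%R) `|f y|%:E.
Proof.
move=> t0 fL; rewrite /convolution EFin_normr_Rintegral//; last exact: dilate_integrable.
have mf := measurable_L1 fL.
have c0 : (0 <= C0 * t ^- n)%R by rewrite mulr_ge0 ?(ltW C00)// invr_ge0 exprn_ge0// ltW.
have mB : measurable (ball x (2 * t)%R) by exact: measurable_rV_ball.
have mnf : measurable_fun setT (fun y => `|f y|%R) by exact: measurableT_comp.
apply: le_trans (le_abse_integral _ _ _) _ => //.
  by apply: measurable_int; exact: dilate_integrable.
rewrite -[ball x _]setTI -integral_cutoff -ge0_integralZl//; last 2 first.
- by apply/measurable_EFinP; exact: measurable_cutoff.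
- by move=> y _; rewrite lee_fin; exact: cutoff_ge0.
apply: ge0_le_integral => //.
- apply/measurable_EFinP; apply: measurableT_comp => //.
  by apply: measurable_funM => //; exact: measurable_dilate.
- by apply/measurable_EFinP; apply: measurable_funM => //; exact: measurable_cutoff.
move=> y _; rewrite /= lee_fin normrM.
have [xy|xy] := ltP `|x - y|%R (2 * t)%R.
  rewrite cutoff_in; last exact/rV_ballP.
  by rewrite ler_wpM2r//; exact: dilate_le.
rewrite dilate_supp ?normr0 ?mul0r//; last by lra.
by rewrite mulr_ge0//; exact: cutoff_ge0.
Qed.

(** As [f] has integral 0, the constant [dilate phi t x] may be subtracted from the kernel. The
    difference is controlled by the Lipschitz bound where [|y| <= t] and by the sup bound
    elsewhere. *)
Lemma convolution_far t x f : (0 < t)%R -> L1 f -> (\int[mu]_y f y = 0)%R ->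
  `|convolution (dilate phi t) f x|%:E <=
  ((L + 2 * C0) * t ^- n)%:E * \int[mu]_y (Num.min (`|y| / t) 1 * `|f y|)%:E.
Proof.
move=> t0 fL f_int.
have mf := measurable_L1 fL.
have mnf : measurable_fun setT (fun y => `|f y|%R) by exact: measurableT_comp.
have tn0 : (0 < t ^- n)%R by rewrite invr_gt0 exprn_gt0.
have i1 := dilate_integrable x t0 fL.
have i2 : mu.-integrable setT (EFin \o (fun y => dilate phi t x * f y)%R).
  have := integrableZl measurableT (dilate phi t x) fL.
  by apply: eq_integrable => // y _ /=; rewrite EFinM.
have -> : convolution (dilate phi t) f x =
   (\int[mu]_y (dilate phi t (x - y) * f y - dilate phi t x * f y))%R.
  by rewrite RintegralB// RintegralZl// f_int mulr0 subr0.
have i3 : mu.-integrable setT (EFin \o (fun y => dilate phi t (x - y) * f y - dilate phi t x * f y)%R).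
  have := integrableB measurableT i1 i2.
  by apply: eq_integrable => // y _ /=; rewrite EFinB.
rewrite EFin_normr_Rintegral//.
apply: le_trans (le_abse_integral _ _ _) _ => //; first exact: measurable_int i3.
have mg : measurable_fun setT (fun y : V => (Num.min (`|y| / t) 1 * `|f y|)%R).
  apply: measurable_funM => //; apply: measurable_minr => //.
  by apply: measurable_funM => //; exact: measurable_norm_rV.
have g0 y : (0 <= Num.min (`|y| / t) 1 * `|f y|)%R.
  by rewrite mulr_ge0// le_min ler01 andbT divr_ge0// ltW.
rewrite -ge0_integralZl//; last 3 first.
- exact/measurable_EFinP.
- by move=> y _; rewrite lee_fin.
- by rewrite lee_fin mulr_ge0 ?(ltW tn0)// addr_ge0 ?mulr_ge0 ?(ltW C00) ?(ltW L0).
apply: ge0_le_integral => //.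
- by apply: measurableT_comp => //; exact: measurable_int i3.
- by apply/measurable_EFinP; apply: measurable_funM.
move=> y _; rewrite /= lee_fin -mulrBl normrM mulrA ler_wpM2r//.
rewrite /dilate -mulrBr normrM (gtr0_norm tn0) mulrAC mulrC ler_wpM2r ?(ltW tn0)//.
have [yt|yt] := leP (`|y| / t)%R 1%R.
  apply: le_trans (phi_lip _ _) _.
  rewrite -scalerBr addrAC subrr add0r normrZ normrN gtr0_norm ?invr_gt0//.
  rewrite [(_^-1 * _)%R]mulrC ler_wpM2r// ?lerDl ?mulr_ge0 ?(ltW C00)//.
  by rewrite invr_ge0 ltW.
rewrite mulr1; apply: le_trans (ler_normB _ _) _.
apply: le_trans (lerD (phi_le _) (phi_le _)) _.
by rewrite mulr_natl mulr2n lerDr ltW.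
Qed.

Let A_ k := @shell R n k.
Let W (h : V -> R) y : R := (h y * (1 + ln_plus (h y) + ln_plus `|y|))%R.

(* lambda k is chosen so that the trivial part lambda k * |B(0, 2 ^ (k + 1))| is summable. *)
Let lambda k : R := ((2 ^+ k)^-1 ^+ n.+1)%R.

Let lambda_gt0 k : (0 < lambda k)%R.
Proof. by rewrite exprn_gt0// invr_gt0 exprn_gt0. Qed.

(* Bounds the dilations with [t] small compared with [|x|]; only points of [ball 0 (2 ^+ k.+1)] are
   within reach of the shell [A_ k]. *)
Let near_majorant (h : V -> R) k x : \bar R :=
  (C0 * 4 ^+ n)%:E * (dyadic_max (cutoff h (A_ k)) (lambda k) x *
    (\1_(ball (0%R : V) (2 ^+ k.+1)%R) x)%:E).

(* Bounds the dilations with [t] at least comparable to [|x|], for [x] in the shell [A_ k]. *)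
Let far_majorant (h : V -> R) k x : \bar R :=
  ((L + 2 * C0) * 8 ^+ n.+1)%:E *
   (((2 ^+ k)^-1 ^+ n)%:E * \int[mu]_y (Num.min (`|y| / 2 ^+ k) 1 * h y)%:E) *
  (\1_(A_ k) x)%:E.

Section maximal_majorant.
Variable f : V -> R.
Hypotheses (fL : L1 f) (f_int : (\int[mu]_y f y = 0)%R).
Let h y := `|f y|%R.
Let h0 y : (0 <= h y)%R. Proof. exact: normr_ge0. Qed.
Let mf : measurable_fun setT f. Proof. exact: measurable_L1. Qed.
Let mh : measurable_fun setT h. Proof. exact: measurableT_comp. Qed.
Let mA k : measurable (A_ k). Proof. exact: measurable_shell. Qed.

Let hk_int k : mu.-integrable setT (EFin \o cutoff h (A_ k)).
Proof.
apply: (le_integrable measurableT _ _ (integrable_norm fL)).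
  by apply/measurable_EFinP; exact: measurable_cutoff.
move=> x _; rewrite /= lee_fin !normrM normr_id ler_piMr// indicE.
by case: (_ \in _); rewrite ?normr1 ?normr0.
Qed.

Lemma near_majorant_ge0 k x : 0 <= near_majorant h k x.
Proof.
rewrite mule_ge0// ?lee_fin ?mulr_ge0 ?(ltW C00)//.
by rewrite mule_ge0// dyadic_max_ge0.
Qed.

Lemma far_majorant_ge0 k x : 0 <= far_majorant h k x.
Proof.
rewrite !mule_ge0//.
  by rewrite lee_fin !mulr_ge0 ?addr_ge0 ?mulr_ge0 ?(ltW C00) ?(ltW L0).
by apply: integral_ge0 => y _; rewrite lee_fin mulr_ge0// le_min ler01 andbT.
Qed.

Lemma convolution_le_majorant t x : (0 < t)%R ->
  `|convolution (dilate phi t) f x|%:E <=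
  \sum_(k <oo) near_majorant h k x + \sum_(k <oo) far_majorant h k x.
Proof.
move=> t0.
have S1 : 0 <= \sum_(k <oo) near_majorant h k x.
  by apply: nneseries_ge0 => k _ _; exact: near_majorant_ge0.
have S2 : 0 <= \sum_(k <oo) far_majorant h k x.
  by apply: nneseries_ge0 => k _ _; exact: far_majorant_ge0.
(* Below the threshold, a point [y] within [2 * t] of [x] satisfies [|x| < 2 * |y|] when [|x| >= 1],
   so only shells [k] with [|x| < 2 ^+ k.+1] contribute. Above it, [t >= 2 ^+ k / 8] for [x] in the
   shell [k], whence the powers of 8 in [far_majorant]. *)
have [tx|tx] := ltP t (Num.max 1 `|x| / 4)%R.
  apply: (@le_trans _ _ (\sum_(k <oo) near_majorant h k x)); last by rewrite leeDl.
  apply: le_trans (convolution_near _ t0 fL) _.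
  have mB : measurable (ball x (2 * t)%R) by exact: measurable_rV_ball.
  have -> : ball x (2 * t)%R = \bigcup_k (ball x (2 * t)%R `&` A_ k).
    by rewrite -setI_bigcupr shell_cover setIT.
  rewrite ge0_integral_bigcup//; last 3 first.
  - by move=> k; exact: measurableI.
  - by apply/measurable_EFinP; apply: measurable_funS mh.
  - by apply: trivIset_setIl; exact: trivIset_shell.
  have c0 : (0 <= C0 * t ^- n)%R by rewrite mulr_ge0 ?(ltW C00)// invr_ge0 exprn_ge0// ltW.
  rewrite -nneseriesZl; last by move=> k _; apply: integral_ge0.
  apply: lee_nneseries => [k _ _|k _]; first by rewrite mule_ge0// integral_ge0.
  rewrite -integral_cutoff /near_majorant.
  have [xk|xk] := pselect (ball (0%R : V) (2 ^+ k.+1)%R x).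
    rewrite indicE mem_set// mule1.
    have t2 : (0 < 2 * t)%R by rewrite mulr_gt0.
    have := ball_le_dyadic_max (cutoff_ge0 (A_ k) h0) (hk_int k) t2 (lambda_gt0 k) (rV_ball_self x t2).
    move=> /(lee_wpmul2l (_ : 0 <= (C0 * t ^- n)%:E)) => /(_ _)/le_trans; apply; first by rewrite lee_fin.
    rewrite muleA -EFinM.
    rewrite (_ : C0 * t ^- n * _ = C0 * 4 ^+ n)%R//.
    rewrite mulrA (_ : 2 * 2 = 4)%R; last lra.
    rewrite exprMn; field.
    by rewrite gt_eqF// exprn_gt0.
  rewrite indicE memNset// mule0 mule0 (_ : integral _ _ _ = 0) ?mule0//.
  rewrite integral_cutoff (_ : _ `&` _ = set0) ?integral_set0// -subset0 => y [/rV_ballP xy /shell_lt yk].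
  have {}xk : (2 ^+ k.+1 <= `|x|)%R.
    by rewrite leNgt; apply/negP => h'; apply: xk; apply/rV_ballP; rewrite sub0r normrN.
  have xm : (Num.max 1 `|x| = `|x|)%R.
    rewrite max_r//; apply: le_trans xk; rewrite exprn_ege1// ler1n//.
  have := ler_distD y x 0%R; rewrite !subr0.
  by move: xk; rewrite exprS; rewrite xm in tx; lra.
have [k _ xk] : (\bigcup_k A_ k) x by rewrite shell_cover.
apply: (@le_trans _ _ (far_majorant h k x)); last first.
  apply: (@le_trans _ _ (\sum_(k <oo) far_majorant h k x)); last by rewrite leeDr.
  apply: le_trans (@nneseries_lim_ge R (fun k => far_majorant h k x) xpredT 0 k.+1 _).
    rewrite big_nat_recr//= leeDr//.
    by apply: sume_ge0 => j _; exact: far_majorant_ge0.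
  by move=> j _ _; exact: far_majorant_ge0.
apply: le_trans (convolution_far _ t0 fL f_int) _.
have p0 : (0 < 2 ^+ k :> R)%R by rewrite exprn_gt0.
have t8 : (2 ^+ k / 8 <= t)%R.
  apply: le_trans tx; case: k xk p0 => [|k] xk p0.
    by have : (1 <= Num.max 1 `|x|)%R; [rewrite le_max lexx|rewrite expr0; lra].
  have := shell_ge xk; have : (`|x| <= Num.max 1 `|x|)%R by rewrite le_max lexx orbT.
  by rewrite exprS; lra.
rewrite /far_majorant indicE mem_set// mule1 muleA -EFinM.
have mg s : measurable_fun setT (fun y : V => (Num.min (`|y| / s) 1 * h y)%R).
  apply: measurable_funM => //; apply: measurable_minr => //.
  by apply: measurable_funM => //; exact: measurable_norm_rV.
have g0 s y : (0 < s)%R -> (0 <= Num.min (`|y| / s) 1 * h y)%R.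
  by move=> s0; rewrite mulr_ge0// le_min ler01 andbT divr_ge0// ltW.
apply: (@le_trans _ _ (((L + 2 * C0) * t ^- n)%:E *
   (8%:E * \int[mu]_y (Num.min (`|y| / 2 ^+ k) 1 * h y)%:E))).
  apply: lee_wpmul2l.
    by rewrite lee_fin mulr_ge0 ?addr_ge0 ?mulr_ge0 ?(ltW C00) ?(ltW L0)// invr_ge0 exprn_ge0 ?(ltW t0).
  rewrite -ge0_integralZl//; last 2 first.
  - exact/measurable_EFinP.
  - by move=> y _; rewrite lee_fin g0.
  apply: ge0_le_integral => //.
  - by move=> y _; rewrite lee_fin g0.
  - exact/measurable_EFinP.
  - by apply/measurable_EFinP; apply: measurable_funM.
  move=> y _; rewrite -EFinM lee_fin mulrA ler_wpM2r//.
  have yt : (`|y| / t <= 8 * (`|y| / 2 ^+ k))%R.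
    rewrite mulrCA ler_wpM2l// -[leRHS]invrK lef_pV2 ?posrE// invf_div//.
  rewrite ge_min; have [y1|y1] := leP (`|y| / 2 ^+ k)%R 1%R; first by rewrite yt.
  by apply/orP; right; lra.
rewrite muleA -EFinM; apply: lee_wpmul2r.
  by apply: integral_ge0 => y _; rewrite lee_fin g0.
rewrite lee_fin exprS -!mulrA ler_wpM2l ?addr_ge0 ?mulr_ge0 ?(ltW C00) ?(ltW L0)//.
rewrite mulrC ler_wpM2l// -exprMn -[(t ^+ n)^-1%R]exprVn.
rewrite lerXn2r ?nnegrE ?mulr_ge0 ?invr_ge0 ?(ltW t0) ?(ltW p0)//.
by rewrite -[leRHS]invrK lef_pV2 ?posrE// ?invr_gt0 ?mulr_gt0// ?invr_gt0// invf_div.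
Qed.

Let C0n : (0 <= C0 * 4 ^+ n)%R. Proof. by rewrite mulr_ge0 ?(ltW C00). Qed.

Let mW : measurable_fun setT (W h).
Proof.
apply: measurable_funM => //; apply: measurable_funD => //.
  apply: measurable_funD => //.
  by apply: measurableT_comp mh; exact: measurable_ln_plus.
by apply: measurableT_comp measurable_norm_rV; exact: measurable_ln_plus.
Qed.

Let W0 y : (0 <= W h y)%R.
Proof. by rewrite mulr_ge0// !addr_ge0// ln_plus_ge0. Qed.

Let measurable_near k : measurable_fun setT (near_majorant h k).
Proof.
apply: emeasurable_funM => //; apply: emeasurable_funM.
  by apply: measurable_dyadic_max; exact: lambda_gt0.
by apply/measurable_EFinP; apply: measurable_indic; exact: measurable_rV_ball.
Qed.

Let measurable_far k : measurable_fun setT (far_majorant h k).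
Proof.
apply: emeasurable_funM => //.
by apply/measurable_EFinP; apply: measurable_indic.
Qed.

(** On the shell [k] the logarithm of [1 / lambda k] is a multiple of [k], and [k] is at most
    [1 + 2 * ln_plus |y|]: here the weight at infinity enters. *)
Lemma near_entropy_le k y :
  (cutoff h (A_ k) y * (1 + 2 * ln_plus (2 * cutoff h (A_ k) y / lambda k)) <=
   4 * n.+2%:R * cutoff (W h) (A_ k) y)%R.
Proof.
have [yk|yk] := pselect (A_ k y); last by rewrite !cutoff_out// mul0r mulr0.
rewrite !cutoff_in// /W mulrCA ler_wpM2l//.
have b1 : (1 <= 2 * (2 ^+ k) ^+ n.+1 :> R)%R.
  by rewrite mulr_ege1 ?ler1n// exprn_ege1// exprn_ege1// ler1n.
have := ln_plusM (h0 y) b1.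
rewrite (_ : h y * _ = 2 * h y / lambda k)%R; last first.
  by rewrite /lambda exprVn invrK; ring.
rewrite lnM ?posrE ?exprn_gt0// -exprM ln_pow//.
have lk : (k%:R <= 1 + 2 * ln_plus `|y| :> R)%R.
  case: k yk b1 => [|k] yk b1; first by rewrite addr_ge0// mulr_ge0// ln_plus_ge0.
  by rewrite -natr1 addrC lerD2l; apply: pow2_le_ln; exact: shell_ge yk.
rewrite (_ : (k * n.+1)%:R * _ = n.+1%:R * (k%:R * ln 2))%R; last by rewrite natrM; ring.
rewrite -(natr1 n.+1); apply: entropy_arith; rewrite ?ln_plus_ge0 ?ln2_le1 ?ler1n//.
by apply: le_trans lk; rewrite ler_piMr// ln2_le1.
Qed.

Lemma integral_near_le k : \int[mu]_x near_majorant h k x <=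
  (C0 * 4 ^+ n)%:E * ((4 ^+ n * (2 / (2 ^ k.+1)%:R))%:E +
     (4 * 3 ^+ n * (4 * n.+2%:R))%:E * \int[mu]_(y in A_ k) (W h y)%:E).
Proof.
have ch0 := cutoff_ge0 (A_ k) h0.
have mB : measurable (ball (0%R : V) (2 ^+ k.+1)%R) by exact: measurable_rV_ball.
rewrite ge0_integralZl//; last 2 first.
- apply: emeasurable_funM; first by apply: measurable_dyadic_max; exact: lambda_gt0.
  by apply/measurable_EFinP; apply: measurable_indic.
- by move=> x _; rewrite mule_ge0// dyadic_max_ge0.
apply: lee_wpmul2l; first by rewrite lee_fin.
have -> : \int[mu]_x (dyadic_max (cutoff h (A_ k)) (lambda k) x *
      (\1_(ball (0%R : V) (2 ^+ k.+1)%R) x)%:E) =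
    \int[mu]_(x in ball (0%R : V) (2 ^+ k.+1)%R) dyadic_max (cutoff h (A_ k)) (lambda k) x.
  by rewrite [in RHS]integral_mkcond epatch_indic.
apply: le_trans (integral_dyadic_max ch0 (hk_int k) mB (lambda_gt0 k)) _.
apply: leeD.
  rewrite lebesgue_rV_ballM ?exprn_gt0// -EFinM lee_fin.
  (* [lambda k] times the volume of the ball is [4 ^+ n / 2 ^+ k], put in the form of the geometric
     series summed in [integral_majorant_lty]. *)
  rewrite le_eqVlt; apply/orP; left; apply/eqP.
  rewrite natrX /lambda (_ : 2 * 2 ^+ k.+1 = 4 * 2 ^+ k)%R; last by rewrite exprS; ring.
  rewrite !exprS exprMn exprVn.
  have : (2 ^+ k != 0 :> R)%R by rewrite expf_neq0.
  have : ((2 ^+ k) ^+ n != 0 :> R)%R by rewrite !expf_neq0.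
  move=> u0 v0; field.
  by rewrite u0 v0.
rewrite [X in _ <= X * _]EFinM -muleA; apply: lee_wpmul2l.
  by rewrite lee_fin mulr_ge0// exprn_ge0.
have -> : \int[mu]_(y in A_ k) (W h y)%:E = \int[mu]_y (cutoff (W h) (A_ k) y)%:E.
  by rewrite integral_cutoff setTI.
rewrite -ge0_integralZl//; last 2 first.
- by apply/measurable_EFinP; exact: measurable_cutoff.
- by move=> y _; rewrite lee_fin; exact: cutoff_ge0.
apply: ge0_le_integral => //.
- by move=> y _; rewrite lee_fin; apply: mulr_ge0; rewrite ?addr_ge0 ?mulr_ge0 ?ln_plus_ge0 ?ch0.
- apply/measurable_EFinP; apply: measurable_funM; first exact: measurable_cutoff.
  apply: measurable_funD => //; apply: measurable_funM => //.
  apply: measurableT_comp; first exact: measurable_ln_plus.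
  apply: measurable_funM => //; apply: measurable_funM => //; exact: measurable_cutoff.
- by apply/measurable_EFinP; apply: measurable_funM => //; exact: measurable_cutoff.
by move=> y _; rewrite -EFinM lee_fin near_entropy_le.
Qed.

Let I_ k := \int[mu]_y (Num.min (`|y| / 2 ^+ k) 1 * h y)%:E.

Let I_ge0 k : 0 <= I_ k.
Proof.
by apply: integral_ge0 => y _; rewrite lee_fin mulr_ge0// le_min ler01 andbT.
Qed.

(** The volume of the shell cancels the decay of the dilations. *)
Lemma integral_far_le k : \int[mu]_x far_majorant h k x <=
  ((L + 2 * C0) * 8 ^+ n.+1 * 2 ^+ n)%:E * I_ k.
Proof.
have C10 : (0 <= (L + 2 * C0) * 8 ^+ n.+1)%R.
  by rewrite !mulr_ge0 ?addr_ge0 ?mulr_ge0 ?(ltW C00) ?(ltW L0).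
rewrite ge0_integralZl//; last 2 first.
- by apply/measurable_EFinP; apply: measurable_indic.
- by rewrite mule_ge0// mule_ge0//; exact: I_ge0.
rewrite integral_indic// setIT [X in _ <= X * _]EFinM -!muleA; apply: lee_wpmul2l; first by rewrite lee_fin.
rewrite -/(I_ k) muleCA [X in _ <= X]muleC; apply: lee_wpmul2l => //.
apply: le_trans (lee_wpmul2l _ (lebesgue_shell_le k)) _; first by rewrite lee_fin.
rewrite -EFinM lee_fin exprVn.
have : ((2 ^+ k) ^+ n != 0 :> R)%R by rewrite !expf_neq0.
by move=> u0; rewrite mulrC mulfK.
Qed.

(** For fixed [y] the minima over [k] consist of about [ln_plus |y|] terms equal to 1, up to
    constants, and a geometric tail. *)
Lemma eseries_I_le : \sum_(k <oo) I_ k <= 4%:E * \int[mu]_y (W h y)%:E.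
Proof.
have mg s : measurable_fun setT (fun y : V => (Num.min (`|y| / s) 1 * h y)%R).
  apply: measurable_funM => //; apply: measurable_minr => //.
  by apply: measurable_funM => //; exact: measurable_norm_rV.
have g0 k y : (0 <= Num.min (`|y| / 2 ^+ k) 1 * h y)%R.
  by rewrite mulr_ge0// le_min ler01 andbT.
rewrite -integral_nneseries//; last 2 first.
- by move=> k; exact/measurable_EFinP.
- by move=> k y _; rewrite lee_fin.
rewrite -ge0_integralZl//; last 2 first.
- exact/measurable_EFinP.
- by move=> y _; rewrite lee_fin.
apply: ge0_le_integral => //.
- by move=> y _; apply: nneseries_ge0 => k _ _; rewrite lee_fin.
- by apply: ge0_emeasurable_sum => k; [move=> y _ _; rewrite lee_fin|move=> _; exact/measurable_EFinP].
- by apply/measurable_EFinP; apply: measurable_funM.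
move=> y _.
under eq_eseriesr do rewrite mulrC EFinM.
rewrite nneseriesZl; last by move=> k _; rewrite lee_fin le_min ler01 andbT.
apply: le_trans (lee_wpmul2l _ (eseries_min_pow2_le (normr_ge0 y))) _; first by rewrite lee_fin.
rewrite -!EFinM lee_fin /W mulrCA ler_wpM2l//.
by have := ln_plus_ge0 (h y); have := ln_plus_ge0 `|y|%R; lra.
Qed.

Hypothesis Wfin : \int[mu]_y (W h y)%:E < +oo.

Lemma integral_majorant_lty :
  \int[mu]_x (\sum_(k <oo) near_majorant h k x + \sum_(k <oo) far_majorant h k x) < +oo.
Proof.
rewrite ge0_integralD//; last 4 first.
- by move=> x _; apply: nneseries_ge0 => k _ _; exact: near_majorant_ge0.
- by apply: ge0_emeasurable_sum => k // x _ _; exact: near_majorant_ge0.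
- by move=> x _; apply: nneseries_ge0 => k _ _; exact: far_majorant_ge0.
- by apply: ge0_emeasurable_sum => k // x _ _; exact: far_majorant_ge0.
rewrite !integral_nneseries//; last 2 first.
- by move=> k x _; exact: far_majorant_ge0.
- by move=> k x _; exact: near_majorant_ge0.
have Wge0 : 0 <= \int[mu]_y (W h y)%:E by apply: integral_ge0 => y _; rewrite lee_fin.
apply: lte_add_pinfty.
  apply: (@le_lt_trans _ _ (\sum_(k <oo) (C0 * 4 ^+ n)%:E * ((4 ^+ n * (2 / (2 ^ k.+1)%:R))%:E +
     (4 * 3 ^+ n * (4 * n.+2%:R))%:E * \int[mu]_(y in A_ k) (W h y)%:E))).
    apply: lee_nneseries => [k _ _|k _]; last exact: integral_near_le.
    by apply: integral_ge0 => x _; exact: near_majorant_ge0.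
  have c1 : (0 <= 4 * 3 ^+ n * (4 * n.+2%:R) :> R)%R by [].
  have W0k k : 0 <= \int[mu]_(y in A_ k) (W h y)%:E by apply: integral_ge0 => y _; rewrite lee_fin.
  rewrite nneseriesZl; last first.
    by move=> k _; rewrite adde_ge0// mule_ge0.
  rewrite nneseriesD; last 2 first.
  - by move=> k _ _; rewrite lee_fin.
  - by move=> k _ _; rewrite mule_ge0.
  rewrite nneseriesZl//.
  under eq_eseriesr do rewrite EFinM.
  rewrite nneseriesZl//.
  rewrite lte_mul_pinfty ?lee_fin//; apply: lte_add_pinfty.
    rewrite lte_mul_pinfty ?lee_fin//.
    by apply: (le_lt_trans (epsilon_trick0 xpredT (ler0n R 2))); rewrite ltry.
  rewrite lte_mul_pinfty ?lee_fin//.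
  rewrite -ge0_integral_bigcup//.
  - by rewrite shell_cover.
  - by apply/measurable_EFinP; apply: measurable_funS mW.
  - by move=> y _; rewrite lee_fin.
  - exact: trivIset_shell.
apply: (@le_lt_trans _ _ (\sum_(k <oo) ((L + 2 * C0) * 8 ^+ n.+1 * 2 ^+ n)%:E * I_ k)).
  apply: lee_nneseries => [k _ _|k _]; last exact: integral_far_le.
  by apply: integral_ge0 => x _; exact: far_majorant_ge0.
rewrite nneseriesZl//.
have C10 : (0 <= (L + 2 * C0) * 8 ^+ n.+1 * 2 ^+ n)%R.
  by rewrite !mulr_ge0 ?addr_ge0 ?mulr_ge0 ?(ltW C00) ?(ltW L0).
rewrite lte_mul_pinfty ?lee_fin//.
apply: le_lt_trans eseries_I_le _.
by rewrite lte_mul_pinfty.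
Qed.

Lemma integral_hardy_maximal_lty : \int[mu]_x hardy_maximal phi f x < +oo.
Proof.
apply: le_lt_trans integral_majorant_lty; apply: ge0_le_integral_nonmeasurable.
  move=> x; apply: (@le_trans _ _ `|convolution (dilate phi 1) f x|%:E).
    by rewrite lee_fin.
  by apply: ereal_sup_ubound; exists 1%R => //=.
by move=> x; apply: ge_ereal_sup => _ [t /= t0 <-]; exact: convolution_le_majorant.
Qed.

End maximal_majorant.

End convolution_bounds.

Lemma hardy_maximal_ge0 {R : realType} {n : nat} (phi f : 'rV[R]_n -> R) x :
  (0 <= hardy_maximal phi f x)%E.
Proof.
apply: (@le_trans _ _ `|convolution (dilate phi 1) f x|%:E); first by rewrite lee_fin.
by apply: ereal_sup_ubound; exists 1%R => //=.
Qed.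

(** * The vector space LlogL *)

Section LlogL_facts.
Context {R : realType} {n : nat}.
Local Notation V := ('rV[R]_n).
Local Notation mu := (lebesgue_rV R n).
Implicit Types (f g : V -> R) (x y : V).

Lemma measurable_euclid_norm : measurable_fun setT (@euclid_norm R n).
Proof.
have ms : measurable_fun setT (@Num.sqrt R).
  by apply: continuous_measurable_fun; exact: sqrt_continuous.
apply: (measurableT_comp ms).
apply: measurable_sum => i; apply: measurable_funX.
exact: measurable_rV_coord.
Qed.

Definition entropy f x : R := `|f x| * (ln_plus `|f x| + ln_plus (euclid_norm x)).

Lemma entropy_ge0 f x : 0 <= entropy f x.
Proof. by rewrite mulr_ge0// addr_ge0// ln_plus_ge0. Qed.

Lemma measurable_entropy f : measurable_fun setT f -> measurable_fun setT (entropy f).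
Proof.
move=> mf; have mnf : measurable_fun setT (fun x => `|f x|) by exact: measurableT_comp.
apply: measurable_funM => //; apply: measurable_funD.
  by apply: measurableT_comp mnf; exact: measurable_ln_plus.
by apply: measurableT_comp measurable_euclid_norm; exact: measurable_ln_plus.
Qed.

(** With [s] the larger of [|f x|] and [|g x|], the combination is at most [s * b] and the logarithm
    of the product splits. The leftover multiple of [ln b] is integrable because [f] and [g] are. *)
Lemma entropyD f g a x : entropy (a *: f + g) x <=
  2 * (1 + `|a|) * (entropy f x + entropy g x +
     ln (2 * (1 + `|a|)) * (`|f x| + `|g x|)).
Proof.
set b := 2 * _; have a0 := normr_ge0 a.
have b1 : 1 <= b by rewrite /b; lra.
have lb : 0 <= ln b by exact: ln_ge0.
set s := Num.max `|f x| `|g x|.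
have s0 : 0 <= s by rewrite le_max normr_ge0.
have afg : `|(a *: f + g) x| <= s * b.
  rewrite /GRing.add /GRing.scale /=; apply: le_trans (ler_normD _ _) _.
  rewrite normrM.
  have fs : `|f x| <= s by rewrite le_max lexx.
  have gs : `|g x| <= s by rewrite le_max lexx orbT.
  have : `|a| * `|f x| <= `|a| * s by rewrite ler_wpM2l.
  have : 0 <= `|a| * s by rewrite mulr_ge0.
  by rewrite /b (_ : s * _ = 2 * s + 2 * (`|a| * s)); [lra|ring].
set w := ln_plus (euclid_norm x).
have w0 : 0 <= w by exact: ln_plus_ge0.
have lw := ln_plusM s0 b1.
have ls := ln_plus_le afg.
have l0 := ln_plus_ge0 s.
apply: (@le_trans _ _ (s * b * (ln_plus s + ln b + w))).
  rewrite /entropy; apply: ler_pM => //; first by rewrite addr_ge0// ln_plus_ge0.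
  by rewrite lerD2r; lra.
rewrite -mulrA mulrCA ler_wpM2l//; first by lra.
rewrite addrAC mulrDr.
have : s * (ln_plus s + w) <= entropy f x + entropy g x.
  have e1 := entropy_ge0 f x; have e2 := entropy_ge0 g x.
  rewrite /s; case: (leP `|f x| `|g x|) => _.
    by rewrite -[leLHS]/(entropy g x) lerDr.
  by rewrite -[leLHS]/(entropy f x) lerDl.
have : s * ln b <= ln b * (`|f x| + `|g x|).
  rewrite mulrC ler_wpM2l// /s ge_max.
  by rewrite lerDl lerDr !normr_ge0.
by move=> h1 h2; exact: lerD.
Qed.

Local Open Scope ereal_scope.

Lemma LlogL_lin f g a : LlogL f -> LlogL g -> LlogL (a *: f + g)%R.
Proof.
move=> [fL fe] [gL ge]; split.
  have := integrableD measurableT (integrableZl measurableT a fL) gL.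
  by apply: eq_integrable => // x _ /=; rewrite -EFinM -EFinD.
have mf := measurable_L1 fL; have mg := measurable_L1 gL.
set b := (2 * (1 + `|a|))%R.
have b0 : (0 <= b)%R by rewrite mulr_ge0// addr_ge0.
have b1 : (1 <= b)%R by have := normr_ge0 a; rewrite /b; lra.
have lb : (0 <= ln b)%R by exact: ln_ge0.
apply: (@le_lt_trans _ _ (\int[mu]_x (b%:E * ((entropy f x)%:E + (entropy g x)%:E +
     (ln b)%:E * (`|f x|%:E + `|g x|%:E))))).
  apply: ge0_le_integral_nonmeasurable => x; first by rewrite lee_fin; exact: entropy_ge0.
  exact: entropyD.
have mnf : measurable_fun setT (fun x => `|f x|%R) by exact: measurableT_comp.
have mng : measurable_fun setT (fun x => `|g x|%R) by exact: measurableT_comp.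
have mef := measurable_entropy mf; have meg := measurable_entropy mg.
rewrite ge0_integralZl//; last 2 first.
- apply: emeasurable_funD; first by apply: emeasurable_funD; exact/measurable_EFinP.
  by apply: emeasurable_funM => //; apply: emeasurable_funD; exact/measurable_EFinP.
- by move=> x _; rewrite !adde_ge0 ?mule_ge0 ?adde_ge0 ?lee_fin ?entropy_ge0.
rewrite lte_mul_pinfty// ge0_integralD//; last 4 first.
- by move=> x _; rewrite adde_ge0// lee_fin entropy_ge0.
- by apply: emeasurable_funD; exact/measurable_EFinP.
- by move=> x _; rewrite mule_ge0// adde_ge0.
- by apply: emeasurable_funM => //; apply: emeasurable_funD; exact/measurable_EFinP.
apply: lte_add_pinfty.
  rewrite ge0_integralD//; first exact: lte_add_pinfty.
  - by move=> x _; rewrite lee_fin entropy_ge0.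
  - exact/measurable_EFinP.
  - by move=> x _; rewrite lee_fin entropy_ge0.
  - exact/measurable_EFinP.
rewrite ge0_integralZl//; last 2 first.
- by apply: emeasurable_funD; exact/measurable_EFinP.
- by move=> x _; rewrite adde_ge0.
rewrite lte_mul_pinfty// ge0_integralD//; [|exact/measurable_EFinP|exact/measurable_EFinP].
by apply: lte_add_pinfty; exact: integral_norm_lty.
Qed.

Lemma LlogL_subspace : L1_subspace (@LlogL R n).
Proof.
split; last by move=> f [].
split.
  rewrite inE; split.
    exact: (@integrable0 _ _ _ mu setT).
  rewrite (eq_integral (cst 0)) ?integral0 ?ltry// => x _.
  by rewrite normr0 mul0r.
by move=> a f g; rewrite !inE; exact: LlogL_lin.
Qed.

Lemma LlogL_dominated f g : LlogL g -> L1 f ->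
  {ae mu, forall x, `|f x| <= `|g x|}%R -> LlogL f.
Proof.
move=> [gL ge] fL fg; split => //; apply: le_lt_trans ge.
have mf := measurable_L1 fL; have mg := measurable_L1 gL.
apply: ae_ge0_le_integral => //.
- by move=> x _; rewrite lee_fin; exact: entropy_ge0.
- by apply/measurable_EFinP; exact: measurable_entropy.
- by move=> x _; rewrite lee_fin; exact: entropy_ge0.
- by apply/measurable_EFinP; exact: measurable_entropy.
apply: filterS fg => x fgx _; rewrite lee_fin.
apply: ler_pM => //; first by rewrite addr_ge0// ln_plus_ge0.
by rewrite lerD2r ln_plus_le.
Qed.

Lemma LlogL_dominated_in_hardy (phi : V -> R) : smooth_fun phi ->
  (forall x, 1 < euclid_norm x -> phi x = 0)%R ->
  dominated_in_hardy phi LlogL.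
Proof.
move=> phi_smooth phi_supp g f gS fL fg f_int; split => //.
have [_ fe] := LlogL_dominated gS fL fg.
have supp x : (1 < `|x| -> phi x = 0)%R.
  by move=> x1; apply: phi_supp; apply: lt_le_trans x1 (norm_le_euclid x).
have cphi := bump_continuous phi_smooth.
have [C C0 phiC] := bounded_of_support cphi supp.
have [L L0 phiL] := bump_lipschitz phi_smooth supp.
rewrite Lnorm1.
rewrite (eq_integral (hardy_maximal phi f)); last first.
  by move=> x _; rewrite gee0_abs// hardy_maximal_ge0.
apply: (integral_hardy_maximal_lty cphi supp C0 phiC L0 phiL fL f_int).
apply: (@le_lt_trans _ _ (\int[mu]_x (`|f x|%:E + (entropy f x)%:E))).
  apply: ge0_le_integral_nonmeasurable => x.
    by rewrite lee_fin mulr_ge0// !addr_ge0// ln_plus_ge0.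
  rewrite -EFinD lee_fin /entropy -addrA mulrDr mulr1 lerD2l ler_wpM2l// lerD2l.
  by apply: ln_plus_le; exact: norm_le_euclid.
have mf := measurable_L1 fL.
rewrite ge0_integralD//.
- by apply: lte_add_pinfty => //; exact: integral_norm_lty.
- by apply/measurable_EFinP; exact: measurableT_comp.
- by move=> x _; rewrite lee_fin entropy_ge0.
- by apply/measurable_EFinP; exact: measurable_entropy.
Qed.

End LlogL_facts.

Lemma lty_of_mull {R : realType} (c : R) (x : \bar R) :
  0 < c -> (c%:E * x < +oo)%E -> (x < +oo)%E.
Proof. by move=> c0; case: x => [r _| |//]; [rewrite ltry|rewrite gt0_muley ?lte_fin]. Qed.

(** * Summation over disjoint sets and balanced functions *)

Section integration_tools.
Context d {T : measurableType d} {R : realType} (mu : {measure set T -> \bar R}).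
Local Open Scope ereal_scope.

(** [M] will be the maximal function, whose measurability is not established; sum and integral are
    exchanged on the measurable minorants [a k] instead. *)
Lemma disjoint_sum_integral_le (P : (set T)^nat) (a : nat -> T -> \bar R) (M : T -> \bar R) :
  trivIset setT P -> (forall k, measurable (P k)) ->
  (forall k, measurable_fun setT (a k)) -> (forall k x, 0 <= a k x) ->
  (forall x, 0 <= M x) -> (forall k x, P k x -> a k x <= M x) ->
  \sum_(k <oo) \int[mu]_(x in P k) a k x <= \int[mu]_x M x.
Proof.
move=> tP mP ma a0 M0 aM.
have r0 k x : 0 <= (a k \_ (P k)) x by apply: erestrict_ge0.
have mr k : measurable_fun setT (a k \_ (P k)).
  by apply/(measurable_restrictT _ (mP k)).1; exact: measurable_funS (ma k).
under eq_eseriesr do rewrite integral_mkcond.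
rewrite -integral_nneseries//.
apply: ge0_le_integral_nonmeasurable => x; first exact: nneseries_ge0.
have [[k _ Pkx]|nP] := pselect ((\bigcup_k P k) x); last first.
  rewrite eseries0// => k _ _; rewrite /patch memNset// => Pkx.
  by apply: nP; exists k.
rewrite (@nneseriesD1 _ _ k)//= eseries0 ?adde0; last first.
  move=> j _ jk; rewrite /patch memNset// => Pjx.
  move/trivIsetP : tP => /(_ j k I I jk); rewrite -subset0 => /(_ x); apply.
  by split.
by rewrite /patch mem_set//; exact: aM.
Qed.

Variable h : T -> R.
Hypotheses (h0 : forall x, (0 <= h x)%R) (hi : mu.-integrable setT (EFin \o h)).

Let mh : measurable_fun setT h.
Proof. by apply/measurable_EFinP; exact: measurable_int hi. Qed.

Lemma nonneg_integral_lty E : measurable E -> \int[mu]_(x in E) (h x)%:E < +oo.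
Proof.
move=> mE; have /integrableP[_] := hi; apply: le_lt_trans.
under [leRHS]eq_integral do rewrite /= ger0_norm//.
exact: integral_ge0_subset.
Qed.

Lemma nonneg_integral_setC E : measurable E ->
  \int[mu]_x (h x)%:E = \int[mu]_(x in E) (h x)%:E + \int[mu]_(x in ~` E) (h x)%:E.
Proof.
move=> mE; rewrite -ge0_integral_setU//.
- by rewrite setUv.
- exact: measurableC.
- by apply/measurable_EFinP; apply: measurable_funS mh.
- by move=> x _; rewrite lee_fin.
- by rewrite disj_set2E setICr.
Qed.

(** The mass of [E j] tends to 0, so it ends up below half of a positive total; this supplies the
    inequality that [balance] asks for. *)
Lemma small_tail (E : (set T)^nat) : (forall j, measurable (E j)) ->
  nonincreasing_seq E -> mu (\bigcap_j E j) = 0 ->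
  exists j, \int[mu]_(x in E j) (h x)%:E <= \int[mu]_(x in ~` E j) (h x)%:E.
Proof.
move=> mE ndE E0.
have mcap : measurable (\bigcap_j E j) by exact: bigcapT_measurable.
have int_fin A : measurable A -> \int[mu]_(x in A) (h x)%:E \is a fin_num.
  move=> mA; rewrite ge0_fin_numE ?nonneg_integral_lty//.
  by apply: integral_ge0 => x _; rewrite lee_fin.
have [T0|T0] := leP (\int[mu]_x (h x)%:E) 0.
  exists 0%N; apply: (@le_trans _ _ 0).
    by apply: le_trans T0; exact: integral_ge0_subset.
  by apply: integral_ge0 => x _; rewrite lee_fin.
have cv : density mu h0 mh (E j) @[j --> \oo] --> 0.
  have <- : density mu h0 mh (\bigcap_j E j) = 0.
    rewrite densityE; apply: null_set_integral => //.
    by apply/measurable_EFinP; apply: measurable_funS mh.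
  apply: (@nonincreasing_cvg_mu _ _ _ (density mu h0 mh) E) => //.
  exact: nonneg_integral_lty.
have [j _ /(_ j (leqnn _)) /= Ej] : \forall j \near \oo,
    density mu h0 mh (E j) < (fine (\int[mu]_x (h x)%:E) / 2)%:E.
  apply: (cv [set x | x < (fine (\int[mu]_x (h x)%:E) / 2)%:E]).
  apply: open_nbhs_nbhs; split; first exact: open_ereal_lt_ereal.
  rewrite /= lte_fin divr_gt0//; apply: fine_gt0; rewrite T0 /=.
  exact: nonneg_integral_lty.
exists j; move: Ej; rewrite /density_set (nonneg_integral_setC (mE j)).
have := int_fin _ (mE j); have := int_fin _ (measurableC (mE j)).
case: (\int[mu]_(x in E j) _) => [a| |]//; case: (\int[mu]_(x in ~` E j) _) => [b| |]// _ _.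
by rewrite /= lte_fin lee_fin; lra.
Qed.

(* [ln_plus w] is comparable to the number of [i] such that [c * b ^+ i < w]. *)
Lemma integral_ln_plus_lty (w : T -> R) (c b : R) : measurable_fun setT w ->
  (forall x, (0 <= w x)%R) -> (0 < c)%R -> (1 < b)%R ->
  \sum_(i <oo) \int[mu]_(x in [set x | (c * b ^+ i < w x)%R]) (h x)%:E < +oo ->
  \int[mu]_x (h x * ln_plus (w x))%:E < +oo.
Proof.
move=> mw w0 c0 b1 sfin.
pose E i := [set x | (c * b ^+ i < w x)%R].
have mE i : measurable (E i) by exact: measurable_gt_level.
have Hh := nonneg_integral_lty measurableT.
(* [Num.max 1 c] dominates [c] and is at least 1, as [ln_plusM] requires; its logarithm only adds a
   multiple of the mass of [h]. *)
have m1c : (1 <= Num.max 1 c)%R by rewrite le_max lexx.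
have lc : (0 <= ln (Num.max 1 c))%R by exact: ln_ge0.
have lb : (0 <= ln b)%R by apply: ln_ge0; exact: ltW.
apply: (@le_lt_trans _ _ (\int[mu]_y ((@ln R (Num.max 1 c)%R)%:E * (h y)%:E +
    (ln b)%:E * \sum_(i <oo) (cutoff h (E i) y)%:E))).
  apply: ge0_le_integral_nonmeasurable => y.
    by rewrite lee_fin mulr_ge0// ln_plus_ge0.
  have wc : (0 <= w y / c)%R by rewrite divr_ge0// ltW.
  have := ln_plusM wc m1c.
  have : (ln_plus (w y) <= ln_plus (w y / c * Num.max 1 c))%R.
    apply: ln_plus_le; rewrite -[leLHS](divfK (lt0r_neq0 c0)).
    by rewrite ler_wpM2l// le_max lexx orbT.
  move=> /le_trans /[apply] H.
  apply: (@le_trans _ _ ((h y)%:E * ((ln_plus (w y / c))%:E + (ln (Num.max 1 c))%:E))).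
    by rewrite -EFinD -EFinM lee_fin ler_wpM2l.
  rewrite muleDr// addeC leeD//; first by rewrite muleC.
  apply: le_trans (lee_wpmul2l _ (ln_plus_le_eseries _ b1)) _; first by rewrite lee_fin.
  rewrite muleCA; apply: lee_wpmul2l; first by rewrite lee_fin.
  rewrite -nneseriesZl; last by move=> i _; rewrite lee_fin.
  apply: lee_nneseries => [i _ _|i _]; first by rewrite -EFinM lee_fin mulr_ge0.
  rewrite -EFinM lee_fin /count_pow; case: ltP => [yi|_]; last first.
    by rewrite mulr0; exact: cutoff_ge0.
  by rewrite mulr1 cutoff_in// /E /=; move: yi; rewrite ltr_pdivlMr// mulrC.
have mc i : measurable_fun setT (cutoff h (E i)) by exact: measurable_cutoff.
have mS : measurable_fun setT (fun y => \sum_(i <oo) (cutoff h (E i) y)%:E).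
  apply: ge0_emeasurable_sum => i; first by move=> y _ _; rewrite lee_fin; exact: cutoff_ge0.
  by move=> _; exact/measurable_EFinP.
have S0 y : 0 <= \sum_(i <oo) (cutoff h (E i) y)%:E.
  by apply: nneseries_ge0 => i _ _; rewrite lee_fin; exact: cutoff_ge0.
rewrite ge0_integralD//; last 4 first.
- by move=> y _; rewrite -EFinM lee_fin mulr_ge0.
- by apply: emeasurable_funM => //; exact/measurable_EFinP.
- by move=> y _; rewrite mule_ge0.
- by apply: emeasurable_funM.
rewrite !ge0_integralZl//; last 2 first.
- exact/measurable_EFinP.
- by move=> y _; rewrite lee_fin.
rewrite lte_add_pinfty//; first by rewrite lte_mul_pinfty// integral_ge0// => y _; rewrite lee_fin.
rewrite lte_mul_pinfty//.
rewrite integral_nneseries//; last 2 first.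
- by move=> i; exact/measurable_EFinP.
- by move=> i y _; rewrite lee_fin; exact: cutoff_ge0.
by under eq_eseriesr do rewrite integral_cutoff setTI.
Qed.

Lemma balance E : measurable E ->
  \int[mu]_(x in E) (h x)%:E <= \int[mu]_(x in ~` E) (h x)%:E ->
  exists f : T -> R, [/\ mu.-integrable setT (EFin \o f),
    forall x, (`|f x| <= h x)%R, forall x, E x -> f x = h x & (\int[mu]_x f x = 0)%R].
Proof.
move=> mE; have mE' := measurableC mE.
have int_fin A : measurable A -> \int[mu]_(x in A) (h x)%:E \is a fin_num.
  move=> mA; rewrite ge0_fin_numE ?nonneg_integral_lty//.
  by apply: integral_ge0 => x _; rewrite lee_fin.
have i1 A : measurable A -> mu.-integrable setT (EFin \o cutoff h A).
  move=> mA; apply: (le_integrable measurableT _ _ hi).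
    by apply/measurable_EFinP; exact: measurable_cutoff.
  move=> x _; rewrite /= lee_fin normrM ler_piMr// indicE.
  by case: (_ \in _); rewrite ?normr1 ?normr0.
have := integral_ge0 mu (fun x (_ : E x) => h0 x : 0 <= (h x)%:E).
have := integral_ge0 mu (fun x (_ : (~` E) x) => h0 x : 0 <= (h x)%:E).
case Ea : (\int[mu]_(x in E) _) (int_fin _ mE) => [a| |]//.
case Eb : (\int[mu]_(x in ~` E) _) (int_fin _ mE') => [b| |]//.
rewrite !lee_fin => _ _ b0 a0 ab.
(* If [b = 0] then [a = 0] as well, and [s = 0] by the convention on the inverse of 0, so
   [s * b = a] in all cases. *)
pose s := (a / b)%R.
have s0 : (0 <= s)%R by rewrite divr_ge0.
have s1 : (s <= 1)%R.
  have [b_eq0|bn0] := eqVneq b 0%R; first by rewrite /s b_eq0 invr0 mulr0.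
  by rewrite ler_pdivrMr ?mul1r// lt_def bn0.
have sb : (s * b = a)%R.
  have [b_eq0|bn0] := eqVneq b 0%R; last by rewrite divfK.
  by rewrite b_eq0 mulr0; apply/eqP; rewrite eq_le a0 -b_eq0 ab.
exists (fun x => cutoff h E x - s * cutoff h (~` E) x)%R.
have i2 : mu.-integrable setT (EFin \o (fun x => s * cutoff h (~` E) x)%R).
  have := integrableZl measurableT s (i1 _ mE').
  by apply: eq_integrable => // x _ /=; rewrite EFinM.
split.
- have := integrableB measurableT (i1 _ mE) i2.
  by apply: eq_integrable => // x _ /=; rewrite EFinB.
- move=> x; have [Ex|Ex] := pselect (E x).
    by rewrite cutoff_in// cutoff_out ?mulr0 ?subr0 ?ger0_norm//; apply.
  rewrite cutoff_out// cutoff_in// sub0r normrN ger0_norm; last exact: mulr_ge0.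
  by rewrite ler_piMl.
- by move=> x Ex; rewrite cutoff_in// cutoff_out ?mulr0 ?subr0//; apply.
rewrite RintegralB//; last exact: i1.
rewrite RintegralZl//; last exact: i1.
by rewrite /Rintegral !integral_cutoff !setTI Ea Eb /= sb subrr.
Qed.

End integration_tools.

(** * Necessity of the condition at infinity *)

Section tail_lower_bound.
Context {R : realType} {n : nat}.
Local Notation V := ('rV[R]_n).
Local Notation mu := (lebesgue_rV R n).
Implicit Types (x y : V) (t : R).
Variables (phi : V -> R) (C0 L : R).
Hypotheses (phi_cont : continuous phi) (phi_supp : forall x, 1 < `|x| -> phi x = 0).
Hypotheses (C00 : 0 < C0) (phi_le : forall x, `|phi x| <= C0).
Hypotheses (L0 : 0 < L) (phi_lip : forall x y, `|phi x - phi y| <= L * `|x - y|).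
Variables (z0 : V) (rho eta : R).
Hypotheses (rho0 : 0 < rho) (rho_z0 : 4 * rho <= `|z0|) (z01 : `|z0| <= 1).
Hypotheses (eta0 : 0 < eta) (eta_le : forall z, `|z0 - z| < rho -> eta <= `|phi z|).
Variables (h f : V -> R) (J : R).
Hypotheses (h0 : forall y, 0 <= h y) (hL : L1 h) (fL : L1 f) (J0 : 0 < J).
Hypotheses (fh : forall y, `|f y| <= h y) (fh_far : forall y, J <= `|y| -> f y = h y).
Hypothesis f_int : \int[mu]_y f y = 0.

Let T_ i : R := J * 2 ^+ i.
Let T0 i : 0 < T_ i. Proof. by rewrite mulr_gt0// exprn_gt0. Qed.
Let B_ i : set V := ball (0 : V) (T_ i).
(** The image under dilation by [T_ i] of the cube around [z0] on which [|phi|] is at least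
    [eta]. *)
Let P_ i : set V := ball (T_ i *: z0) (T_ i * rho).
Let mB i : measurable (B_ i). Proof. exact: measurable_rV_ball. Qed.
Let mBC i : measurable (~` B_ i). Proof. exact: measurableC. Qed.
Let mP i : measurable (P_ i). Proof. exact: measurable_rV_ball. Qed.
Let mh := measurable_L1 hL.
Let mf := measurable_L1 fL.

Let BP i y : B_ i y <-> `|y| < T_ i.
Proof. by rewrite -[y in `|y|]opprK normrN -sub0r; exact: rV_ballP. Qed.

(** [Hr] is the main term, whose sum over [i] yields the logarithm at infinity. [Kr] bounds the
    error of treating the mass of [f] in [B_ i] as concentrated at 0 and dropping the rest. *)
Let Hr i : R := \int[mu]_y cutoff h (~` B_ i) y.
Let Kr i : R := \int[mu]_y (ramp (`|y| / J) i * h y).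

Let ramp4 (s : R) i : 0 <= s -> ramp s i <= 4.
Proof.
move=> s0; rewrite /ramp; case: ltP => // /ltW h4.
by rewrite ler_pdivrMr// exprn_gt0.
Qed.

Let measurable_ramp i : measurable_fun setT (fun y : V => ramp (`|y| / J) i).
Proof.
have m1 : measurable_fun setT (fun y : V => `|y| / J).
  by apply: measurable_funM => //; exact: measurable_norm_rV.
rewrite (_ : (fun y : V => _) = cutoff (fun y : V => `|y| / J / 2 ^+ i) (B_ i.+2)).
  by apply: measurable_cutoff => //; apply: measurable_funM.
apply/funext => y; rewrite /ramp.
have E : (`|y| / J < 4 * 2 ^+ i) = (`|y| < T_ i.+2).
  by rewrite ltr_pdivrMr// /T_ !exprS; congr (_ < _); ring.
rewrite E; case: ltP => yT; first by rewrite cutoff_in//; exact/BP.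
by rewrite cutoff_out// => /BP; rewrite ltNge yT.
Qed.

Let ramp_int i : mu.-integrable setT (EFin \o (fun y => ramp (`|y| / J) i * h y)).
Proof.
have := integrableZl measurableT 4 hL; apply: le_integrable => //.
  by apply/measurable_EFinP; apply: measurable_funM.
move=> y _; rewrite /= lee_fin !ger0_norm ?mulr_ge0//; last first.
  by rewrite ramp_ge0// divr_ge0// ltW.
by rewrite ler_wpM2r// ramp4// divr_ge0// ltW.
Qed.

Let cutoff_int (g : V -> R) A : measurable A -> L1 g -> L1 (cutoff g A).
Proof.
move=> mA gL; have mg := measurable_L1 gL.
apply: (le_integrable measurableT _ _ gL).
  by apply/measurable_EFinP; exact: measurable_cutoff.
move=> x _; rewrite /= lee_fin normrM ler_piMr// indicE.
by case: (_ \in _); rewrite ?normr1 ?normr0.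
Qed.

(** The total integral of [f] is 0, and [f] is [h] off [B_ i]. *)
Let int_far i : \int[mu]_y cutoff f (B_ i) y = - Hr i.
Proof.
apply/eqP; rewrite -subr_eq0 opprK; apply/eqP.
rewrite /Hr -f_int.
have -> : cutoff h (~` B_ i) = cutoff f (~` B_ i).
  apply/funext => y; have [By|By] := pselect ((~` B_ i) y); last by rewrite !cutoff_out.
  rewrite !cutoff_in// fh_far//; apply: le_trans (_ : T_ i <= _).
    by rewrite /T_ ler_peMr ?(ltW J0)// exprn_ege1// ler1n.
  by rewrite leNgt; apply/negP => h'; apply: By; apply/BP.
rewrite -RintegralD//; [|exact: cutoff_int|exact: cutoff_int].
apply: eq_Rintegral => y _.
have [By|By] := pselect (B_ i y).
  by rewrite cutoff_in// cutoff_out ?addr0//; apply.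
by rewrite cutoff_out// cutoff_in// add0r.
Qed.

(** The convolution is compared with [dilate phi (T_ i) x] times the integral of [f] over [B_ i],
    which is minus [Hr i]. The difference is estimated by the Lipschitz bound for [|y| < T_ i] and
    by the sup bound up to [4 * T_ i]; beyond, the kernel vanishes because [|x| < 2 * T_ i]. *)
Lemma tail_pointwise i x : P_ i x ->
  eta * T_ i ^- n * Hr i <=
  `|convolution (dilate phi (T_ i)) f x| + (L + C0) * T_ i ^- n * Kr i.
Proof.
move=> /rV_ballP Px; have t0 := T0 i.
have tn0 : 0 < T_ i ^- n by rewrite invr_gt0 exprn_gt0.
have xz : `|z0 - (T_ i)^-1 *: x| < rho.
  have -> : z0 - (T_ i)^-1 *: x = (T_ i)^-1 *: (T_ i *: z0 - x).
    by rewrite scalerBr scalerA mulVf ?scale1r// gt_eqF.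
  by rewrite normrZ gtr0_norm ?invr_gt0// mulrC ltr_pdivrMr// mulrC.
have rho4 : rho <= 1 / 4.
  by rewrite ler_pdivlMr// mulrC; exact: le_trans rho_z0 z01.
have x2 : `|x| < 2 * T_ i.
  have := ler_distD (T_ i *: z0) x 0; rewrite !subr0 normrZ gtr0_norm// distrC.
  have : T_ i * rho <= T_ i * (1 / 4) by rewrite ler_wpM2l ?(ltW t0).
  have : T_ i * `|z0| <= T_ i * 1 by rewrite ler_wpM2l ?(ltW t0).
  lra.
have Hr0 : 0 <= Hr i by apply: Rintegral_ge0 => y _; exact: cutoff_ge0.
have i1 := dilate_integrable phi_cont phi_le x t0 fL.
have i2 : mu.-integrable setT (EFin \o (fun y => dilate phi (T_ i) x * cutoff f (B_ i) y)).
  have := integrableZl measurableT (dilate phi (T_ i) x) (cutoff_int (mB i) fL).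
  by apply: eq_integrable => // y _ /=; rewrite EFinM.
have i3 : mu.-integrable setT (EFin \o (fun y => dilate phi (T_ i) x * cutoff f (B_ i) y
     - dilate phi (T_ i) (x - y) * f y)).
  have := integrableB measurableT i2 i1.
  by apply: eq_integrable => // y _ /=; rewrite EFinB.
have d_ge : eta * T_ i ^- n <= `|dilate phi (T_ i) x|.
  rewrite /dilate normrM (gtr0_norm tn0) mulrC ler_wpM2l ?(ltW tn0)//.
  exact: eta_le.
apply: (@le_trans _ _ (`|dilate phi (T_ i) x| * Hr i)); first by rewrite ler_wpM2r.
have -> : `|dilate phi (T_ i) x| * Hr i =
    `|\int[mu]_y (dilate phi (T_ i) x * cutoff f (B_ i) y)|.
  rewrite RintegralZl//; last exact: cutoff_int.
  by rewrite int_far mulrN normrN [in RHS]normrM (ger0_norm Hr0).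
have -> : \int[mu]_y (dilate phi (T_ i) x * cutoff f (B_ i) y) =
   convolution (dilate phi (T_ i)) f x + \int[mu]_y (dilate phi (T_ i) x * cutoff f (B_ i) y
     - dilate phi (T_ i) (x - y) * f y).
  by rewrite RintegralB// addrC subrK.
apply: le_trans (ler_normD _ _) _; rewrite lerD2l.
apply: le_trans (le_normr_Rintegral measurableT i3) _.
have LC : 0 <= L + C0 by rewrite addr_ge0// ltW.
rewrite /Kr -RintegralZl//.
apply: le_Rintegral => //.
- exact: integrable_norm.
- have := integrableZl measurableT ((L + C0) * T_ i ^- n) (ramp_int i).
  by apply: eq_integrable => // y _ /=; rewrite EFinM.
move=> y _.
have Jn : J != 0 by rewrite gt_eqF.
have yTi : `|y| / J / 2 ^+ i = `|y| / T_ i.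
  by rewrite /T_ invfM mulrA.
have [yT|Ty] := ltP `|y| (T_ i).
  rewrite cutoff_in; last exact/BP.
  rewrite -mulrBl normrM /dilate -mulrBr normrM (gtr0_norm tn0).
  rewrite /ramp ifT; last first.
    rewrite ltr_pdivrMr// (lt_le_trans yT)// /T_ mulrC ler_wpM2r ?(ltW J0)//.
    by rewrite ler_peMl ?exprn_ge0// ler1n.
  rewrite yTi mulrA; apply: ler_pM => //; first by rewrite mulr_ge0// ltW.
  rewrite [leRHS]mulrAC [leRHS]mulrC ler_wpM2l ?(ltW tn0)//.
  apply: le_trans (phi_lip _ _) _.
  rewrite -scalerBr opprB addrCA subrr addr0 normrZ gtr0_norm ?invr_gt0//.
  by rewrite [_^-1 * _]mulrC ler_wpM2r ?divr_ge0 ?(ltW t0)// lerDl ltW.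
rewrite cutoff_out; last by move=> /BP; rewrite ltNge Ty.
rewrite mulr0 sub0r normrN normrM.
have [y4|y4] := ltP (`|y| / J) (4 * 2 ^+ i).
  rewrite /ramp y4 yTi mulrA; apply: ler_pM => //.
  apply: le_trans (dilate_le phi_le _ t0) _.
  have : 1 <= `|y| / T_ i by rewrite ler_pdivlMr// mul1r.
  move=> y1; rewrite mulrAC ler_wpM2r ?(ltW tn0)//.
  apply: (@le_trans _ _ ((L + C0) * 1)); first by rewrite mulr1 lerDr ltW.
  by rewrite ler_wpM2l.
rewrite /ramp ltNge y4 /= mul0r mulr0.
rewrite dilate_supp// ?normr0 ?mul0r//.
have : 4 * T_ i <= `|y|.
  by move: y4; rewrite ler_pdivlMr// /T_; lra.
by have := ler_distD x y 0; rewrite !subr0 distrC; lra.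
Qed.

Local Open Scope ereal_scope.

Let Hr_ge0 i : (0 <= Hr i)%R.
Proof. by apply: Rintegral_ge0 => y _; exact: cutoff_ge0. Qed.

Let ramp_h_ge0 i y : (0 <= ramp (`|y| / J) i * h y)%R.
Proof. by rewrite mulr_ge0// ramp_ge0// divr_ge0// ltW. Qed.

Let Kr_ge0 i : (0 <= Kr i)%R.
Proof. exact: Rintegral_ge0. Qed.

Let HrE i : (Hr i)%:E = \int[mu]_y (cutoff h (~` B_ i) y)%:E.
Proof. by rewrite fineK//; apply: integrable_fin_num => //; exact: cutoff_int. Qed.

Let KrE i : (Kr i)%:E = \int[mu]_y (ramp (`|y| / J) i * h y)%:E.
Proof. by rewrite fineK//; apply: integrable_fin_num => //; exact: ramp_int. Qed.

Let eseries_Kr_lty : \sum_(i <oo) (Kr i)%:E < +oo.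
Proof.
under eq_eseriesr do rewrite KrE.
rewrite -integral_nneseries//; last 2 first.
- by move=> i; apply/measurable_EFinP; apply: measurable_funM.
- by move=> i y _; rewrite lee_fin.
have Hh : \int[mu]_y (h y)%:E < +oo.
  exact: (nonneg_integral_lty h0 hL measurableT).
apply: (@le_lt_trans _ _ (8%:E * \int[mu]_y (h y)%:E)); last by rewrite lte_mul_pinfty.
rewrite -ge0_integralZl//; last 2 first.
- exact/measurable_EFinP.
- by move=> y _; rewrite lee_fin.
apply: ge0_le_integral => //.
- by move=> y _; apply: nneseries_ge0 => i _ _; rewrite lee_fin.
- apply: ge0_emeasurable_sum => i; first by move=> y _ _; rewrite lee_fin.
  by move=> _; apply/measurable_EFinP; apply: measurable_funM.
- by apply/measurable_EFinP; apply: measurable_funM.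
move=> y _; under eq_eseriesr do rewrite mulrC EFinM.
have yJ : (0 <= `|y| / J)%R by rewrite divr_ge0// ltW.
rewrite nneseriesZl; last by move=> i _; rewrite lee_fin ramp_ge0.
rewrite muleC; apply: lee_wpmul2r; first by rewrite lee_fin.
apply: lime_le.
  by apply: is_cvg_ereal_nneg_natsum => k _; rewrite lee_fin ramp_ge0.
by apply: nearW => m; rewrite sumEFin lee_fin sum_ramp_le.
Qed.

(** As [4 * rho <= |z0|], points of [P_ i] have norm between 3/4 and 5/4 of [T_ i * |z0|], and
    [T_ i] at least doubles from one index to a later one. *)
Let trivP : trivIset setT P_.
Proof.
have z_gt0 : (0 < `|z0|)%R by apply: lt_le_trans rho_z0; rewrite mulr_gt0.
have H i k x : (i < k)%N -> P_ i x -> P_ k x -> False.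
  move=> ik /rV_ballP h1 /rV_ballP h2.
  have n1 : (`|T_ i *: z0| = T_ i * `|z0|)%R by rewrite normrZ gtr0_norm.
  have n2 : (`|T_ k *: z0| = T_ k * `|z0|)%R by rewrite normrZ gtr0_norm.
  have T2 : (2 * T_ i <= T_ k)%R.
    rewrite /T_ mulrCA ler_wpM2l ?(ltW J0)// -exprS.
    by apply: ler_weXn2l; rewrite ?ler1n.
  have d1 := ler_distD (T_ i *: z0)%R x 0%R; rewrite !subr0 distrC n1 in d1.
  have d2 := ler_distD x (T_ k *: z0)%R 0%R; rewrite !subr0 n2 in d2.
  have r1 : (T_ i * (4 * rho) <= T_ i * `|z0|)%R by rewrite ler_wpM2l ?(ltW (T0 i)).
  have r2 : (T_ k * (4 * rho) <= T_ k * `|z0|)%R by rewrite ler_wpM2l ?(ltW (T0 k)).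
  have r3 : (2 * T_ i * `|z0| <= T_ k * `|z0|)%R by rewrite ler_wpM2r.
  have r4 : (0 < T_ i * `|z0|)%R by rewrite mulr_gt0.
  lra.
apply/trivIsetP => i j _ _ ij; rewrite -subset0 => x [xi xj].
by move: ij; rewrite neq_ltn => /orP[] l; [exact: (H _ _ _ l xi xj)|exact: (H _ _ _ l xj xi)].
Qed.

Hypothesis Mfin : \int[mu]_x hardy_maximal phi f x < +oo.

(** A positive part, since the error may exceed the main term at some scales. *)
Let excess i : R := (Num.max 0 (eta * Hr i - (L + C0) * Kr i))%R.

Let eseries_excess_lty : \sum_(i <oo) (excess i)%:E < +oo.
Proof.
have rn0 : (0 < (2 * rho) ^+ n)%R by rewrite exprn_gt0// mulr_gt0.
have E0 i : (0 <= excess i)%R by rewrite le_max lexx.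
suff : ((2 * rho) ^+ n)%:E * \sum_(i <oo) (excess i)%:E < +oo.
  exact: lty_of_mull.
apply: le_lt_trans Mfin.
rewrite -nneseriesZl; last by move=> i _; rewrite lee_fin.
have -> : \sum_(i <oo) ((2 * rho) ^+ n)%:E * (excess i)%:E =
    \sum_(i <oo) \int[mu]_(x in P_ i) cst (T_ i ^- n * excess i)%:E x.
  apply: eq_eseriesr => i _; rewrite integral_cst// lebesgue_rV_ballM ?mulr_gt0//.
  rewrite -!EFinM; congr EFin; rewrite [(2 * (_ * _))%R]mulrCA [((T_ i * _) ^+ n)%R]exprMn.
  by field; rewrite expf_neq0// gt_eqF.
apply: disjoint_sum_integral_le => //.
- by move=> i x; rewrite lee_fin mulr_ge0// invr_ge0 exprn_ge0// ltW.
- exact: hardy_maximal_ge0.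
move=> i x Px; apply: (@le_trans _ _ `|convolution (dilate phi (T_ i)) f x|%:E); last first.
  by apply: ereal_sup_ubound; exists (T_ i) => //=; exact: T0.
rewrite lee_fin /excess maxr_pMr; last by rewrite invr_ge0 exprn_ge0// ltW.
rewrite mulr0 ge_max normr_ge0/=.
by have := tail_pointwise Px; rewrite mulrBr; lra.
Qed.

Lemma tail_integral_lty : \int[mu]_y (h y * ln_plus `|y|)%:E < +oo.
Proof.
have sHr : \sum_(i <oo) (Hr i)%:E < +oo.
  suff : eta%:E * \sum_(i <oo) (Hr i)%:E < +oo.
    exact: lty_of_mull.
  rewrite -nneseriesZl; last by move=> i _; rewrite lee_fin.
  have E0 i : (0 <= excess i)%R by rewrite le_max lexx.
  have LC : (0 <= L + C0)%R by rewrite addr_ge0// ltW.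
  apply: (@le_lt_trans _ _ (\sum_(i <oo) ((excess i)%:E + (L + C0)%:E * (Kr i)%:E))).
    apply: lee_nneseries => [i _ _|i _]; first by rewrite -EFinM lee_fin mulr_ge0// ltW.
    rewrite -!EFinM -EFinD lee_fin -lerBlDr.
    by rewrite /excess le_max lexx orbT.
  rewrite nneseriesD; last 2 first.
  - by move=> i _ _; rewrite lee_fin.
  - by move=> i _ _; rewrite -EFinM lee_fin mulr_ge0.
  rewrite lte_add_pinfty// nneseriesZl; last by move=> i _; rewrite lee_fin.
  by rewrite lte_mul_pinfty.
apply: (integral_ln_plus_lty h0 hL measurable_norm_rV _ J0 (_ : 1 < 2)%R) => //.
  by rewrite ltr1n.
apply: le_lt_trans sHr; apply: lee_nneseries => [i _ _|i _].
  by apply: integral_ge0 => y _; rewrite lee_fin.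
rewrite HrE integral_cutoff setTI; apply: integral_ge0_subset => //.
  exact: measurable_gt_level measurable_norm_rV.
by move=> y /= yi /BP; rewrite ltNge (ltW yi).
Qed.

End tail_lower_bound.

(** * Necessity of the local condition *)

Section gap.
Context {R : realType} {n : nat}.
Local Notation V := ('rV[R]_n).
Variables (U : set V) (z1 : V).
Hypotheses (oU : open U) (Uz1 : ~ U z1).
Implicit Types (x y z : V).

(** The distance to the complement of [U]; the point [z1] makes the set nonempty, without which
    [inf] would be a default value. *)
Definition gap x : R := inf [set `|x - z| | z in ~` U].

Let lb x : has_lbound [set `|x - z| | z in ~` U].
Proof. by exists 0 => _ [z _ <-]. Qed.

Let ne x : [set `|x - z| | z in ~` U] !=set0.
Proof. by exists `|x - z1|; exists z1. Qed.

Lemma gap_le x z : ~ U z -> gap x <= `|x - z|.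
Proof. by move=> Uz; apply: ge_inf => //; exists z. Qed.

Lemma gap_lip x y : gap x <= gap y + `|x - y|.
Proof.
rewrite -lerBlDr; apply: lb_le_inf => // _ [z Uz <-].
rewrite lerBlDr addrC; apply: le_trans (gap_le x Uz) _.
exact: ler_distD.
Qed.

Lemma gap_dist x y : `|gap x - gap y| <= `|x - y|.
Proof.
have := gap_lip x y; have := gap_lip y x; rewrite (distrC y x) => h1 h2.
by rewrite ler_norml; apply/andP; split; lra.
Qed.

Lemma gap_gt0 x : U x -> 0 < gap x.
Proof.
move=> Ux; have /nbhs_ballP[e /= e0 eU] : nbhs x U by exact: open_nbhs_nbhs.
apply: (lt_le_trans e0); apply: lb_le_inf => // _ [z Uz <-].
by rewrite leNgt; apply/negP => xz; apply/Uz/eU/rV_ballP.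
Qed.

Lemma gap_in x y : `|x - y| < gap x -> U y.
Proof. by move=> xy; apply: contrapT => /(gap_le x); rewrite leNgt xy. Qed.

(** A nearest point up to a factor 2, which is the tolerance of [heavy_set_local]. *)
Lemma gap_near x : 0 < gap x -> exists2 z, ~ U z & `|z - x| <= 2 * gap x.
Proof.
move=> g0; have [|_ [z Uz <-] h] := @inf_adherent R [set `|x - z| | z in ~` U] _ g0.
  by split.
by exists z => //; rewrite distrC ltW// mulr_natl mulr2n.
Qed.

Lemma measurable_gap : measurable_fun setT gap.
Proof.
apply: continuous_measurable_rV => x.
apply/(@cvgrPdist_lt R R V _ (nbhs_filter (x : V))) => e e0; apply/nbhs_ballP.
exists e => //= y /rV_ballP xy; exact: le_lt_trans (gap_dist _ _) xy.
Qed.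

End gap.

(** * Dependence of a dilation on its scale *)

Section dilate_perturbation.
Context {R : realType} {n : nat}.
Local Notation V := ('rV[R]_n).
Variables (phi : V -> R) (C0 L : R).
Hypotheses (C00 : 0 < C0) (phi_le : forall x, `|phi x| <= C0).
Hypotheses (L0 : 0 < L) (phi_lip : forall x y, `|phi x - phi y| <= L * `|x - y|).

(** The summand with [L] comes from the change of the argument of [phi], the one with [C0] from the
    change of the normalising power. *)
Definition perturb_const : R := 8 * L + 4 * (n%:R * 2 ^+ n) * C0.

Lemma expr_sub1_le (u : R) k : 0 <= u <= 2 -> `|u ^+ k - 1| <= k%:R * 2 ^+ k * `|u - 1|.
Proof.
move=> /andP[u0 u2]; rewrite subrX1 normrM mulrC ler_wpM2r//.
apply: le_trans (ler_norm_sum _ _ _) _.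
rewrite mulr_natl -[k in leRHS]card_ord -sumr_const; apply: ler_sum => i _.
rewrite ger0_norm ?exprn_ge0//; apply: (@le_trans _ _ (2 ^+ i)).
  by rewrite lerXn2r ?nnegrE.
by rewrite card_ord ler_weXn2l ?ler1n// ltnW.
Qed.

(** The bound on [del] gives [t >= tau / 2], so [tau / t] stays at most 2 and its powers are
    Lipschitz there. *)
Lemma dilate_perturb (t tau del : R) (z : V) : 0 < tau -> 0 < del -> del <= 1 / 4 ->
  `|t - tau| <= 2 * del * tau -> `|z| <= 2 * tau ->
  `|dilate phi t z - dilate phi tau z| <= perturb_const * del * tau ^- n.
Proof.
move=> tau0 del0 del4 ttau z2.
have dt : del * tau <= 1 / 4 * tau by rewrite ler_wpM2r// ltW.
have t2 : tau / 2 <= t by move: ttau; rewrite ler_norml -mulrA => /andP[]; lra.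
have t0 : 0 < t by lra.
have taun0 : 0 < tau ^- n by rewrite invr_gt0 exprn_gt0.
have tn : t ^- n = tau ^- n * (tau / t) ^+ n.
  by rewrite expr_div_n; field; rewrite !expf_neq0// gt_eqF.
have -> : dilate phi t z - dilate phi tau z =
   tau ^- n * (((tau / t) ^+ n - 1) * phi (t^-1 *: z) + (phi (t^-1 *: z) - phi (tau^-1 *: z))).
  by rewrite /dilate tn; ring.
rewrite normrM (gtr0_norm taun0) mulrC ler_wpM2r ?(ltW taun0)//.
apply: le_trans (ler_normD _ _) _.
have ut : `|tau / t - 1| <= 4 * del.
  have -> : tau / t - 1 = (tau - t) / t by rewrite mulrBl divff// gt_eqF.
  rewrite normrM normfV (gtr0_norm t0) ler_pdivrMr// distrC.
  apply: (le_trans ttau); have : del * (tau / 2) <= del * t by rewrite ler_wpM2l// ltW.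
  lra.
have h1 : `|((tau / t) ^+ n - 1) * phi (t^-1 *: z)| <= 4 * (n%:R * 2 ^+ n) * C0 * del.
  rewrite normrM.
  have u02 : 0 <= tau / t <= 2.
    by rewrite divr_ge0 ?(ltW tau0) ?(ltW t0)//= ler_pdivrMr//; lra.
  have := expr_sub1_le n u02; have k0 : 0 <= n%:R * 2 ^+ n :> R by [].
  move=> /le_trans /(_ (ler_wpM2l k0 ut)) h.
  rewrite (_ : 4 * _ * _ * del = n%:R * 2 ^+ n * (4 * del) * C0); last by ring.
  by apply: ler_pM.
have h2 : `|phi (t^-1 *: z) - phi (tau^-1 *: z)| <= 8 * L * del.
  apply: le_trans (phi_lip _ _) _.
  rewrite -scalerBl normrZ.
  have -> : t^-1 - tau^-1 = (tau - t) / (t * tau).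
    by field; rewrite !gt_eqF.
  rewrite normrM normfV (gtr0_norm (mulr_gt0 t0 tau0)) distrC.
  rewrite (_ : 8 * L * del = L * (8 * del)); last by ring.
  rewrite ler_wpM2l ?(ltW L0)// mulrAC ler_pdivrMr ?mulr_gt0//.
  apply: le_trans (ler_pM _ _ ttau z2) _ => //.
  have : del * tau * (tau / 2) <= del * tau * t by rewrite ler_wpM2l// mulr_ge0// ltW.
  by rewrite (_ : 8 * del * (t * tau) = 8 * (del * tau * t)); [lra|ring].
by rewrite /perturb_const [leRHS]mulrDl [leRHS]addrC lerD.
Qed.

End dilate_perturbation.

Lemma measurable_inv {R : realType} : measurable_fun setT (GRing.inv : R -> R).
Proof.
have m0 : measurable [set (0 : R)] by exact: measurable_set1.
rewrite -(setUv [set (0 : R)]); apply/measurable_funU => //; first exact: measurableC.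
split; first exact: measurable_fun_set1.
rewrite (_ : ~` _ = [set x : R | x != 0]); last first.
  by apply/seteqP; split => x /eqP.
apply: open_continuous_measurable_fun; first exact: open_neq.
by move=> x; rewrite inE => x0; exact: inv_continuous.
Qed.

(** * Testing the maximal function between two levels *)

Section level_lower_bound.
Context {R : realType} {n : nat}.
Local Notation V := ('rV[R]_n).
Local Notation mu := (lebesgue_rV R n).
Implicit Types (x y z : V).
Variables (phi : V -> R) (C0 L : R).
Hypotheses (phi_cont : continuous phi) (phi_supp : forall x, 1 < `|x| -> phi x = 0).
Hypotheses (C00 : 0 < C0) (phi_le : forall x, `|phi x| <= C0).
Hypotheses (L0 : 0 < L) (phi_lip : forall x y, `|phi x - phi y| <= L * `|x - y|).
Let sigma : R := \int[mu]_x phi x.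
Variables (h f : V -> R) (l A del : R) (z1 : V).
Hypotheses (h0 : forall x, 0 <= h x) (hL : L1 h) (fL : L1 f).
Hypotheses (l0 : 0 < l) (A5 : 5 ^+ n <= A) (del0 : 0 < del) (del4 : del <= 1 / 4).
(** The two summands are the integrals of the two errors in [kernel_near]: [6 ^+ n] comes from the
    volume of [ball y (3 * r y)], and [30 ^+ n / A] from the density of [U'] given by
    [heavy_set_local]. *)
Hypothesis small : perturb_const (n := n) C0 L * del * 6 ^+ n + C0 * del ^- n * (30 ^+ n / A) <= `|sigma| / 2.
Let U := heavy_set h l.
Let U' := heavy_set h (A * l).
Hypotheses (Uz1 : ~ U z1) (fhU : forall y, U y -> f y = h y).

Let G := U `\` U'.
Let r x : R := del * gap U x.
Let K := perturb_const (n := n) C0 L.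
(* Integrating [kernel y x * f y] in [y] gives the convolution with the dilation by [r x]. *)
Let kernel y x : R := \1_G x * dilate phi (r x) (x - y).
Let mh := measurable_L1 hL.
Let oU : open U. Proof. exact: open_heavy_set. Qed.
Let mU : measurable U. Proof. exact: measurable_heavy_set. Qed.
Let mU' : measurable U'. Proof. exact: measurable_heavy_set. Qed.
Let mG : measurable G. Proof. exact: measurableD. Qed.

Let r0 x : U x -> 0 < r x.
Proof. by move=> Ux; rewrite mulr_gt0// (gap_gt0 oU Uz1). Qed.

Let r_lt x : U x -> r x < gap U x.
Proof.
move=> Ux; rewrite -[ltRHS]mul1r /r ltr_pM2r ?(gap_gt0 oU Uz1)//.
by apply: (le_lt_trans del4); rewrite ltr_pdivrMr// mul1r ltr1n.
Qed.

(** The scale [r x] is smaller than the distance from [x] to the complement of [U], so only values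
    of [f] in [U], where it is [h], are seen. *)
Let kernel_off y x : ~ U y -> kernel y x = 0.
Proof.
move=> Uy; rewrite /kernel; have [[Ux _]|Gx] := pselect (G x); last first.
  by rewrite indicE memNset// mul0r.
rewrite (dilate_supp phi_supp (r0 Ux)) ?mulr0//.
rewrite ltNge; apply/negP => xy; apply: Uy; apply: (gap_in (x := x)).
exact: le_lt_trans xy (r_lt Ux).
Qed.

(** The first error is due to the variation of the scale between [x] and [y], the second to the
    points of [U'] that the indicator removes. *)
Let kernel_near y x : U y ->
  `|kernel y x - dilate phi (r y) (x - y)| <=
  K * del * r y ^- n * \1_(ball y (3 * r y)) x +
  C0 * r y ^- n * \1_(U' `&` ball y (gap U y)) x.
Proof.
move=> Uy; have ry0 := r0 Uy; have gy0 := gap_gt0 oU Uz1 Uy.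
have K0 : 0 <= K by rewrite addr_ge0// !mulr_ge0// ltW.
have rn0 : 0 <= r y ^- n by rewrite invr_ge0 exprn_ge0// ltW.
have t1 : 0 <= K * del * r y ^- n * \1_(ball y (3 * r y)) x.
  by rewrite !mulr_ge0// ltW.
have t2 : 0 <= C0 * r y ^- n * \1_(U' `&` ball y (gap U y)) x.
  by rewrite !mulr_ge0// ltW.
(* Farther than [2 * r y] both terms vanish: the scale at [x] is at most [r y + |x - y| / 4], hence
   below [|x - y|]. *)
have [xy|yx] := leP `|x - y| (2 * r y); last first.
  rewrite (dilate_supp phi_supp ry0); last by lra.
  rewrite subr0 (_ : kernel y x = 0) ?normr0 ?addr_ge0//.
  rewrite /kernel; have [[Ux _]|Gx] := pselect (G x); last first.
    by rewrite indicE memNset// mul0r.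
  rewrite (dilate_supp phi_supp (r0 Ux)) ?mulr0//.
  have := gap_lip Uz1 x y => gl.
  have : r x <= r y + del * `|x - y| by rewrite -mulrDr ler_wpM2l// ltW.
  have : del * `|x - y| <= 1 / 4 * `|x - y| by rewrite ler_wpM2r.
  lra.
have [Gx|Gx] := pselect (G x).
  rewrite /kernel indicE mem_set// mul1r -[leLHS]addr0 lerD//.
  rewrite indicE mem_set ?mulr1; last by apply/rV_ballP; rewrite distrC; lra.
  apply: dilate_perturb => //.
  rewrite -mulrBr normrM gtr0_norm// -mulrA [leRHS]mulrCA ler_wpM2l ?(ltW del0)//.
  by apply: le_trans (gap_dist Uz1 _ _) xy.
rewrite /kernel [\1_G x]indicE (memNset Gx) mul0r sub0r normrN -[leLHS]add0r lerD//.
have [xy1|yx1] := leP `|x - y| (r y); last first.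
  by rewrite (dilate_supp phi_supp ry0)// normr0.
have xg : `|y - x| < gap U y.
  by rewrite distrC; exact: le_lt_trans xy1 (r_lt Uy).
have Ux : U x by exact: gap_in xg.
rewrite indicE mem_set ?mulr1; first exact: dilate_le.
split; last exact/rV_ballP.
by apply: contrapT => U'x; apply: Gx.
Qed.

Let kernel_dist y : U y ->
  (\int[mu]_x `|kernel y x - dilate phi (r y) (x - y)|%:E <= (`|sigma| / 2)%:E)%E.
Proof.
move=> Uy; have ry0 := r0 Uy; have gy0 := gap_gt0 oU Uz1 Uy.
have K0 : 0 <= K by rewrite addr_ge0// !mulr_ge0// ltW.
have rn0 : 0 <= r y ^- n by rewrite invr_ge0 exprn_ge0// ltW.
have mB d : measurable (ball y d) by exact: measurable_rV_ball.
have c1 : 0 <= K * del * r y ^- n by rewrite !mulr_ge0// ltW.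
have c2 : 0 <= C0 * r y ^- n by rewrite !mulr_ge0// ltW.
apply: (@le_trans _ _ (\int[mu]_x
   ((K * del * r y ^- n)%:E * (\1_(ball y (3 * r y)) x)%:E +
    (C0 * r y ^- n)%:E * (\1_(U' `&` ball y (gap U y)) x)%:E))%E).
  apply: ge0_le_integral_nonmeasurable => x; first by rewrite lee_fin.
  by rewrite -!EFinM -EFinD lee_fin; exact: kernel_near.
rewrite ge0_integralD//; last 4 first.
- by move=> x _; rewrite -EFinM lee_fin mulr_ge0.
- by apply: measurable_funeM; apply/measurable_EFinP; exact: measurable_indic.
- by move=> x _; rewrite -EFinM lee_fin mulr_ge0.
- by apply: measurable_funeM; apply/measurable_EFinP; apply: measurable_indic; exact: measurableI.
rewrite !ge0_integralZl//; last 2 first.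
- by apply/measurable_EFinP; apply: measurable_indic; exact: measurableI.
- by apply/measurable_EFinP; exact: measurable_indic.
rewrite !integral_indic ?setIT//; last exact: measurableI.
rewrite lebesgue_rV_ballM ?mulr_gt0//.
have [z Uz zy] := gap_near Uz1 gy0.
have := heavy_set_local h0 mh l0 gy0 A5 Uz zy => HL.
apply: (@le_trans _ _ ((K * del * r y ^- n)%:E * ((2 * (3 * r y)) ^+ n)%:E +
   (C0 * r y ^- n)%:E * (30 ^+ n / A * gap U y ^+ n)%:E)%E).
  by apply: leeD2l; apply: lee_wpmul2l HL; rewrite lee_fin.
rewrite -!EFinM -EFinD lee_fin; apply: le_trans small.
have A0 : 0 < A by apply: lt_le_trans A5; rewrite exprn_gt0.
rewrite le_eqVlt; apply/orP; left; apply/eqP; rewrite /r (_ : 2 * (3 * _) = 6 * (del * gap U y)); last by ring.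
rewrite !exprMn -/K; field.
by rewrite !expf_neq0 ?gt_eqF.
Qed.

Let phi_L1 : L1 phi.
Proof.
have iB : mu.-integrable setT (fun x => (C0 * \1_(ball (0 : V) 2) x)%:E).
  have mB : measurable (ball (0 : V) 2) by exact: measurable_rV_ball.
  apply/integrableP; split.
    apply/measurable_EFinP; apply: measurable_funM => //; exact: measurable_indic.
  under eq_integral => x _ do rewrite /= ger0_norm ?mulr_ge0 ?(ltW C00)// EFinM.
  rewrite ge0_integralZl//; last 2 first.
  - by apply/measurable_EFinP; exact: measurable_indic.
  - by rewrite lee_fin ltW.
  by rewrite integral_indic// setIT lebesgue_rV_ballM// ltry.
apply: le_integrable iB => //.
  by apply/measurable_EFinP; exact: measurable_phi.
move=> x _; rewrite /= lee_fin [leRHS]ger0_norm ?mulr_ge0 ?(ltW C00)//.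
have [x1|x1] := leP `|x| 1; last by rewrite phi_supp// normr0 mulr_ge0// ltW.
rewrite indicE mem_set ?mulr1//; apply/rV_ballP; rewrite sub0r normrN.
by apply: le_lt_trans x1 _; rewrite ltr1n.
Qed.

Let dilateE y t x : dilate phi t (x - y) = t ^- n * phi (affine y t x).
Proof. by []. Qed.

Let integrable_dilate y t : 0 < t -> mu.-integrable setT (fun x => (dilate phi t (x - y))%:E).
Proof.
move=> t0; under eq_fun do rewrite dilateE EFinM.
apply: integrableZl => //; apply/integrableP; split.
  apply/measurable_EFinP; apply: (measurableT_comp (measurable_phi phi_cont)).
  exact: measurable_affine.
have := @ge0_integral_affine R n y t t0 (fun x => `|phi x|%:E).
move=> ->//; last first.
  by apply/measurable_EFinP; apply: measurableT_comp => //; exact: measurable_phi.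
by rewrite lte_mul_pinfty// ?lee_fin ?exprn_ge0 ?(ltW t0)//; exact: integral_norm_lty.
Qed.

Let integral_dilate y t : 0 < t -> (\int[mu]_x (dilate phi t (x - y))%:E = sigma%:E)%E.
Proof.
move=> t0; under eq_integral do rewrite dilateE EFinM.
have tn0 : t ^+ n != 0 by rewrite expf_neq0// gt_eqF.
have sE : (sigma%:E = \int[mu]_x (phi x)%:E)%E.
  by rewrite /sigma /Rintegral fineK//; exact: integrable_fin_num.
have ia : mu.-integrable setT (fun x => (phi (affine y t x))%:E).
  have := integrableZl measurableT (t ^+ n) (integrable_dilate y t0).
  apply: eq_integrable => // x _ /=.
  by rewrite dilateE -EFinM mulrA mulfV ?mul1r.
rewrite integralZl// (integral_affine y t0 phi_L1) muleA -EFinM.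
by rewrite mulVf// mul1e sE.
Qed.

Let measurable_kernel : measurable_fun setT (fun p : V * V => kernel p.2 p.1).
Proof.
have m1 : measurable_fun setT (fun p : V * V => r p.1).
  apply: measurable_funM => //.
  exact: (measurableT_comp (measurable_gap Uz1) (@measurable_fst _ _ V V)).
apply: measurable_funM.
  exact: (measurableT_comp (measurable_indic mG) (@measurable_fst _ _ V V)).
apply: measurable_funM.
  apply: (measurableT_comp (@measurable_inv R)).
  exact: measurable_funX.
apply: (measurableT_comp (measurable_phi phi_cont)).
apply: measurable_fun_rVP => i.
rewrite (_ : _ \o _ = fun p : V * V => (r p.1)^-1 * (rV_coord i p.1 - rV_coord i p.2)); last first.
  by apply/funext => p; rewrite /rV_coord /= !mxE.
apply: measurable_funM; first exact: (measurableT_comp (@measurable_inv R)).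
apply: measurable_funB.
  exact: (measurableT_comp (measurable_rV_coord i) (@measurable_fst _ _ V V)).
exact: (measurableT_comp (measurable_rV_coord i) (@measurable_snd _ _ V V)).
Qed.

Let measurable_kernel1 y : measurable_fun setT (kernel y).
Proof.
rewrite (_ : kernel y = (fun p : V * V => kernel p.2 p.1) \o (fun x => (x, y)))//.
apply: (measurableT_comp measurable_kernel).
exact: measurable_pair2.
Qed.

Let kernel_norm y : U y ->
  (\int[mu]_x `|kernel y x|%:E <= (`|sigma| / 2)%:E + \int[mu]_x `|phi x|%:E)%E.
Proof.
move=> Uy; have ry0 := r0 Uy.
have md : measurable_fun setT (fun x => dilate phi (r y) (x - y)).
  by apply/measurable_EFinP; exact: measurable_int (integrable_dilate y ry0).
apply: (@le_trans _ _ (\int[mu]_x (`|kernel y x - dilate phi (r y) (x - y)|%:E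
   + `|dilate phi (r y) (x - y)|%:E))%E).
  apply: ge0_le_integral_nonmeasurable => x; first by rewrite lee_fin.
  rewrite -EFinD lee_fin -{1}(subrK (dilate phi (r y) (x - y)) (kernel y x)).
  exact: ler_normD.
rewrite ge0_integralD//; last 2 first.
- by apply/measurable_EFinP; apply: measurableT_comp => //; exact: measurable_funB.
- by apply/measurable_EFinP; exact: measurableT_comp.
apply: leeD; first exact: kernel_dist.
under eq_integral do rewrite dilateE normrM EFinM.
have tn0 : 0 <= r y ^- n by rewrite invr_ge0 exprn_ge0// ltW.
rewrite ge0_integralZl//; last first.
  apply/measurable_EFinP; apply: measurableT_comp => //.
  apply: (measurableT_comp (measurable_phi phi_cont)); exact: measurable_affine.
rewrite (@ge0_integral_affine R n y (r y) ry0 (fun x => `|phi x|%:E))//; last first.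
  by apply/measurable_EFinP; apply: measurableT_comp => //; exact: measurable_phi.
rewrite muleA -EFinM ger0_norm// mulVf ?mul1e//.
by rewrite expf_neq0// gt_eqF.
Qed.

Let phi_norm_lty : (\int[mu]_x `|phi x|%:E < +oo)%E.
Proof. exact: integral_norm_lty. Qed.

Let integrable_kernel y : mu.-integrable setT (EFin \o kernel y).
Proof.
apply/integrableP; split; first exact/measurable_EFinP.
have [Uy|Uy] := pselect (U y).
  by apply: le_lt_trans (kernel_norm Uy) _; rewrite lte_add_pinfty// ltry.
under eq_integral do rewrite /= kernel_off// normr0.
by rewrite integral0.
Qed.

Let integral_kernel y : U y ->
  `| \int[mu]_x kernel y x - sigma | <= `|sigma| / 2.
Proof.
move=> Uy; have ry0 := r0 Uy; have id := integrable_dilate y ry0.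
have {1}-> : sigma = \int[mu]_x dilate phi (r y) (x - y).
  by rewrite /Rintegral integral_dilate.
rewrite -RintegralB//.
apply: le_trans (le_normr_Rintegral _ _) _ => //.
  have := integrableB measurableT (integrable_kernel y) id.
  by apply: eq_integrable => // x _; rewrite /= EFinB.
have := kernel_dist Uy; rewrite /Rintegral.
have := integral_ge0 mu (fun x (_ : setT x) =>
  (normr_ge0 (kernel y x - dilate phi (r y) (x - y)) :
    (0 <= `|kernel y x - dilate phi (r y) (x - y)|%:E)%E)).
by case: (integral _ _ _) => [a| |]//= _; rewrite lee_fin.
Qed.

Let F (p : V * V) : \bar R := (kernel p.2 p.1 * f p.2)%:E.

Let measurable_F : measurable_fun setT F.
Proof.
apply/measurable_EFinP; apply: measurable_funM => //.
exact: (measurableT_comp (measurable_L1 fL) (@measurable_snd _ _ V V)).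
Qed.

(** The L1 norm of [kernel y] is bounded uniformly in [y], so integrating first in [x] leaves a
    multiple of [|f y|]. *)
Let integrable_F : ((mu : {sigma_finite_measure set V -> \bar R}) \x mu)%E.-integrable setT F.
Proof.
apply: (proj2 (@integrable21ltyP _ _ _ _ _ mu mu F measurable_F)).
pose c := (`|sigma| / 2 + fine (\int[mu]_x `|phi x|%:E)%E).
have cE : ((`|sigma| / 2)%:E + \int[mu]_x `|phi x|%:E = c%:E)%E.
  rewrite /c EFinD fineK// ge0_fin_numE//.
  by apply: integral_ge0 => x _; rewrite lee_fin.
have c0 : 0 <= c.
  by rewrite addr_ge0// fine_ge0//; apply: integral_ge0 => x _; rewrite lee_fin.
apply: (@le_lt_trans _ _ (\int[mu]_y (c%:E * `|f y|%:E))%E).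
  apply: ge0_le_integral_nonmeasurable => y.
    by apply: integral_ge0.
  rewrite /F /=.
  under eq_integral do rewrite normrM EFinM muleC.
  rewrite ge0_integralZl//; last first.
    by apply/measurable_EFinP; apply: measurableT_comp => //; exact: measurable_kernel1.
  rewrite muleC; have [Uy|Uy] := pselect (U y).
    by apply: lee_wpmul2r => //; rewrite -cE; exact: kernel_norm.
  under eq_integral do rewrite kernel_off// normr0.
  by rewrite integral0 mul0e mule_ge0.
rewrite ge0_integralZl//; last first.
  by apply/measurable_EFinP; apply: measurableT_comp => //; exact: measurable_L1.
by rewrite lte_mul_pinfty//; exact: integral_norm_lty.
Qed.

Let fubini_kernel y : fubini_G mu F y = ((\int[mu]_x kernel y x) * f y)%:E.
Proof.
rewrite /fubini_G /F /=; under eq_integral do rewrite mulrC EFinM.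
rewrite integralZl//; last exact: integrable_kernel.
rewrite mulrC EFinM /Rintegral fineK//.
by apply: integrable_fin_num => //; exact: integrable_kernel.
Qed.

Let integrable_G : mu.-integrable setT (fubini_G mu F).
Proof.
apply/integrableP; split; first exact: measurable_fubini_G integrable_F.
apply: le_lt_trans (proj1 (@integrable21ltyP _ _ _ _ _ mu mu F measurable_F) integrable_F).
apply: ge0_le_integral_nonmeasurable => y; first exact: abse_ge0.
apply: le_abse_integral => //.
exact: (measurable_fun_pair1 y measurable_F).
Qed.

(** The minorant [a] is the absolute value of the convolution at the scale [r x]; it is stated
    separately because it is measurable and can thus be summed over levels. *)
Lemma level_lower_bound : exists a : V -> \bar R,
  [/\ measurable_fun setT a, forall x, (0 <= a x)%E,
    forall x, G x -> (a x <= hardy_maximal phi f x)%E &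
    ((`|sigma| / 2)%:E * \int[mu]_(y in U) (h y)%:E <= \int[mu]_(x in G) a x)%E].
Proof.
exists (fun x => `|fubini_F mu F x|%E); split => //.
- by apply: measurableT_comp => //; exact: measurable_fubini_F integrable_F.
- move=> x Gx; have Ux : U x by case: Gx.
  rewrite /fubini_F /F /=.
  rewrite (_ : (\int[mu]_y _)%E = (convolution (dilate phi (r x)) f x)%:E).
    by apply: ereal_sup_ubound; exists (r x) => //=; exact: r0.
  rewrite /convolution /Rintegral fineK; last first.
    by apply: integrable_fin_num => //; exact: dilate_integrable (r0 Ux) fL.
  by apply: eq_integral => y _; rewrite /kernel indicE mem_set// mul1r.
rewrite [leRHS](_ : _ = \int[mu]_x `|fubini_F mu F x|)%E; last first.
  rewrite integral_mkcond; apply: eq_integral => x _; rewrite /patch.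
  case: ifPn => // Gx; rewrite /fubini_F /F /=.
  rewrite integral0_eq ?abse0// => y _.
  by rewrite /kernel indicE (negbTE Gx) !mul0r.
(* After Fubini, [h y] is multiplied by the integral of [kernel y], which is within [|sigma| / 2] of
   [sigma]; the sign of [sigma] makes this factor at least [|sigma| / 2]. *)
apply: (@le_trans _ _ `|(Num.sg sigma)%:E * \int[mu]_x fubini_F mu F x|%E); last first.
  rewrite abseM; apply: (@le_trans _ _ (1 * `|\int[mu]_x fubini_F mu F x|)%E).
    apply: lee_wpmul2r => //=; rewrite lee_fin normr_sg.
    by case: eqP.
  rewrite mul1e; apply: le_abse_integral => //.
  exact: measurable_fubini_F integrable_F.
rewrite (Fubini integrable_F); apply: le_trans (lee_abs _).
rewrite -[X in (_ <= _ * X)%E]/(\int[mu]_y fubini_G mu F y)%E -(integralZl measurableT integrable_G).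
have sh0 : 0 <= `|sigma| / 2 by [].
rewrite -[leLHS]ge0_integralZl//; last 2 first.
- by apply/measurable_EFinP; exact: measurable_funS mh.
- by move=> y _; rewrite lee_fin.
rewrite integral_mkcond.
have H y : ((((fun y => (`|sigma| / 2)%:E * (h y)%:E) \_ U) y <=
   (Num.sg sigma)%:E * fubini_G mu F y) /\ 0 <= ((fun y => (`|sigma| / 2)%:E * (h y)%:E) \_ U) y)%E.
  rewrite fubini_kernel /patch; case: ifPn => [|/negP]; rewrite inE => Uy; last first.
    by rewrite /Rintegral; under eq_integral do rewrite kernel_off//;
      rewrite integral0 mul0r mule0.
  rewrite -!EFinM !lee_fin fhU// mulrA; split; last by rewrite mulr_ge0.
  rewrite ler_wpM2r//; have := integral_kernel Uy; set b := Rintegral _ _ _ => bs.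
  have -> : Num.sg sigma * b = `|sigma| + Num.sg sigma * (b - sigma).
    by rewrite (normrEsg sigma); ring.
  have : `|Num.sg sigma * (b - sigma)| <= `|sigma| / 2.
    apply: le_trans bs; rewrite normrM ler_piMl// normr_sg.
    by case: eqP.
  by rewrite ler_norml => /andP[]; lra.
apply: ge0_le_integral => //.
- by move=> y _; have [] := H y.
- apply: (proj1 (measurable_restrictT _ mU)); apply: measurable_funeM.
  by apply/measurable_EFinP; exact: measurable_funS mh.
- apply: measurable_funeM; exact: measurable_fubini_G integrable_F.
- by move=> y _; have [] := H y.
Qed.

End level_lower_bound.

(** Each summand receives half of [s]: [del] is fixed by the first, then [A] by the second, which
    involves [del ^- n]. [2 <= A] makes the levels [A ^+ j] grow geometrically. *)
Lemma heavy_scales_exist {R : realType} n (K C0 s : R) : 0 <= K -> 0 <= C0 -> 0 < s ->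
  exists del A : R, [/\ 0 < del, del <= 1 / 4, 2 <= A, 5 ^+ n <= A &
    K * del * 6 ^+ n + C0 * del ^- n * (30 ^+ n / A) <= s].
Proof.
move=> K0 C00 s0.
have k6 : 0 <= K * 6 ^+ n by rewrite mulr_ge0// exprn_ge0.
have k61 : 0 < 2 * (K * 6 ^+ n + 1) by lra.
pose del := Num.min (1 / 4) (s / (2 * (K * 6 ^+ n + 1))).
have del0 : 0 < del by rewrite lt_min divr_gt0//= divr_gt0.
have h1 : K * del * 6 ^+ n <= s / 2.
  rewrite mulrAC; apply: (@le_trans _ _ (K * 6 ^+ n * (s / (2 * (K * 6 ^+ n + 1))))).
    by rewrite ler_wpM2l// ge_min lexx orbT.
  rewrite mulrA ler_pdivrMr//; have := mulr_ge0 k6 (ltW s0); lra.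
pose c := C0 * del ^- n * 30 ^+ n.
have c0 : 0 <= c by rewrite !mulr_ge0// ?invr_ge0 exprn_ge0// ltW.
pose A := Num.max 2 (Num.max (5 ^+ n) (2 * c / s)).
have A2 : 2 <= A by rewrite le_max lexx.
have A0 : 0 < A by lra.
exists del, A; split => //.
- by rewrite ge_min lexx.
- by rewrite !le_max lexx orbT.
have : c / A <= s / 2.
  rewrite ler_pdivrMr//.
  have : 2 * c / s <= A by rewrite !le_max lexx !orbT.
  by rewrite ler_pdivrMr//; lra.
by rewrite /c; lra.
Qed.

(** * Integrability of h ln_+ h *)

Section height.
Context {R : realType} {n : nat}.
Local Notation V := ('rV[R]_n).
Local Notation mu := (lebesgue_rV R n).
Implicit Types (x y z : V) (l : R).
Hypothesis n_gt0 : (0 < n)%N.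
Variables (phi : V -> R) (C0 L : R).
Hypotheses (phi_cont : continuous phi) (phi_supp : forall x, 1 < `|x| -> phi x = 0).
Hypotheses (C00 : 0 < C0) (phi_le : forall x, `|phi x| <= C0).
Hypotheses (L0 : 0 < L) (phi_lip : forall x y, `|phi x - phi y| <= L * `|x - y|).
Hypothesis phi_int : \int[mu]_x phi x != 0.
Variable h : V -> R.
Hypotheses (h0 : forall x, 0 <= h x) (hL : L1 h).

Let mh := measurable_L1 hL.
Let Ih := fine (\int[mu]_x (h x)%:E)%E.

Let IhE : (\int[mu]_x (h x)%:E)%E = Ih%:E.
Proof.
rewrite fineK// ge0_fin_numE; last by apply: integral_ge0 => x _; rewrite lee_fin.
by apply: (nonneg_integral_lty h0 hL).
Qed.

Let Ih0 : 0 <= Ih.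
Proof. by apply: fine_ge0; apply: integral_ge0 => x _; rewrite lee_fin. Qed.

Let heavy_le l : 0 < l -> (mu (heavy_set h l) <= (3 ^+ n / l * Ih)%:E)%E.
Proof. by move=> l0; rewrite EFinM -IhE; exact: heavy_set_weak. Qed.

(** A heavy set has finite measure, whereas in positive dimension the cubes have unbounded
    measure. *)
Lemma heavy_set_proper l : 0 < l -> exists z, ~ heavy_set h l z.
Proof.
move=> l0; apply: contrapT => nz.
have hT : heavy_set h l = setT.
  by rewrite -subTset => z _; apply: contrapT => hz; apply: nz; exists z.
pose c : R := 3 ^+ n / l * Ih.
have c0 : 0 <= c by rewrite !mulr_ge0 ?invr_ge0// ltW.
have : (mu (ball (0%R : V) (c + 1)%R) <= c%:E)%E.
  apply: le_trans (heavy_le l0); rewrite hT; apply: le_measure; rewrite ?inE//.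
  exact: measurable_rV_ball.
rewrite lebesgue_rV_ballM; last lra.
rewrite lee_fin leNgt => /negP; apply.
have c1 : 1 <= 2 * (c + 1) by lra.
apply: (@lt_le_trans _ _ (2 * (c + 1))); first lra.
by rewrite -[leLHS]expr1 ler_weXn2l.
Qed.

Lemma heavy_set_homo l1 l2 : l1 <= l2 -> heavy_set h l2 `<=` heavy_set h l1.
Proof.
move=> l12; apply: heavy_set_sub => i i0; apply: le_lt_trans.
by rewrite lee_fin ler_wpM2r// exprn_ge0// mulr_ge0// ltW.
Qed.

(** Passes from level sets of the maximal function to level sets of [h], which are the ones that
    build [ln_plus (h y)]. *)
Lemma integral_gt_le_heavy l : 0 < l ->
  (\int[mu]_(x in [set x | (2 * 3 ^+ n * l < h x)%R]) (h x)%:E <=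
   \int[mu]_(x in heavy_set h l) (h x)%:E)%E.
Proof.
move=> l0; have null := heavy_set_ae_above h0 hL l0.
set E := [set x | _].
have mE : measurable E by exact: measurable_gt_level.
have mU : measurable (heavy_set h l) by exact: measurable_heavy_set.
rewrite (@ge0_negligible_integral _ _ _ mu E (E `\` heavy_set h l))//.
- apply: integral_ge0_subset => //.
    by apply: measurableD => //; exact: measurableD.
  by move=> x [Ex nEx]; apply: contrapT => hx; apply: nEx.
- exact: measurableD.
- by apply/measurable_EFinP; exact: measurable_funS mh.
- by move=> x _; rewrite lee_fin.
Qed.

Hypothesis Mfin : forall f : V -> R, L1 f -> (forall x, `|f x| <= h x) ->
  \int[mu]_x f x = 0 -> (\int[mu]_x hardy_maximal phi f x < +oo)%E.

Lemma height_integral_lty : (\int[mu]_y (h y * ln_plus (h y))%:E < +oo)%E.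
Proof.
pose sigma : R := \int[mu]_x phi x.
have s0 : 0 < `|sigma| / 2 by rewrite divr_gt0// normr_gt0.
have K0 : 0 <= perturb_const (n := n) C0 L by rewrite addr_ge0// !mulr_ge0// ltW.
have [del [A [del0 del4 A2 A5 small]]] := heavy_scales_exist n K0 (ltW C00) s0.
have A0 : 0 < A by lra.
have Aj0 j : 0 < A ^+ j by rewrite exprn_gt0.
have Aj j : j%:R <= A ^+ j.
  apply: (@le_trans _ _ (2 ^+ j)); last by rewrite lerXn2r// nnegrE ltW.
  by rewrite -natrX ler_nat ltnW// ltn_expl.
pose E j := heavy_set h (A ^+ j).
have mE j : measurable (E j) by exact: measurable_heavy_set.
have E_S j : E j.+1 `<=` E j.
  by apply: heavy_set_homo; rewrite exprS ler_peMl ?(ltW (Aj0 j))//; lra.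
have ndE : nonincreasing_seq E.
  by apply/nonincreasing_seqP => j; apply/subsetPset; exact: E_S.
have E0 : mu (\bigcap_j E j) = 0%E.
  have mcap : measurable (\bigcap_j E j) by exact: bigcapT_measurable.
  have le j : (mu (\bigcap_j E j) <= (3 ^+ n / A ^+ j * Ih)%:E)%E.
    apply: le_trans (heavy_le (Aj0 j)).
    by apply: le_measure; rewrite ?inE; [exact: mcap|exact: mE|move=> x; exact].
  have mu0 : (0 <= mu (\bigcap_j E j))%E by [].
  move: (mu _) mu0 le => [m| |] // m0 le; last first.
    by have := le 0%N.
  congr EFin; apply/eqP; move: m0; rewrite lee_fin => m0.
  rewrite eq_le m0 andbT leNgt; apply/negP => mpos.
  pose c := 3 ^+ n * Ih.
  have := le (Num.truncn (c / m)).+1; rewrite lee_fin mulrAC ler_pdivlMr//.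
  rewrite leNgt => /negP; apply.
  have /lt_le_trans -> // : c < m * (Num.truncn (c / m)).+1%:R.
    by rewrite mulrC -ltr_pdivrMr//; exact: truncnS_gt.
  by rewrite ler_wpM2l// ltW.
(* [A ^+ j0] is the starting level; all later heavy sets lie in [E j0], so that one balanced [f]
   serves every level. *)
have [j0 bal] := small_tail h0 hL mE ndE E0.
have [f [fL fh fE f_int]] := balance h0 hL (mE j0) bal.
have U_sub (i : nat) : E (j0 + i)%N `<=` E j0 by apply/subsetPset/ndE/leq_addr.
pose G (i : nat) := E (j0 + i)%N `\` E (j0 + i.+1)%N.
have lower i : exists a : V -> \bar R,
  [/\ measurable_fun setT a, forall x, (0 <= a x)%E,
    forall x, G i x -> (a x <= hardy_maximal phi f x)%E &
    ((`|sigma| / 2)%:E * \int[mu]_(y in E (j0 + i)%N) (h y)%:E <= \int[mu]_(x in G i) a x)%E].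
  have [z1 Uz1] := heavy_set_proper (Aj0 (j0 + i)%N).
  have := level_lower_bound phi_cont phi_supp C00 phi_le L0 phi_lip h0 hL fL
    (Aj0 (j0 + i)%N) A5 del0 del4 small Uz1 (fun y Uy => fE y (@U_sub i y Uy)).
  by rewrite -exprS -addnS.
have [a Ha] := choice lower.
have sum_lty : (\sum_(i <oo) \int[mu]_(y in E (j0 + i)%N) (h y)%:E < +oo)%E.
  apply: (lty_of_mull s0).
  rewrite -nneseriesZl; last by move=> i _; apply: integral_ge0 => y _; rewrite lee_fin.
  apply: le_lt_trans (Mfin fL fh f_int).
  apply: le_trans (_ : \sum_(i <oo) \int[mu]_(x in G i) a i x <= _)%E.
    apply: lee_nneseries => [i _ _|i _]; last by have [] := Ha i.
    rewrite mule_ge0//.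
    by apply: integral_ge0 => y _; rewrite lee_fin.
  apply: disjoint_sum_integral_le.
  - have H i j x : (i < j)%N -> G i x -> G j x -> False.
      move=> ij [_ nx] [jx _]; apply: nx; move: x jx; apply/subsetPset/ndE.
      by rewrite leq_add2l.
    apply/trivIsetP => i j _ _ ij; rewrite -subset0 => x [xi xj].
    by move: ij; rewrite neq_ltn => /orP[] lt; [exact: (H _ _ _ lt xi xj)|exact: (H _ _ _ lt xj xi)].
  - by move=> i; exact: measurableD.
  - by move=> i; have [] := Ha i.
  - by move=> i; have [] := Ha i.
  - exact: hardy_maximal_ge0.
  - by move=> i; have [] := Ha i.
have c0 : 0 < 2 * 3 ^+ n * A ^+ j0 by rewrite !mulr_gt0// exprn_gt0.
have A1 : 1 < A by lra.
apply: (integral_ln_plus_lty h0 hL mh h0 c0 A1).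
apply: le_lt_trans sum_lty; apply: lee_nneseries => [i _ _|i _].
  by apply: integral_ge0 => y _; rewrite lee_fin.
rewrite (_ : 2 * 3 ^+ n * A ^+ j0 * A ^+ i = 2 * 3 ^+ n * A ^+ (j0 + i))%R.
  exact: integral_gt_le_heavy.
by rewrite exprD mulrA.
Qed.

End height.

(** * A cube on which the bump function does not vanish *)

Section nonvanishing.
Context {R : realType} {n : nat}.
Local Notation V := ('rV[R]_n).
Local Notation mu := (lebesgue_rV R n).
Variable phi : V -> R.
Hypothesis phi_cont : continuous phi.

Lemma nonvanishing_near (w : V) : phi w != 0 ->
  exists2 e : R, 0 < e & forall z : V, `|w - z| < e -> `|phi w| / 2 <= `|phi z|.
Proof.
move=> w0; have e0 : 0 < `|phi w| / 2 by rewrite divr_gt0// normr_gt0.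
have cw : phi @ w --> phi w by exact: phi_cont.
have /nbhs_ballP[e /= e1 we] := proj1 (@cvgrPdist_lt R R V _ (nbhs_filter (w : V)) _ _) cw _ e0.
exists e => // z wz; have := we z (proj2 (rV_ballP w z e) wz) => /= h.
have := lerB_dist (phi w) (phi z); lra.
Qed.

(** A nonzero integral gives a point where [phi] is nonzero; if that point is 0, continuity allows
    moving it to a nearby constant vector. The bound on [rho] serves the disjointness of the dilated
    cubes. *)
Lemma bump_nonvanishing : (0 < n)%N -> (forall x, 1 < `|x| -> phi x = 0) ->
  \int[mu]_x phi x != 0 ->
  exists z0 rho eta, [/\ 0 < rho, 4 * rho <= `|z0|, `|z0| <= 1, 0 < eta &
    forall z, `|z0 - z| < rho -> eta <= `|phi z|].
Proof.
move=> n0 supp int0.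
have [w w0] : exists w, phi w != 0.
  apply: contrapT => nw; move/eqP: int0; apply.
  have -> : phi = cst 0.
    by apply/funext => x; apply/eqP/negP => /negP px; apply: nw; exists x.
  by rewrite /Rintegral integral0.
have [z0 z00 pz0] : exists2 z0, z0 != 0 & phi z0 != 0.
  have [w00|] := eqVneq w 0; last by exists w.
  have [e e0 we] := nonvanishing_near w0.
  have zi : (const_mx (e / 2) : V) ord0 (Ordinal n0) = e / 2 by rewrite mxE.
  exists (const_mx (e / 2)).
    by apply/negP => /eqP z0; move: zi; rewrite z0 mxE; lra.
  have : `|w - const_mx (e / 2)| < e.
    rewrite w00 sub0r normrN; apply/rV_norm_ltP => // i.
    by rewrite mxE gtr0_norm; lra.
  move=> /we; rewrite -normr_gt0; apply: lt_le_trans.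
  by rewrite divr_gt0// normr_gt0.
have [e e0 ze] := nonvanishing_near pz0.
exists z0, (Num.min e (`|z0| / 4)), (`|phi z0| / 2); split.
- by rewrite lt_min e0 divr_gt0// normr_gt0.
- have : Num.min e (`|z0| / 4) <= `|z0| / 4 by rewrite ge_min lexx orbT.
  lra.
- by rewrite leNgt; apply/negP => /supp p0; rewrite p0 eqxx in pz0.
- by rewrite divr_gt0// normr_gt0.
- by move=> z; rewrite lt_min => /andP[/ze].
Qed.

End nonvanishing.

(** * Maximality of LlogL *)

Section maximality.
Context {R : realType} {n : nat}.
Local Notation V := ('rV[R]_n).
Local Notation mu := (lebesgue_rV R n).
Hypothesis n_gt0 : (0 < n)%N.
Variable phi : V -> R.
Hypotheses (phi_smooth : smooth_fun phi) (phi_supp : forall x, 1 < euclid_norm x -> phi x = 0).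
Hypothesis phi_int : \int[mu]_x phi x != 0.

Lemma LlogL_maximal (S : set (V -> R)) :
  L1_subspace S -> dominated_in_hardy phi S -> S `<=` LlogL.
Proof.
move=> [_ SL1] SH g Sg; have gL := SL1 _ Sg.
have supp x : 1 < `|x| -> phi x = 0.
  by move=> x1; apply: phi_supp; apply: lt_le_trans x1 (norm_le_euclid x).
have cphi := bump_continuous phi_smooth.
have [C C0 phiC] := bounded_of_support cphi supp.
have [L L0 phiL] := bump_lipschitz phi_smooth supp.
pose h (x : V) : R := `|g x|.
have h0 x : 0 <= h x by exact: normr_ge0.
have hL : L1 h.
  by have := integrable_abse gL; apply: eq_integrable.
have mh := measurable_L1 hL.
have Mfin f : L1 f -> (forall x, `|f x| <= h x) -> \int[mu]_x f x = 0 ->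
    (\int[mu]_x hardy_maximal phi f x < +oo)%E.
  move=> fL fh f0; have [] := SH g f Sg fL _ f0; first exact: aeW.
  move=> _; rewrite Lnorm1; apply: le_lt_trans.
  by under [leRHS]eq_integral => x _ do rewrite gee0_abs ?hardy_maximal_ge0//.
have height := height_integral_lty n_gt0 cphi supp C0 phiC L0 phiL phi_int h0 hL Mfin.
(* A second test function is needed here: it agrees with [h] far from the origin instead of where
   [h] has large means. *)
pose E j : set V := ~` ball (0 : V) (2 ^+ j).
have mE j : measurable (E j) by apply: measurableC; exact: measurable_rV_ball.
have ndE : nonincreasing_seq E.
  apply/nonincreasing_seqP => j; apply/subsetPset; apply: subsetC.
  by apply: le_ball; rewrite ler_weXn2l// ler1n.
have E0 : mu (\bigcap_j E j) = 0%E.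
  rewrite (_ : \bigcap_j E j = set0) ?measure0// -subset0 => x /(_ (Num.truncn `|x|).+1 I).
  apply; apply/rV_ballP; rewrite sub0r normrN; apply: lt_trans (truncnS_gt _) _.
  by rewrite -natrX ltr_nat ltn_expl.
have [j bal] := small_tail h0 hL mE ndE E0.
have [f [fL fh fE f_int]] := balance h0 hL (mE j) bal.
have [z0 [rho [eta [rho0 rhoz z01 eta0 eta_le]]]] := bump_nonvanishing cphi n_gt0 supp phi_int.
have J0 : 0 < 2 ^+ j :> R by rewrite exprn_gt0.
have far y : 2 ^+ j <= `|y| -> f y = h y.
  by move=> yj; apply: fE => /rV_ballP; rewrite sub0r normrN ltNge yj.
have tail := tail_integral_lty cphi supp C0 phiC L0 phiL rho0 rhoz z01 eta0 eta_le
  h0 hL fL J0 fh far f_int (Mfin f fL fh f_int).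
have n1 : 1 <= n%:R :> R by rewrite ler1n.
have ln0 : 0 <= ln n%:R :> R by exact: ln_ge0.
split => //.
(* The term with [ln n%:R] is the cost of replacing the Euclidean norm by the sup norm inside
   [ln_plus]. *)
apply: (@le_lt_trans _ _ (\int[mu]_x ((h x * ln_plus (h x))%:E +
  ((h x * ln_plus `|x|)%:E + (ln n%:R)%:E * (h x)%:E)))%E).
  apply: ge0_le_integral_nonmeasurable => x.
    by rewrite lee_fin mulr_ge0// addr_ge0// ln_plus_ge0.
  rewrite -EFinM -!EFinD lee_fin -/(h x).
  rewrite (mulrC (ln _)) -!mulrDr ler_wpM2l// lerD2l.
  apply: le_trans (ln_plusM _ n1); last by [].
  by apply: ln_plus_le; rewrite mulrC; exact: euclid_le_norm.
have mln1 : measurable_fun setT (fun x => (h x * ln_plus (h x))%:E).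
  apply/measurable_EFinP; apply: measurable_funM => //.
  exact: (measurableT_comp measurable_ln_plus).
have mln2 : measurable_fun setT (fun x : V => (h x * ln_plus `|x|)%:E).
  apply/measurable_EFinP; apply: measurable_funM => //.
  exact: (measurableT_comp measurable_ln_plus measurable_norm_rV).
have mln3 : measurable_fun setT (fun x => (ln n%:R)%:E * (h x)%:E)%E.
  by apply: measurable_funeM; exact/measurable_EFinP.
rewrite ge0_integralD//; last 3 first.
- by move=> x _; rewrite lee_fin mulr_ge0// ln_plus_ge0.
- by move=> x _; rewrite -EFinM -EFinD lee_fin addr_ge0// mulr_ge0// ln_plus_ge0.
- exact: emeasurable_funD.
apply: lte_add_pinfty => //; rewrite ge0_integralD//; last 2 first.
- by move=> x _; rewrite lee_fin mulr_ge0// ln_plus_ge0.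
- by move=> x _; rewrite -EFinM lee_fin mulr_ge0.
apply: lte_add_pinfty => //; rewrite ge0_integralZl//.
- by rewrite lte_mul_pinfty ?lee_fin//; apply: (nonneg_integral_lty h0 hL).
- exact/measurable_EFinP.
- by move=> x _; rewrite lee_fin.
Qed.

End maximality.

Theorem mainTheorem2 (R : realType) (n : nat) (n_gt0 : (0 < n)%N)
    (phi : 'rV[R]_n -> R) (phi_smooth : smooth_fun phi)
    (phi_supp : forall x, 1 < euclid_norm x -> phi x = 0)
    (phi_int : \int[lebesgue_rV R n]_x phi x != 0) :
  [/\ L1_subspace (@LlogL R n),
      dominated_in_hardy phi LlogL &
      forall S : set ('rV[R]_n -> R),
        L1_subspace S -> dominated_in_hardy phi S -> S `<=` LlogL].
Proof.
split; first exact: LlogL_subspace.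
  exact: LlogL_dominated_in_hardy.
by move=> S; exact: LlogL_maximal.
Qed.
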